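(* For $A\in C^\infty_{\mathbb R}(S^1)$, $$\|\dot Z_A\|_{\mathrm{HS}}^2=\frac16\sum_{n=2}^\infty(n^3-n)|\widehat A(-n)|^2 .$$ Consequently, after quotienting out the Möbius modes $\operatorname{span}_{\mathbb R}\{1,\cos\theta,\sin\theta\}$, the differential $A\mapsto\dot Z_A$ extends by completion from smooth vector fields to the Weil--Petersson tangent space, i.e. real-valued $H^{3/2}(S^1)$ modulo $\operatorname{span}_{\mathbb R}\{1,\cos\theta,\sin\theta\}$, with values in the Hilbert--Schmidt operators $\mathrm{HS}(H^{1/2}_+,H^{1/2}_-)$. The right-hand side of the formula is, up to a constant factor, the Weil--Petersson quadratic form at the base point. Hence the extended differential identifies the completed Weil--Petersson tangent space with its image in $\mathrm{HS}(H^{1/2}_+,H^{1/2}_-)$.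
   Context: $H^{1/2}(S^1)$ is the Hilbert space of (classes modulo constants of) complex-valued functions $u$ on $S^1$ with $\|u\|_{H^{1/2}}^2=\sum_{n\ne0}|n||\widehat u(n)|^2<\infty$, $\widehat u(n)=\frac1{2\pi}\int_0^{2\pi}u(e^{i\theta})e^{-in\theta}d\theta$. $H^{1/2}_+$ and $H^{1/2}_-$ are the closed spans of $\{e^{in\theta}:n\ge1\}$ and $\{e^{-in\theta}:n\ge1\}$, with orthogonal projections $P_\pm$; $e_m^+=e^{im\theta}/\sqrt m$, $m\ge1$, is an orthonormal basis of $H^{1/2}_+$. For $T:H^{1/2}_+\to H^{1/2}_-$, $\|T\|_{\mathrm{HS}}^2=\sum_{m\ge1}\|Te_m^+\|^2_{H^{1/2}}$, and $T$ is Hilbert--Schmidt if this is finite. For an orientation-preserving $C^\infty$ diffeomorphism $h$ of $S^1$, $V_hu=u\circ h$ is bounded and invertible on $H^{1/2}(S^1)$; put $A_h=P_+V_h|_{H^{1/2}_+}$, $B_h=P_-V_h|_{H^{1/2}_+}$. $A_h$ is an isomorphism of $H^{1/2}_+$ and $Z_h=B_hA_h^{-1}:H^{1/2}_+\to H^{1/2}_-$. A smooth path $h_t$ in $\mathrm{Diff}_+(S^1)$ (real $t$ near $0$, $h_0=\mathrm{id}$) has initial vector field $A\in C^\infty_{\mathbb R}(S^1)$ if, with angular lifts $h_t(e^{i\theta})=e^{i\varphi_t(\theta)}$, one has $\varphi_t(\theta)=\theta+tA(\theta)+o(t)$ in $C^\infty(S^1)$. For such a path the operator-norm derivative $\dot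 Z_A=\frac{d}{dt}\big|_{t=0}Z_{h_t}$ exists and depends only on $A$. $H^{3/2}(S^1)$ is the space of functions $f$ on $S^1$ with $\sum_{n\in\mathbb Z}|n|^3|\widehat f(n)|^2<\infty$. The tangent space of the Weil--Petersson universal Teichmüller space at the base point is identified with (real-valued) $H^{3/2}(S^1)$ modulo infinitesimal Möbius transformations $\operatorname{span}_{\mathbb R}\{1,\cos\theta,\sin\theta\}$, and the Weil--Petersson quadratic form at the base point is, up to a positive constant factor, $A\mapsto\sum_{n\ge2}(n^3-n)|\widehat A(-n)|^2$. *)

(* Defs.v *)
From HB Require Import structures.
From mathcomp Require Import all_boot all_order all_algebra.
From mathcomp Require Import all_classical all_reals all_analysis.
From mathcomp Require Import complex.

Set Implicit Arguments.
Unset Strict Implicit.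
Unset Printing Implicit Defensive.

Import Order.TTheory GRing.Theory Num.Theory.
Import numFieldNormedType.Exports.

Local Open Scope classical_set_scope.
Local Open Scope ring_scope.
Local Open Scope complex_scope.

(* The circle is R / 2 pi Z: a function on S^1 is a function of the angle that
   is 2 pi-periodic, and a diffeomorphism of S^1 is represented by an angular
   lift. *)

Section Fourier.
Context {R : realType}.
Implicit Types (u v : R -> R[i]) (f g : R -> R).

Definition periodic (T : Type) (w : R -> T) : Prop :=
  forall x, w (x + 2 * pi) = w x.

Definition emode (n : int) (x : R) : R[i] :=
  cos (n%:~R * x) +i* sin (n%:~R * x).

Definition cintegral u : R[i] :=
  (\int[lebesgue_measure]_(x in `[0, 2 * pi]) complex.Re (u x)) +i*
  (\int[lebesgue_measure]_(x in `[0, 2 * pi]) complex.Im (u x)).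

Definition fourier u (n : int) : R[i] :=
  ((2 * pi)^-1)%:C * cintegral (fun x => u x * emode (- n) x).

Definition fourierR f (n : int) : R[i] := fourier (fun x => (f x)%:C) n.

Definition sqnormc (z : R[i]) : R := complex.Re z ^+ 2 + complex.Im z ^+ 2.

Definition circle_L2 u : Prop :=
  [/\ periodic u,
      measurable_fun setT (fun x => complex.Re (u x)),
      measurable_fun setT (fun x => complex.Im (u x)) &
      (\int[lebesgue_measure]_(x in `[0%R, (2 * pi)%R]) (sqnormc (u x))%:E
        < +oo)%E].

(* sum over n of |n|^s |u^(n)|^2; for s > 0 the mode n = 0 does not count. *)
Definition sobolev (s : nat) u : \bar R :=
  \esum_(n in [set: int]) ((`|n|%N%:R ^+ s * sqnormc (fourier u n))%:E).

End Fourier.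

Section HalfSpace.
Context {R : realType}.
Implicit Types (u v w : R -> R[i]).

(* Elements of the Hilbert space H^{1/2} are represented by functions, and two
   of them are equal when the functions differ by a constant a.e.: [eqH]. *)
Definition H12 u : Prop := circle_L2 u /\ (sobolev 1 u < +oo)%E.

Definition eqH u v : Prop :=
  exists c : R[i], {ae lebesgue_measure, forall x : R, u x = v x + c}.

Definition normH2 u : \bar R := sobolev 1 u.

Definition innerH u v : R[i] :=
  let a (n : int) := `|n|%N%:R * (fourier u n * (fourier v n)^*) in
  limn (fun N => \sum_(1 <= n < N) complex.Re (a n%:Z + a (- n%:Z))) +i*
  limn (fun N => \sum_(1 <= n < N) complex.Im (a n%:Z + a (- n%:Z))).

Definition closed_span (e : nat -> R -> R[i]) u : Prop :=
  H12 u /\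
  forall eps : R, 0 < eps -> exists (N : nat) (c : nat -> R[i]),
    (normH2 (fun x => u x - \sum_(1 <= n < N) c n * e n x)%R < eps%:E)%E.

Definition Hplus : (R -> R[i]) -> Prop := closed_span (fun n => emode n%:Z).
Definition Hminus : (R -> R[i]) -> Prop :=
  closed_span (fun n => emode (- n%:Z)).

(* A representative of the orthogonal projection of u on the subspace S; it is
   determined up to [eqH]. *)
Definition proj (S : (R -> R[i]) -> Prop) u : R -> R[i] :=
  xget (fun=> 0)
    [set v | S v /\ forall w, S w -> innerH (fun x => u x - v x) w = 0].

Definition Pplus := proj Hplus.
Definition Pminus := proj Hminus.

End HalfSpace.

Section Operators.
Context {R : realType}.
Implicit Types (u v : R -> R[i]) (T U : (R -> R[i]) -> (R -> R[i])).

(* Norms are compared through their squares, which live in \bar R. *)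
Definition op_norm_le (S : (R -> R[i]) -> Prop) T (M : R) : Prop :=
  0 <= M /\ forall u, S u -> (normH2 (T u) <= (M ^+ 2)%:E * normH2 u)%E.

(* These conditions make T compatible with [eqH]. *)
Definition bounded_op (S1 S2 : (R -> R[i]) -> Prop) T : Prop :=
  [/\ forall u, S1 u -> S2 (T u),
      forall (a : R[i]) u v, S1 u -> S1 v ->
        eqH (T (fun x => a * u x + v x)) (fun x => a * T u x + T v x) &
      exists M, op_norm_le S1 T M].

Definition eq_op_plus T U : Prop := forall u, Hplus u -> eqH (T u) (U u).

Definition eplus (m : nat) (x : R) : R[i] :=
  ((Num.sqrt m%:R)^-1)%:C * emode m%:Z x.

Definition HS_norm2 T : \bar R :=
  (\sum_(1 <= m <oo) normH2 (T (eplus m)))%E.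

Definition hilbert_schmidt T : Prop :=
  bounded_op Hplus Hminus T /\ (HS_norm2 T < +oo)%E.

End Operators.

Section Diffeomorphisms.
Context {R : realType}.
Implicit Types (A f phi : R -> R) (T Z : (R -> R[i]) -> (R -> R[i])).

Definition smooth f : Prop := forall (n : nat) (x : R), derivable (derive1n n f) x 1.

Definition smooth_field A : Prop := periodic A /\ smooth A.

(* The angular lifts of the orientation-preserving diffeomorphisms of S^1. *)
Definition diffeo phi : Prop :=
  [/\ smooth phi, forall x, phi (x + 2 * pi) = phi x + 2 * pi &
      forall x, 0 < derive1 phi x].

Definition Vop phi (u : R -> R[i]) : R -> R[i] := u \o phi.
Definition Aop phi (u : R -> R[i]) : R -> R[i] := Pplus (Vop phi u).
Definition Bop phi (u : R -> R[i]) : R -> R[i] := Pminus (Vop phi u).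

(* Z represents Z_h = B_h A_h^{-1}, as an operator from H_+ to H_-. *)
Definition is_Z phi Z : Prop :=
  bounded_op Hplus Hminus Z /\
  exists Ainv : (R -> R[i]) -> (R -> R[i]),
    [/\ bounded_op Hplus Hplus Ainv,
        forall u, Hplus u -> eqH (Ainv (Aop phi u)) u,
        forall u, Hplus u -> eqH (Aop phi (Ainv u)) u &
        forall u, Hplus u -> eqH (Z u) (Bop phi (Ainv u))].

(* C^infinity in (t, x) for |t| < d; [D i j] is the derivative of order i in t
   and j in x. *)
Definition jointly_smooth (d : R) (F : R -> R -> R) : Prop :=
  exists D : nat -> nat -> R -> R -> R, D 0%N 0%N = F /\
    forall (i j : nat) (t x : R), `|t| < d ->
      [/\ is_derive t 1 (fun s => D i j s x) (D i.+1 j t x),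
          is_derive x 1 (D i j t) (D i j.+1 t x) &
          {for (t, x), continuous (fun p : R * R => D i j p.1 p.2)}].

Definition smooth_path (Phi : R -> R -> R) A : Prop :=
  [/\ forall x, Phi 0 x = x,
      exists d : R, [/\ 0 < d, jointly_smooth d Phi &
        forall t, `|t| < d -> diffeo (Phi t)] &
      forall (k : nat) (eps : R), 0 < eps -> \forall t \near (0 : R),
        forall x, `|derive1n k (fun y => Phi t y - y - t * A y) x| <= eps * `|t|].

(* T is the operator-norm derivative of t |-> Z_{h_t} at t = 0. *)
Definition Z_derivative (Phi : R -> R -> R) T : Prop :=
  bounded_op Hplus Hminus T /\
  exists Z : R -> (R -> R[i]) -> (R -> R[i]),
    (\forall t \near (0 : R), is_Z (Phi t) (Z t)) /\
    forall eps : R, 0 < eps -> \forall t \near (0 : R)^',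
      op_norm_le Hplus
        (fun u x => (t^-1)%:C * (Z t u x - Z 0 u x) - T u x) eps.

(* T represents the differential at the base point in the direction A: it is
   the derivative of Z along every smooth path with initial vector field A. *)
Definition is_Zdot A T : Prop :=
  forall Phi, smooth_path Phi A -> Z_derivative Phi T.

End Diffeomorphisms.

Section WeilPetersson.
Context {R : realType}.
Implicit Types (f g : R -> R) (E : (R -> R) -> (R -> R[i]) -> (R -> R[i])).

Definition H32 f : Prop :=
  circle_L2 (fun x => (f x)%:C) /\ (sobolev 3 (fun x => (f x)%:C) < +oo)%E.

Definition eq_mod_mobius f g : Prop :=
  exists a b c : R, {ae lebesgue_measure, forall x : R,
    f x = g x + (a + b * cos x + c * sin x)}.

Definition wp_sum f : \bar R :=
  (\sum_(2 <= n <oo)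
     ((n ^ 3 - n)%N%:R * sqnormc (fourierR f (- n%:Z)))%:E)%E.

(* The Weil-Petersson quadratic form, whose normalization is left free. *)
Definition weil_petersson_form (W : (R -> R) -> \bar R) : Prop :=
  exists c : R, 0 < c /\ forall f, H32 f -> W f = (c%:E * wp_sum f)%E.

(* H^{3/2} modulo Moebius, with the squared norm [wp_sum], is the completion of
   the smooth fields: they form a dense subspace, and the space is complete. *)
Definition smooth_dense : Prop :=
  (forall A : R -> R, smooth_field A -> H32 A) /\
  forall f, H32 f -> forall eps : R, 0 < eps ->
    exists A, smooth_field A /\ (wp_sum (fun x => f x - A x)%R < eps%:E)%E.

Definition wp_complete : Prop :=
  forall F : nat -> R -> R, (forall k, H32 (F k)) ->
    (forall eps : R, 0 < eps -> exists N : nat, forall m n : nat,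
       (N <= m)%N -> (N <= n)%N ->
       (wp_sum (fun x => F m x - F n x)%R < eps%:E)%E) ->
    exists f, H32 f /\ forall eps : R, 0 < eps ->
      exists N : nat, forall n : nat, (N <= n)%N ->
       (wp_sum (fun x => F n x - f x)%R < eps%:E)%E.

(* Bounded R-linear maps from H^{3/2} modulo Moebius to HS(H_+, H_-). *)
Definition bounded_to_HS E : Prop :=
  [/\ forall f, H32 f -> hilbert_schmidt (E f),
      forall f g, H32 f -> H32 g -> eq_mod_mobius f g -> eq_op_plus (E f) (E g),
      forall (a : R) f g, H32 f -> H32 g ->
        eq_op_plus (E (fun x => a * f x + g x))
                   (fun u x => a%:C * E f u x + E g u x) &
      exists M : R, forall f, H32 f -> (HS_norm2 (E f) <= M%:E * wp_sum f)%E].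

Definition extends_Zdot (Zdot : (R -> R) -> (R -> R[i]) -> (R -> R[i])) E :
    Prop :=
  bounded_to_HS E /\
  forall A, smooth_field A -> eq_op_plus (E A) (Zdot A).

End WeilPetersson.

(* Main.v *)
Require Import Defs.
From mathcomp Require Import all_boot all_order all_algebra.
From mathcomp Require Import all_classical all_reals all_analysis.
From mathcomp Require Import measurable_realfun complex.
From mathcomp Require Import ring lra zify.

Set Implicit Arguments.
Unset Strict Implicit.
Unset Printing Implicit Defensive.

Import Order.TTheory GRing.Theory Num.Theory.
Import numFieldNormedType.Exports.
Import Defs.

Local Open Scope classical_set_scope.
Local Open Scope ring_scope.
Local Open Scope complex_scope.

(** Why the theorem is true.

    For the path x + t A(x) write V_t for the composition operator and put
    w_t = P_+ V_t e_m. By the definition of Z_t one has Z_t w_t = P_- V_t e_m,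
    while w_t tends to e_m; so the derivative of Z at 0 maps e_m to P_- of the
    derivative of V_t e_m, which is i m A e_m. Hence the coefficient of the
    image of e_m at -k is i m A^(-(k+m)) ([Zdot_coef]). This needs the estimates
    [perturb_decay] and [perturb_coef] on V_t e_m - e_m, and the fact that
    composition with a diffeomorphism close to the identity respects equality
    almost everywhere ([negligible_preimage]), since elements of the Hilbert
    space are functions up to null sets and constants.

    In orthonormal bases the squared Hilbert-Schmidt norm is then the sum of
    k m |A^(-(k+m))|^2 over k, m >= 1. Along the antidiagonal k + m = j the
    weights k m add up to (j^3 - j) / 6 ([sum_convolution]), which gives the
    formula ([hankel_HS]).

    The formula i m f^(-(k+m)) makes sense for every f in H^{3/2} and defines
    [extension f]. The matrix sums converge absolutely
    ([hankel_double_summable]), so that the image of a function is again given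
    by an absolutely convergent Fourier series, and Cauchy-Schwarz bounds the
    operator by the same sum ([extension_bound]). Its Hilbert-Schmidt norm obeys
    the same formula, so its kernel consists of the f whose modes n <= -2
    vanish; for a real f these are the infinitesimal Moebius transformations
    ([fourier_moebius]).

    Smooth fields are dense because partial sums of a Fourier series are smooth
    ([smooth_fields_dense]), and two bounded maps that agree on them coincide
    ([extension_unique]). Completeness of the tangent space is that of a
    weighted l^2 space ([weil_petersson_complete]): for k >= 2 the weight
    k^3 - k is comparable to k^3, and a sequence of modes with finite weighted
    norm is absolutely summable, so it is the Fourier series of a function.

    Two facts about Fourier series carry all comparisons of functions: a square
    integrable function whose coefficients vanish is zero almost everywhere
    ([fourier_null_ae0]), and absolutely summable coefficients are those of
    their sum ([fourier_synth]). *)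

(** * Complex numbers and the exponentials *)

Section ComplexAlgebra.
Context {R : realType}.
Implicit Types (z w : R[i]) (x y : R) (m n : int).

Lemma cplx_eq z w : complex.Re z = complex.Re w -> complex.Im z = complex.Im w -> z = w.
Proof. by case: z w => a b [c d] /= -> ->. Qed.

Lemma cReD z w : complex.Re (z + w) = complex.Re z + complex.Re w.
Proof. by case: z w => a b []. Qed.
Lemma cImD z w : complex.Im (z + w) = complex.Im z + complex.Im w.
Proof. by case: z w => a b []. Qed.
Lemma cReN z : complex.Re (- z) = - complex.Re z.
Proof. by case: z. Qed.
Lemma cImN z : complex.Im (- z) = - complex.Im z.
Proof. by case: z. Qed.
Lemma cReM z w :
  complex.Re (z * w) = complex.Re z * complex.Re w - complex.Im z * complex.Im w.
Proof. by case: z w => a b []. Qed.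
Lemma cImM z w :
  complex.Im (z * w) = complex.Re z * complex.Im w + complex.Im z * complex.Re w.
Proof. by case: z w => a b []. Qed.
Lemma cImC x : complex.Im x%:C = 0. Proof. by []. Qed.
Lemma cRe0 : complex.Re (0 : R[i]) = 0. Proof. by []. Qed.
Lemma cIm0 : complex.Im (0 : R[i]) = 0. Proof. by []. Qed.
Lemma cRe1 : complex.Re (1 : R[i]) = 1. Proof. by []. Qed.
Lemma cIm1 : complex.Im (1 : R[i]) = 0. Proof. by []. Qed.
Lemma cReJ z : complex.Re (z^*) = complex.Re z. Proof. by case: z. Qed.
Lemma cImJ z : complex.Im (z^*) = - complex.Im z. Proof. by case: z. Qed.
Lemma RCM x y : (x * y)%:C = x%:C * y%:C.
Proof. by apply: cplx_eq; rewrite ?(cReM, cImM)/= ?mulr0 ?mul0r ?subr0 ?addr0. Qed.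
Lemma natC (k : nat) : k%:R = (k%:R : R)%:C :> R[i].
Proof. by rewrite rmorph_nat. Qed.
End ComplexAlgebra.

(** The operation is matched syntactically, which keeps unification from
    unfolding products of explicit complex numbers. *)
Ltac reim := repeat match goal with
  | |- context [complex.Re (?a + ?b)] => rewrite (cReD a b)
  | |- context [complex.Im (?a + ?b)] => rewrite (cImD a b)
  | |- context [complex.Re (?a * ?b)] => rewrite (cReM a b)
  | |- context [complex.Im (?a * ?b)] => rewrite (cImM a b)
  | |- context [complex.Re (- ?a)] => rewrite (cReN a)
  | |- context [complex.Im (- ?a)] => rewrite (cImN a)
  | |- context [complex.Re (?a^*)] => rewrite (cReJ a)
  | |- context [complex.Im (?a^*)] => rewrite (cImJ a)
  | |- context [complex.Re (?a%:C)] => change (complex.Re (a%:C)) with a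
  | |- context [complex.Im (?a%:C)] => rewrite (cImC a)
  | |- context [complex.Re (?a +i* ?b)] => change (complex.Re (a +i* b)) with a
  | |- context [complex.Im (?a +i* ?b)] => change (complex.Im (a +i* b)) with b
  | |- context [@complex.Re ?R 0] => rewrite (@cRe0 R)
  | |- context [@complex.Im ?R 0] => rewrite (@cIm0 R)
  | |- context [@complex.Re ?R 1] => rewrite (@cRe1 R)
  | |- context [@complex.Im ?R 1] => rewrite (@cIm1 R)
  end.

Section ComplexAlgebraTheory.
Context {R : realType}.
Implicit Types (z w : R[i]) (x y : R) (m n : int).

Lemma Re_sum (I : Type) (r : seq I) (P : pred I) (F : I -> R[i]) :
  complex.Re (\sum_(i <- r | P i) F i) = \sum_(i <- r | P i) complex.Re (F i).
Proof. by elim/big_rec2: _ => //= i a b _ <-; rewrite cReD. Qed.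

Lemma Im_sum (I : Type) (r : seq I) (P : pred I) (F : I -> R[i]) :
  complex.Im (\sum_(i <- r | P i) F i) = \sum_(i <- r | P i) complex.Im (F i).
Proof. by elim/big_rec2: _ => //= i a b _ <-; rewrite cImD. Qed.

Lemma sqnormc_ge0 z : 0 <= sqnormc z.
Proof. by rewrite addr_ge0 ?sqr_ge0. Qed.

Lemma sqnormc0 : sqnormc (0 : R[i]) = 0.
Proof. by rewrite /sqnormc; reim; ring. Qed.

Lemma sqnormc_eq0 z : sqnormc z = 0 -> z = 0.
Proof.
move=> /eqP; rewrite paddr_eq0 ?sqr_ge0// !sqrf_eq0 => /andP[/eqP a /eqP b].
exact: cplx_eq.
Qed.

Lemma sqnormcM z w : sqnormc (z * w) = sqnormc z * sqnormc w.
Proof. by rewrite /sqnormc; reim; ring. Qed.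

Lemma sqnormcN z : sqnormc (- z) = sqnormc z.
Proof. by rewrite /sqnormc; reim; ring. Qed.

Lemma sqnormcJ z : sqnormc z^* = sqnormc z.
Proof. by rewrite /sqnormc; reim; ring. Qed.

Lemma sqnormcC x : sqnormc x%:C = x ^+ 2.
Proof. by rewrite /sqnormc; reim; ring. Qed.

Lemma sqnormc_nat (k : nat) : sqnormc (k%:R : R[i]) = k%:R ^+ 2.
Proof. by rewrite natC sqnormcC. Qed.

Lemma sqnormci : sqnormc ('i : R[i]) = 1.
Proof. by rewrite /sqnormc/= expr0n expr1n add0r. Qed.

Lemma sqnormcD z w : sqnormc (z + w) <= 2 * sqnormc z + 2 * sqnormc w.
Proof.
rewrite -subr_ge0 (_ : _ - _ = sqnormc (z - w)) ?sqnormc_ge0//.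
by rewrite /sqnormc; reim; ring.
Qed.

Lemma sqnormcB z w : sqnormc (z - w) <= 2 * sqnormc z + 2 * sqnormc w.
Proof. by rewrite -(sqnormcN w) sqnormcD. Qed.

Lemma Re_le_sqnormc z : complex.Re z ^+ 2 <= sqnormc z.
Proof. by rewrite lerDl sqr_ge0. Qed.

Lemma Im_le_sqnormc z : complex.Im z ^+ 2 <= sqnormc z.
Proof. by rewrite lerDr sqr_ge0. Qed.

Lemma emodeD m n x : emode (m + n) x = emode m x * emode n x.
Proof.
rewrite /emode intrD mulrDl cosD sinD.
by apply: cplx_eq; reim; ring.
Qed.

Lemma emode0 x : emode 0 x = 1.
Proof. by rewrite /emode mul0r cos0 sin0. Qed.

Lemma emodeNJ n x : emode (- n) x = (emode n x)^*.
Proof.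
rewrite /emode intrN mulNr cosN sinN.
by apply: cplx_eq; reim.
Qed.

Lemma sqnormc_emode n x : sqnormc (emode n x) = 1.
Proof. by rewrite /sqnormc/= cos2Dsin2. Qed.

Lemma Re_emode_le n x : `|complex.Re (emode n x)| <= 1.
Proof. by rewrite /= ler_norml cos_geN1 cos_le1. Qed.

Lemma Im_emode_le n x : `|complex.Im (emode n x)| <= 1.
Proof. by rewrite /= ler_norml sin_geN1 sin_le1. Qed.

Lemma cos_shift_nat (k : nat) x : cos (x + k%:R * (2 * pi)) = cos x.
Proof.
elim: k => [|k IH]; first by rewrite mul0r addr0.
by rewrite -natr1 mulrDl mul1r addrA -IH [2 * pi]mulr_natl cosD2pi.
Qed.

Lemma sin_shift_nat (k : nat) x : sin (x + k%:R * (2 * pi)) = sin x.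
Proof.
elim: k => [|k IH]; first by rewrite mul0r addr0.
by rewrite -natr1 mulrDl mul1r addrA -IH [2 * pi]mulr_natl sinD2pi.
Qed.

Lemma emode_periodic n : periodic (@emode R n).
Proof.
move=> x; rewrite /emode; case: n => k /=.
  by rewrite mulrDr cos_shift_nat sin_shift_nat.
rewrite NegzE !intrN !mulNr !cosN !sinN.
by rewrite mulrDr cos_shift_nat sin_shift_nat.
Qed.

Lemma twopi_gt0 : 0 < 2 * pi :> R.
Proof. by rewrite mulr_gt0// pi_gt0. Qed.

Lemma continuous_Re_emode n : continuous (fun x => complex.Re (@emode R n x)).
Proof.
move=> x; apply: (@continuous_comp _ _ _ (fun x => n%:~R * x) cos).
  by apply: cvgMr; exact: cvg_id.
exact: continuous_cos.
Qed.

Lemma continuous_Im_emode n : continuous (fun x => complex.Im (@emode R n x)).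
Proof.
move=> x; apply: (@continuous_comp _ _ _ (fun x => n%:~R * x) sin).
  by apply: cvgMr; exact: cvg_id.
exact: continuous_sin.
Qed.

Lemma measurable_Re_emode n : measurable_fun setT (fun x => complex.Re (@emode R n x)).
Proof. apply: continuous_measurable_fun; exact: continuous_Re_emode. Qed.

Lemma measurable_Im_emode n : measurable_fun setT (fun x => complex.Im (@emode R n x)).
Proof. apply: continuous_measurable_fun; exact: continuous_Im_emode. Qed.

End ComplexAlgebraTheory.

(** * Integration over the circle and Fourier coefficients *)

Section FourierCoefficients.
Context {R : realType}.
Implicit Types (u v w e : R -> R[i]) (f g : R -> R) (a z : R[i]) (n m : int).
Notation mu := (@lebesgue_measure R).
Notation circ := (`[0%R, (2 * pi)%R]%classic : set (measurableTypeR R)).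

Let Rint f := (mu.-integrable circ (EFin \o f)).

Lemma measurable_circ : measurable circ.
Proof. exact: measurable_itv. Qed.

Lemma mu_circ : (mu : {measure set (measurableTypeR R) -> \bar R}) circ = (2 * pi)%:E.
Proof. by rewrite [LHS]lebesgue_measure_itv/= lte_fin twopi_gt0 oppr0 adde0. Qed.

Lemma Rint_eq f g : (forall x, f x = g x) -> Rint f -> Rint g.
Proof. by move=> /funext ->. Qed.

Lemma Rint_D f g : Rint f -> Rint g -> Rint (fun x => f x + g x).
Proof. by move=> hf hg; exact: (integrableD measurable_circ hf hg). Qed.

Lemma Rint_Z (k : R) f : Rint f -> Rint (fun x => k * f x).
Proof. by move=> hf; exact: (integrableZl measurable_circ k hf). Qed.

Definition Cint u := Rint (fun x => complex.Re (u x)) /\ Rint (fun x => complex.Im (u x)).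

Lemma cintegralD u v : Cint u -> Cint v ->
  cintegral (fun x => u x + v x) = cintegral u + cintegral v.
Proof.
move=> [u1 u2] [v1 v2]; apply: cplx_eq; reim.
  by rewrite -RintegralD//; apply: eq_Rintegral => x _; rewrite cReD.
by rewrite -RintegralD//; apply: eq_Rintegral => x _; rewrite cImD.
Qed.

Lemma CintZ a u : Cint u -> Cint (fun x => a * u x).
Proof.
move=> [u1 u2]; split.
  apply: Rint_eq (Rint_D (Rint_Z (complex.Re a) u1) (Rint_Z (- complex.Im a) u2)).
  by move=> x; cbv beta; rewrite cReM mulNr.
apply: Rint_eq (Rint_D (Rint_Z (complex.Re a) u2) (Rint_Z (complex.Im a) u1)).
by move=> x; cbv beta; rewrite cImM.
Qed.

Lemma cintegralZ a u : Cint u -> cintegral (fun x => a * u x) = a * cintegral u.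
Proof.
move=> [u1 u2]; apply: cplx_eq; reim.
  rewrite -!RintegralZl// -RintegralB//; try exact: Rint_Z.
  by apply: eq_Rintegral => x _; rewrite cReM.
rewrite -!RintegralZl// -RintegralD//; try exact: Rint_Z.
by apply: eq_Rintegral => x _; rewrite cImM.
Qed.

Lemma eq_cintegral u v : {in circ, u =1 v} -> cintegral u = cintegral v.
Proof.
move=> uv; rewrite /cintegral; congr (_ +i* _);
  by apply: eq_Rintegral => x xI; rewrite uv.
Qed.

Lemma Rint_bounded f (M : R) : measurable_fun setT f ->
  (forall x, `|f x| <= M) -> Rint f.
Proof.
move=> mf fM; apply: measurable_bounded_integrable => //.
  by rewrite mu_circ ltry.
  exact: measurable_funTS.
by exists M; split; [exact: num_real|move=> N MN x _; exact: le_trans (fM x) (ltW MN)].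
Qed.

Lemma Rintegral_bound f (M : R) : Rint f -> (forall x, `|f x| <= M) ->
  `|\int[mu]_(x in circ) f x| <= 2 * pi * M.
Proof.
move=> If fM; apply: le_trans (le_normr_Rintegral measurable_circ If) _.
have -> : 2 * pi * M = \int[mu]_(x in circ) (cst M x).
  by rewrite Rintegral_cst// mu_circ/= mulrC.
apply: le_Rintegral => //; first exact: integrable_norm.
apply: (@Rint_bounded _ `|M|) => //; exact: measurable_cst.
Qed.

Lemma Rint_ge0 f : measurable_fun setT f -> (forall x, 0 <= f x) ->
  (\int[mu]_(x in circ) (f x)%:E < +oo)%E <-> Rint f.
Proof.
move=> mf f0.
have E : (\int[mu]_(x in circ) `|(EFin \o f) x| = \int[mu]_(x in circ) (f x)%:E)%E.
  by apply: eq_integral => x _ /=; rewrite ger0_norm.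
split=> [h|/integrableP[_]]; last by rewrite E.
apply/integrableP; split; last by rewrite E.
by apply/measurable_EFinP; exact: measurable_funTS.
Qed.

(** The circle has finite measure, so the constant 1 may be added to a
    quadratic bound. *)
Lemma L2_dom_integrable u f (C : R) : circle_L2 u -> measurable_fun setT f ->
  (forall x, `|f x| <= C * (1 + sqnormc (u x))) -> Rint f.
Proof.
move=> [_ mr mi fin] mf fb.
have ms : measurable_fun setT (fun x => sqnormc (u x)).
  by apply: measurable_funD; apply: measurable_funX.
apply: (@le_integrable _ _ _ mu circ _ _ (fun x => (C * (1 + sqnormc (u x)))%:E)) => //.
- by apply/measurable_EFinP; exact: measurable_funTS.
- move=> x _ /=; rewrite lee_fin; apply: le_trans (fb x) _; exact: ler_norm.
apply: Rint_Z; apply: Rint_D.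
  apply: (@Rint_bounded _ 1) => [|x]; first exact: measurable_cst.
  by rewrite normr1.
by apply/Rint_ge0 => // x; exact: sqnormc_ge0.
Qed.

Lemma norm_le_1sq (x : R) : `|x| <= 1 + x ^+ 2.
Proof. by rewrite ler_norml; apply/andP; split; nra. Qed.

Lemma normRe_le z : `|complex.Re z| <= 1 + sqnormc z.
Proof. by apply: le_trans (norm_le_1sq _) _; rewrite lerD2l Re_le_sqnormc. Qed.

Lemma normIm_le z : `|complex.Im z| <= 1 + sqnormc z.
Proof. by apply: le_trans (norm_le_1sq _) _; rewrite lerD2l Im_le_sqnormc. Qed.

Lemma measurable_ReM u v : 
  measurable_fun setT (fun x => complex.Re (u x)) ->
  measurable_fun setT (fun x => complex.Im (u x)) ->
  measurable_fun setT (fun x => complex.Re (v x)) ->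
  measurable_fun setT (fun x => complex.Im (v x)) ->
  measurable_fun setT (fun x => complex.Re (u x * v x)) /\
  measurable_fun setT (fun x => complex.Im (u x * v x)).
Proof.
move=> *; split.
  under eq_fun do rewrite cReM.
  by apply: measurable_funB; apply: measurable_funM.
under eq_fun do rewrite cImM.
by apply: measurable_funD; apply: measurable_funM.
Qed.

(** Multiplication by a bounded measurable function keeps a square integrable
    function integrable; with [e] an exponential this makes every Fourier
    integral meaningful. *)
Lemma Cint_mul_bounded u e (M : R) : circle_L2 u ->
  measurable_fun setT (fun x => complex.Re (e x)) ->
  measurable_fun setT (fun x => complex.Im (e x)) ->
  (forall x, `|complex.Re (e x)| <= M) -> (forall x, `|complex.Im (e x)| <= M) ->
  Cint (fun x => u x * e x).
Proof.
move=> Lu me1 me2 b1 b2; have [_ mu1 mu2 _] := Lu.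
have [m1 m2] := measurable_ReM mu1 mu2 me1 me2.
have M0 : 0 <= M by apply: le_trans (b1 0).
have P x (a b : R) : `|a| <= 1 + sqnormc (u x) -> `|b| <= M ->
    `|a * b| <= M * (1 + sqnormc (u x)).
  by move=> ha hb; rewrite normrM mulrC ler_pM.
split; apply: (@L2_dom_integrable u _ (2 * M)) => // x.
  rewrite cReM mulr2n mulrDl !mul1r mulrDl; apply: le_trans (ler_normB _ _) _.
  by rewrite lerD// P// ?normRe_le ?normIm_le.
rewrite cImM mulr2n mulrDl !mul1r mulrDl; apply: le_trans (ler_normD _ _) _.
by rewrite lerD// P// ?normRe_le ?normIm_le.
Qed.

Lemma Cint_emode u n : circle_L2 u -> Cint (fun x => u x * emode n x).
Proof.
move=> Lu; apply: (@Cint_mul_bounded _ _ 1) => //.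
- exact: measurable_Re_emode.
- exact: measurable_Im_emode.
- exact: Re_emode_le.
- exact: Im_emode_le.
Qed.

Lemma L2_bounded u (M : R) : Defs.periodic u ->
  measurable_fun setT (fun x => complex.Re (u x)) ->
  measurable_fun setT (fun x => complex.Im (u x)) ->
  (forall x, sqnormc (u x) <= M) -> circle_L2 u.
Proof.
move=> pu mr mi uM; split => //.
have ms : measurable_fun setT (fun x => sqnormc (u x)).
  by apply: measurable_funD; apply: measurable_funX.
apply/Rint_ge0 => // [x|]; first exact: sqnormc_ge0.
by apply: (Rint_bounded (M := M)) => // x; rewrite ger0_norm ?sqnormc_ge0.
Qed.

Lemma L2_emode n : circle_L2 (@emode R n).
Proof.
apply: (@L2_bounded _ 1).
- exact: emode_periodic.
- exact: measurable_Re_emode.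
- exact: measurable_Im_emode.
- by move=> x; rewrite sqnormc_emode.
Qed.

Lemma L2_lin a u v : circle_L2 u -> circle_L2 v -> circle_L2 (fun x => a * u x + v x).
Proof.
move=> Lu Lv; have [pu u1 u2 u3] := Lu; have [pv v1 v2 v3] := Lv.
have sq f : measurable_fun setT f -> measurable_fun setT (fun x => f x ^+ 2).
  by move=> ?; exact: measurable_funX.
have ms w : circle_L2 w -> measurable_fun setT (fun x => sqnormc (w x)).
  by case=> *; apply: measurable_funD; apply: measurable_funX.
have Is w : circle_L2 w -> Rint (fun x => sqnormc (w x)).
  move=> Lw; apply: (@L2_dom_integrable w _ 1) => [//||x]; first exact: ms.
  by rewrite ger0_norm ?sqnormc_ge0// mul1r lerDr.
have m1 : measurable_fun setT (fun x => complex.Re (a * u x + v x)).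
  under eq_fun do rewrite cReD cReM.
  by apply: measurable_funD => //; apply: measurable_funB; exact: measurable_funM.
have m2 : measurable_fun setT (fun x => complex.Im (a * u x + v x)).
  under eq_fun do rewrite cImD cImM.
  by apply: measurable_funD => //; apply: measurable_funD; exact: measurable_funM.
split => //.
- by move=> x; rewrite pu pv.
have mw : measurable_fun setT (fun x => sqnormc (a * u x + v x)).
  by apply: measurable_funD; exact: measurable_funX.
have IB : Rint (fun x => (2 * sqnormc a) * sqnormc (u x) + 2 * sqnormc (v x)).
  by apply: Rint_D; apply: Rint_Z; exact: Is.
apply/Rint_ge0 => // [x|]; first exact: sqnormc_ge0.
apply: (le_integrable measurable_circ) IB.
  by apply/measurable_EFinP; exact: measurable_funTS.
move=> x _ /=; rewrite lee_fin ger0_norm ?sqnormc_ge0//.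
apply: le_trans (sqnormcD _ _) _; rewrite sqnormcM mulrA; exact: ler_norm.
Qed.

Lemma L2_0 : circle_L2 (fun _ : R => 0 : R[i]).
Proof.
by apply: (@L2_bounded _ 0) => // x; rewrite sqnormc0.
Qed.

Lemma L2Z a u : circle_L2 u -> circle_L2 (fun x => a * u x).
Proof.
move=> Lu; have := L2_lin a Lu L2_0; congr circle_L2.
by apply/funext => x; rewrite addr0.
Qed.

Lemma L2D u v : circle_L2 u -> circle_L2 v -> circle_L2 (fun x => u x + v x).
Proof.
move=> Lu Lv; have := L2_lin 1 Lu Lv; congr circle_L2.
by apply/funext => x; rewrite mul1r.
Qed.

Lemma L2B u v : circle_L2 u -> circle_L2 v -> circle_L2 (fun x => u x - v x).
Proof.
move=> Lu Lv; have := L2_lin (-1) Lv Lu; congr circle_L2.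
by apply/funext => x; rewrite mulN1r addrC.
Qed.

Lemma L2_cst a : circle_L2 (fun _ : R => a).
Proof. by apply: (@L2_bounded _ (sqnormc a)). Qed.

Lemma L2_sum (r : seq nat) (F : nat -> R -> R[i]) :
  (forall k, circle_L2 (F k)) -> circle_L2 (fun x => \sum_(k <- r) F k x).
Proof.
move=> LF; elim: r => [|k r IH].
  by under eq_fun do rewrite big_nil; exact: L2_0.
by under eq_fun do rewrite big_cons; exact: L2D.
Qed.

Lemma eq_fourier u v n : u =1 v -> fourier u n = fourier v n.
Proof. by move=> /funext ->. Qed.

Lemma fourier_lin a u v n : circle_L2 u -> circle_L2 v ->
  fourier (fun x => a * u x + v x) n = a * fourier u n + fourier v n.
Proof.
move=> Lu Lv; rewrite /fourier.
have -> : (fun x => (a * u x + v x) * emode (- n) x) =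
    (fun x => a * (u x * emode (- n) x) + v x * emode (- n) x).
  by apply/funext => x; rewrite mulrDl mulrA.
rewrite cintegralD; [|apply: CintZ|]; try exact: Cint_emode.
rewrite cintegralZ; last exact: Cint_emode.
by rewrite mulrDr mulrCA.
Qed.

Lemma fourier0 n : fourier (fun _ : R => 0 : R[i]) n = 0.
Proof.
rewrite /fourier (@eq_cintegral _ (fun=> 0)) => [|x _]; last by rewrite mul0r.
rewrite (_ : cintegral _ = 0) ?mulr0//.
by apply: cplx_eq; rewrite /= Rintegral_cst// mul0r.
Qed.

Lemma fourierZ a u n : circle_L2 u -> fourier (fun x => a * u x) n = a * fourier u n.
Proof.
move=> Lu; have := fourier_lin a n Lu L2_0; rewrite fourier0 addr0 => <-.
by apply: eq_fourier => x; rewrite addr0.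
Qed.

Lemma fourierD u v n : circle_L2 u -> circle_L2 v ->
  fourier (fun x => u x + v x) n = fourier u n + fourier v n.
Proof.
move=> Lu Lv; have := fourier_lin 1 n Lu Lv; rewrite mul1r => <-.
by apply: eq_fourier => x; rewrite mul1r.
Qed.

Lemma fourierB u v n : circle_L2 u -> circle_L2 v ->
  fourier (fun x => u x - v x) n = fourier u n - fourier v n.
Proof.
move=> Lu Lv; have := fourier_lin (-1) n Lv Lu; rewrite mulN1r addrC => <-.
by apply: eq_fourier => x; rewrite mulN1r addrC.
Qed.

Lemma fourier_sum (r : seq nat) (F : nat -> R -> R[i]) n :
  (forall k, circle_L2 (F k)) ->
  fourier (fun x => \sum_(k <- r) F k x) n = \sum_(k <- r) fourier (F k) n.
Proof.
move=> LF; elim: r => [|k r IH].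
  by rewrite big_nil -[RHS](fourier0 n); apply: eq_fourier => x; rewrite big_nil.
rewrite big_cons -IH -fourierD//; last exact: L2_sum.
by apply: eq_fourier => x; rewrite big_cons.
Qed.

(** The exponentials form a group: multiplying by one shifts the coefficients. *)
Lemma fourierM_emode u m n :
  fourier (fun x => u x * emode m x) n = fourier u (n - m).
Proof.
rewrite /fourier; congr (_ * _); apply: eq_cintegral => x _.
by rewrite -mulrA -emodeD opprB.
Qed.

Lemma aeS (P Q : R -> Prop) : (forall x, P x -> Q x) ->
  {ae mu, forall x, P x} -> {ae mu, forall x, Q x}.
Proof. by move=> PQ; apply: (@filterS _ _ (ae_filter_ringOfSetsType mu)). Qed.

Lemma aeI (P Q : R -> Prop) : {ae mu, forall x, P x} -> {ae mu, forall x, Q x} ->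
  {ae mu, forall x, P x /\ Q x}.
Proof. exact: (@filterI _ _ (ae_filter_ringOfSetsType mu)). Qed.

Lemma fourier_ae u v n : circle_L2 u ->
  measurable_fun setT (fun x => complex.Re (v x)) ->
  measurable_fun setT (fun x => complex.Im (v x)) ->
  {ae mu, forall x, u x = v x} -> fourier u n = fourier v n.
Proof.
move=> [_ u1 u2 _] v1 v2 uv.
have [e1 e2] := (@measurable_Re_emode R (- n), @measurable_Im_emode R (- n)).
have [mu1 mu2] := measurable_ReM u1 u2 e1 e2.
have [mv1 mv2] := measurable_ReM v1 v2 e1 e2.
rewrite /fourier; congr (_ * (_ +i* _)); congr fine; apply: ae_eq_integral => //;
  do ?[by apply/measurable_EFinP/measurable_funTS];
  by apply: aeS uv => x -> _.
Qed.

(** The factor 2 is the price of bounding the real and imaginary parts of the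
    integral separately. *)
Lemma fourier_bound u n (M : R) : circle_L2 u -> (forall x, sqnormc (u x) <= M ^+ 2) ->
  0 <= M -> sqnormc (fourier u n) <= 2 * M ^+ 2.
Proof.
move=> Lu uM M0; have [I1 I2] := Cint_emode (- n) Lu.
have rM z : sqnormc z <= M ^+ 2 -> `|complex.Re z| <= M /\ `|complex.Im z| <= M.
  move=> zM; split; rewrite -(@ler_pXn2r _ 2) ?nnegrE// real_normK ?num_real//.
    exact: le_trans (Re_le_sqnormc _) zM.
  exact: le_trans (Im_le_sqnormc _) zM.
have b x : sqnormc (u x * emode (- n) x) <= M ^+ 2.
  by rewrite sqnormcM sqnormc_emode mulr1.
have b1 := Rintegral_bound I1 (fun x => (rM _ (b x)).1).
have b2 := Rintegral_bound I2 (fun x => (rM _ (b x)).2).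
have p0 := @twopi_gt0 R.
have sb (t : R) : `|t| <= 2 * pi * M -> ((2 * pi)^-1) ^+ 2 * t ^+ 2 <= M ^+ 2.
  move=> tb; rewrite -exprMn -(real_normK (num_real (_ * t))) ler_pXn2r ?nnegrE//.
  rewrite normrM gtr0_norm ?invr_gt0// mulrC ler_pdivrMr//.
  by rewrite mulrC.
rewrite /fourier sqnormcM sqnormcC /sqnormc mulrDr (_ : 2 * M ^+ 2 = M ^+ 2 + M ^+ 2); last by ring.
by apply: lerD; apply: sb.
Qed.

End FourierCoefficients.

(** * Derivatives of periodic functions and their Fourier coefficients *)

Section Derivatives.
Context {R : realType}.
Implicit Types (u v w : R -> R[i]) (f g : R -> R) (a z : R[i]) (n m : int).
Notation mu := (@lebesgue_measure R).
Notation circ := (`[0%R, (2 * pi)%R]%classic : set (measurableTypeR R)).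

Lemma deriv_mul f g (x df dg : R) : is_derive x 1 f df -> is_derive x 1 g dg ->
  is_derive x 1 (fun y => f y * g y) (df * g x + f x * dg).
Proof.
move=> hf hg; have h := is_deriveM hf hg; apply: is_derive_eq h _.
by rewrite /GRing.scale/= addrC mulrC.
Qed.

Lemma deriv_add f g (x df dg : R) : is_derive x 1 f df -> is_derive x 1 g dg ->
  is_derive x 1 (fun y => f y + g y) (df + dg).
Proof. by move=> hf hg; exact: (is_deriveD hf hg). Qed.

Lemma deriv_sub f g (x df dg : R) : is_derive x 1 f df -> is_derive x 1 g dg ->
  is_derive x 1 (fun y => f y - g y) (df - dg).
Proof. by move=> hf hg; exact: (is_deriveB hf hg). Qed.

Lemma deriv_cst (x c : R) : is_derive x 1 (fun _ : R => c) 0.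
Proof. exact: is_derive_cst. Qed.

Lemma deriv_scale f (x c df : R) : is_derive x 1 f df ->
  is_derive x 1 (fun y => c * f y) (c * df).
Proof. by move=> hf; exact: (is_deriveZ c hf). Qed.

Lemma deriv_comp f g (x df dg : R) : is_derive x 1 f df -> is_derive (f x) 1 g dg ->
  is_derive x 1 (fun y => g (f y)) (dg * df).
Proof. by move=> hf hg; exact: (is_derive1_comp hg hf). Qed.

Lemma deriv_eq f (x df dg : R) : is_derive x 1 f df -> df = dg -> is_derive x 1 f dg.
Proof. by move=> ? <-. Qed.

Lemma deriv_continuous f (f' : R -> R) : (forall x : R, is_derive x 1 f (f' x)) -> continuous f.
Proof.
move=> h x; apply/differentiable_continuous/derivable1_diffP.
exact: (@ex_derive _ _ _ _ _ _ _ (h x)).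
Qed.

(** Complex derivatives are taken on real and imaginary parts, as integrals and
    measurability are. *)
Definition cderiv u u' := forall x : R,
  is_derive x 1 (fun y => complex.Re (u y)) (complex.Re (u' x)) /\
  is_derive x 1 (fun y => complex.Im (u y)) (complex.Im (u' x)).

Definition ccont u := continuous (fun y => complex.Re (u y)) /\
  continuous (fun y => complex.Im (u y)).

Lemma cderiv_ccont u u' : cderiv u u' -> ccont u.
Proof.
by move=> h; split; apply: deriv_continuous => x; [exact: (h x).1|exact: (h x).2].
Qed.

Lemma ccontM u v : ccont u -> ccont v -> ccont (fun x => u x * v x).
Proof.
move=> [u1 u2] [v1 v2]; split.
  rewrite (_ : (fun y => _) = fun y => complex.Re (u y) * complex.Re (v y)
    - complex.Im (u y) * complex.Im (v y)); last by apply/funext => y; rewrite cReM.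
  by move=> x; apply: cvgB; apply: cvgM; [exact: u1|exact: v1|exact: u2|exact: v2].
rewrite (_ : (fun y => _) = fun y => complex.Re (u y) * complex.Im (v y)
    + complex.Im (u y) * complex.Re (v y)); last by apply/funext => y; rewrite cImM.
by move=> x; apply: cvgD; apply: cvgM; [exact: u1|exact: v2|exact: u2|exact: v1].
Qed.

Lemma ccontD u v : ccont u -> ccont v -> ccont (fun x => u x + v x).
Proof.
move=> [u1 u2] [v1 v2]; split.
  rewrite (_ : (fun y => _) = fun y => complex.Re (u y) + complex.Re (v y)); last first.
    by apply/funext => y; rewrite cReD.
  by move=> x; apply: cvgD; [exact: u1|exact: v1].
rewrite (_ : (fun y => _) = fun y => complex.Im (u y) + complex.Im (v y)); last first.
  by apply/funext => y; rewrite cImD.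
by move=> x; apply: cvgD; [exact: u2|exact: v2].
Qed.

Lemma ccont_cst a : ccont (fun=> a).
Proof. by split=> x; apply: cvg_cst. Qed.

Lemma ccont_emode n : ccont (@emode R n).
Proof. by split; [exact: continuous_Re_emode|exact: continuous_Im_emode]. Qed.

Lemma ccont_real f : continuous f -> ccont (fun x => (f x)%:C).
Proof. by move=> cf; split => //= x; apply: cvg_cst. Qed.

Lemma cderivM u u' v v' : cderiv u u' -> cderiv v v' ->
  cderiv (fun x => u x * v x) (fun x => u' x * v x + u x * v' x).
Proof.
move=> hu hv x; have [u1 u2] := hu x; have [v1 v2] := hv x; split.
  rewrite (_ : (fun y => _) = fun y => complex.Re (u y) * complex.Re (v y)
    - complex.Im (u y) * complex.Im (v y)); last by apply/funext => y; rewrite cReM.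
  apply: deriv_eq (deriv_sub (deriv_mul u1 v1) (deriv_mul u2 v2)) _.
  by reim; ring.
rewrite (_ : (fun y => _) = fun y => complex.Re (u y) * complex.Im (v y)
    + complex.Im (u y) * complex.Re (v y)); last by apply/funext => y; rewrite cImM.
apply: deriv_eq (deriv_add (deriv_mul u1 v2) (deriv_mul u2 v1)) _.
by reim; ring.
Qed.

Lemma cderivD u u' v v' : cderiv u u' -> cderiv v v' ->
  cderiv (fun x => u x + v x) (fun x => u' x + v' x).
Proof.
move=> hu hv x; have [u1 u2] := hu x; have [v1 v2] := hv x; split.
  rewrite (_ : (fun y => _) = fun y => complex.Re (u y) + complex.Re (v y)); last first.
    by apply/funext => y; rewrite cReD.
  by apply: deriv_eq (deriv_add u1 v1) _; rewrite cReD.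
rewrite (_ : (fun y => _) = fun y => complex.Im (u y) + complex.Im (v y)); last first.
  by apply/funext => y; rewrite cImD.
by apply: deriv_eq (deriv_add u2 v2) _; rewrite cImD.
Qed.

Lemma cderiv_cst a : cderiv (fun=> a) (fun=> 0).
Proof. by move=> x; split; apply: deriv_cst. Qed.

Lemma cderiv_real f f' : (forall x : R, is_derive x 1 f (f' x)) ->
  cderiv (fun x => (f x)%:C) (fun x => (f' x)%:C).
Proof. by move=> h x; split => //=; apply: deriv_cst. Qed.

Lemma eq_cderiv u u' v' : cderiv u u' -> u' =1 v' -> cderiv u v'.
Proof. by move=> h /funext <-. Qed.

Lemma cderiv_emode_comp (th th' : R -> R) n : (forall x : R, is_derive x 1 th (th' x)) ->
  cderiv (fun x => emode n (th x))
         (fun x => 'i%C * (n%:~R * th' x)%:C * emode n (th x)).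
Proof.
move=> h x; have hn := deriv_scale n%:~R (h x).
split.
  by apply: deriv_eq (deriv_comp hn (is_derive_cos _)) _; rewrite /emode; cbv beta; reim; ring.
by apply: deriv_eq (deriv_comp hn (is_derive_sin _)) _; rewrite /emode; cbv beta; reim; ring.
Qed.

Lemma cderiv_emode n : cderiv (@emode R n) (fun x => 'i%C * (n%:~R)%:C * emode n x).
Proof.
apply: eq_cderiv (@cderiv_emode_comp id (fun=> 1) n (fun x => is_derive_id x 1)) _ => x.
by rewrite mulr1.
Qed.

Lemma measurable_ccont u : ccont u ->
  measurable_fun setT (fun x => complex.Re (u x)) /\
  measurable_fun setT (fun x => complex.Im (u x)).
Proof. by move=> [? ?]; split; apply: continuous_measurable_fun. Qed.

(** The extreme value theorem on one period. *)
Lemma periodic_bounded f : Defs.periodic f -> continuous f ->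
  exists2 M, 0 <= M & forall x, `|f x| <= M.
Proof.
move=> pf cf; have p0 := @twopi_gt0 R.
have cn : continuous (fun x => `|f x|).
  by move=> x; apply: continuous_comp; [exact: cf|exact: norm_continuous].
have [c _ cM] := EVT_max (ltW p0) (continuous_subspaceT cn).
exists `|f c| => // x.
have pn (k : nat) y : f (y + k%:R * (2 * pi)) = f y.
  elim: k y => [|k IH] y; first by rewrite mul0r addr0.
  by rewrite -natr1 mulrDl mul1r addrA pf IH.
have pz (k : int) y : f (y + k%:~R * (2 * pi)) = f y.
  case: k => k; first exact: pn.
  by rewrite NegzE intrN mulNr -(pn k.+1 (y - _)) subrK.
pose k := Num.floor (x / (2 * pi)).
rewrite -(pz (- k)) cM// in_itv/= intrN mulNr.
have := floor_itv (x / (2 * pi)); rewrite -/k => /andP[h1 h2].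
rewrite subr_ge0 -ler_pdivlMr// h1/= lerBlDl -{2}(mul1r (2 * pi)) -mulrDl.
by rewrite -ler_pdivrMr// ltW// -(intrD _ k 1).
Qed.

Lemma L2_ccont u : Defs.periodic u -> ccont u -> circle_L2 u.
Proof.
move=> pu cu; have [m1 m2] := measurable_ccont cu.
have [p1 p2] : Defs.periodic (fun x => complex.Re (u x)) /\
    Defs.periodic (fun x => complex.Im (u x)).
  by split=> x; rewrite pu.
have [M1 M10 h1] := periodic_bounded p1 cu.1.
have [M2 M20 h2] := periodic_bounded p2 cu.2.
apply: (@L2_bounded _ _ (M1 ^+ 2 + M2 ^+ 2)) => // x.
by rewrite lerD// -real_normK ?num_real// ler_pXn2r ?nnegrE.
Qed.

(** The fundamental theorem of calculus over one period. *)
Lemma cintegral_deriv_periodic w w' : Defs.periodic w -> cderiv w w' -> ccont w' ->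
  cintegral w' = 0.
Proof.
move=> pw dw cw'; have p0 := @twopi_gt0 R.
have w2 : w (2 * pi) = w 0 by rewrite -(pw 0) add0r.
have F f f' : (forall x : R, is_derive x 1 f (f' x)) -> continuous f' ->
    f (2 * pi) = f 0 -> \int[mu]_(x in circ) f' x = 0.
  move=> df cf' ff; rewrite /Rintegral.
  rewrite (@continuous_FTC2 _ f' f 0 (2 * pi)) ?ff ?subee//.
  - exact: continuous_subspaceT.
  - have cf := deriv_continuous df; split.
    + by move=> x _; exact: (@ex_derive _ _ _ _ _ _ _ (df x)).
    + by apply: cvg_at_right_filter; exact: cf.
    + by apply: cvg_at_left_filter; exact: cf.
  - move=> x _; rewrite derive1E; exact: (@derive_val _ _ _ _ _ _ _ (df x)).
apply: cplx_eq => /=.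
  apply: (F (fun x => complex.Re (w x))); last by rewrite w2.
    by move=> x; exact: (dw x).1.
  exact: cw'.1.
apply: (F (fun x => complex.Im (w x))); last by rewrite w2.
  by move=> x; exact: (dw x).2.
exact: cw'.2.
Qed.

Lemma periodicM u v : Defs.periodic u -> Defs.periodic v ->
  Defs.periodic (fun x => u x * v x).
Proof. by move=> pu pv x; rewrite pu pv. Qed.

(** Integration by parts: the derivative of u times an exponential has integral
    zero over a period. *)
Lemma fourier_deriv u u' n : Defs.periodic u -> Defs.periodic u' ->
  cderiv u u' -> ccont u' ->
  fourier u' n = 'i%C * (n%:~R)%:C * fourier u n.
Proof.
move=> pu pu' du cu'; have cu := cderiv_ccont du.
have := @cintegral_deriv_periodic _ _ (periodicM pu (emode_periodic (- n)))
  (cderivM du (cderiv_emode (- n))) _.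
have Lu := L2_ccont pu cu; have Lu' := L2_ccont pu' cu'.
have -> : (fun x => u' x * emode (- n) x + u x * ('i%C * ((- n)%:~R)%:C * emode (- n) x)) =
    fun x => (u' x * emode (- n) x + ('i%C * ((- n)%:~R)%:C) * (u x * emode (- n) x)).
  by apply/funext => x; rewrite [in LHS]mulrCA.
rewrite cintegralD; [|exact: Cint_emode|apply: CintZ; exact: Cint_emode].
rewrite cintegralZ; last exact: Cint_emode.
rewrite (_ : ((- n)%:~R)%:C = - (n%:~R)%:C :> R[i]); last first.
  by apply: cplx_eq; reim; rewrite ?intrN ?oppr0.
move=> h; rewrite /fourier; have /eqP := h (ccontD (ccontM cu' (ccont_emode _))
  (ccontM (ccont_cst _) (ccontM cu (ccont_emode _)))).
by rewrite addr_eq0 => /eqP ->; ring.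
Qed.

(** The derivative of the constant 1 is zero, so [fourier_deriv] kills all its
    nonzero modes; the other exponentials reduce to it by a shift. *)
Lemma fourier_emode m n : fourier (@emode R m) n = (m == n)%:R.
Proof.
have one k : fourier (fun _ : R => 1 : R[i]) k = (k == 0)%:R.
  have [->|k0] := eqVneq k 0.
    rewrite /fourier (@eq_cintegral _ _ (fun=> 1)) => [|x _]; last first.
      by rewrite oppr0 emode0 mulr1.
    have -> : cintegral (fun _ : R => 1 : R[i]) = (2 * pi)%:C.
      by apply: cplx_eq; rewrite /= Rintegral_cst// ?mul0r// mu_circ mul1r.
    by rewrite -RCM mulVf// gt_eqF// twopi_gt0.
  have := @fourier_deriv (fun=> 1) (fun=> 0) k (fun=> erefl) (fun=> erefl)
    (cderiv_cst 1) (ccont_cst 0).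
  rewrite fourier0; move: (fourier _ k) => F /esym/eqP; rewrite !mulf_eq0 => /orP[/orP[]|/eqP//].
    by rewrite eq_complex/= oner_eq0 andbF.
  by rewrite eq_complex/= eqxx andbT intr_eq0 (negbTE k0).
rewrite (eq_fourier (v := fun x => 1 * emode m x)) => [|x]; last by rewrite mul1r.
by rewrite fourierM_emode one subr_eq0 eq_sym.
Qed.

(** Integrating by parts k times trades k derivatives for k powers of the
    frequency; squared norms make it 2 k powers. *)
Lemma fourier_decay (U : nat -> R -> R[i]) (k : nat) n (M : R) :
  (forall j, (j <= k)%N -> Defs.periodic (U j)) ->
  (forall j, (j < k)%N -> cderiv (U j) (U j.+1)) -> ccont (U k) ->
  0 <= M -> (forall x, sqnormc (U k x) <= M ^+ 2) ->
  `|n|%N%:R ^+ (2 * k) * sqnormc (fourier (U 0%N) n) <= 2 * M ^+ 2.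
Proof.
move=> pU dU cU M0 UM.
have cUj j : (j <= k)%N -> ccont (U j).
  by rewrite leq_eqVlt => /predU1P[->//|/dU]; exact: cderiv_ccont.
have -> : `|n|%N%:R ^+ (2 * k) * sqnormc (fourier (U 0%N) n) =
    sqnormc (fourier (U k) n).
  elim: k pU dU cUj {cU UM} => [|k IH] pU dU cU; first by rewrite muln0 expr0 mul1r.
  rewrite (@fourier_deriv (U k) (U k.+1)); [|exact: pU|exact: pU|exact: dU|exact: cU].
  rewrite sqnormcM -IH; [|by move=> j ?; apply: pU; exact: leqW
    |by move=> j ?; apply: dU; exact: leqW|by move=> j ?; apply: cU; exact: leqW].
  rewrite sqnormcM sqnormci mul1r sqnormcC mulrA; congr (_ * _).
  rewrite mulnS exprD; congr (_ * _).
  by rewrite -[RHS]real_normK ?num_real// -intr_norm -natr_absz.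
by apply: fourier_bound => //; apply: L2_ccont => //; exact: pU.
Qed.

End Derivatives.

(** * Null sets and uniqueness of Fourier coefficients *)

Section NullSets.
Context {R : realType}.
Notation mu := (@lebesgue_measure R).

(** The preimage of an interval of length l has diameter at most L l, so the
    preimages of a countable cover of small total length are again small. *)
Lemma negligible_preimage (phi : R -> R) (L : R) (P : R -> Prop) :
  continuous phi -> 0 < L -> (forall x y, `|x - y| <= L * `|phi x - phi y|) ->
  {ae mu, forall x, P x} -> {ae mu, forall x, P (phi x)}.
Proof.
move=> cphi L0 Lphi [N [mN N0 PN]].
have mphi : measurable_fun [set: measurableTypeR R] (phi : measurableTypeR R -> measurableTypeR R).
  exact: continuous_measurable_fun.
have mpre (A : set (measurableTypeR R)) : measurable A ->
    @measurable _ (measurableTypeR R) (phi @^-1` A).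
  by move=> mA; have := mphi measurableT A mA; rewrite setTI.
exists (phi @^-1` N); split; [exact: mpre| |by move=> x /= /PN].
have pre (A : set R) : ocitv A -> (mu (phi @^-1` A) <= (2 * L)%:E * wlength idfun A)%E.
  case/ocitvP => [->|[[a b] /= ab ->]].
    by rewrite preimage_set0 measure0 wlength0 mule0.
  have [E|/set0P[x0 /= hx0]] := eqVneq (phi @^-1` `]a, b]%classic) set0.
    by rewrite E measure0 mule_ge0// ?wlength_ge0// lee_fin mulr_ge0// ltW.
  rewrite wlength_itv_bnd ?(ltW ab)// -EFinM.
  (* x0 is any point of the preimage, the rest of which is within L (b - a) *)
  apply: (@le_trans _ _ (mu `[x0 - L * (b - a), x0 + L * (b - a)]%classic)).
    apply: le_measure; rewrite ?inE.
    - apply: mpre; exact: measurable_itv.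
    - exact: measurable_itv.
    move=> x /= hx; rewrite in_itv/= -ler_distlC distrC.
    apply: le_trans (Lphi _ _) _; rewrite ler_wpM2l ?(ltW L0)//.
    move: hx hx0; rewrite !in_itv/= => /andP[? ?] /andP[? ?].
    by rewrite ler_norml; apply/andP; split; lra.
  rewrite lebesgue_measure_itv/= lte_fin; case: ifP => _.
    by rewrite -EFinD lee_fin; lra.
  by rewrite lee_fin !mulr_ge0 ?(ltW L0)// subr_ge0 ltW.
apply/eqP; rewrite eq_le measure_ge0 andbT.
apply/lee_addgt0Pr => e e0; rewrite add0e.
have e1 : 0 < e / (2 * L) by rewrite divr_gt0// mulr_gt0.
have /(lb_ereal_inf_adherent e1)[_ [A [mA NA] <-]] :
    ereal_inf [set \sum_(k <oo) wlength idfun (A k) | A in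
      @measurable_cover _ (ocitv_type R) N]%E \is a fin_num.
  by move: N0; rewrite /lebesgue_measure/= /lebesgue_stieltjes_measure /measure_extension /mu_ext => ->.
move: N0; rewrite /lebesgue_measure/= /lebesgue_stieltjes_measure /measure_extension {1}/mu_ext => ->.
rewrite add0e => hA.
have mA' k : measurable (A k : set (measurableTypeR R)) by apply: sub_sigma_algebra; exact: mA.
apply: (@le_trans _ _ (\sum_(k <oo) mu (phi @^-1` (A k)))%E).
  apply: measure_sigma_subadditive => //.
  - by move=> k; exact: mpre.
  - exact: mpre.
  - by rewrite -preimage_bigcup; exact: preimage_subset.
apply: (@le_trans _ _ (\sum_(k <oo) (2 * L)%:E * wlength idfun (A k))%E).
  by apply: lee_nneseries => // k _; apply: pre; exact: mA.
rewrite nneseriesZl; [|by move=> *; exact: wlength_ge0].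
rewrite -(@divfK _ (2 * L) _ e) ?gt_eqF ?mulr_gt0// [e / _ * _]mulrC [leRHS]EFinM.
by apply: lee_wpmul2l; [rewrite lee_fin ltW// mulr_gt0|exact: ltW].
Qed.

End NullSets.

Section FourierUniqueness.
Context {R : realType}.
Implicit Types (u v w : R -> R[i]) (f g : R -> R) (n m : int).
Notation mu := (@lebesgue_measure R).
Notation circ := (`[0%R, (2 * pi)%R]%classic : set (measurableTypeR R)).

Lemma bernoulli_le (s : R) k : -1 <= s -> 1 + k%:R * s <= (1 + s) ^+ k.
Proof.
move=> s1; elim: k => [|k IH]; first by rewrite mul0r addr0 expr0.
rewrite exprS; apply: le_trans (_ : (1 + s) * (1 + k%:R * s) <= _); last first.
  by rewrite ler_wpM2l// -lerBlDl sub0r.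
rewrite -natr1 -subr_ge0 (_ : _ - _ = k%:R * s ^+ 2); first by rewrite mulr_ge0 ?sqr_ge0.
by ring.
Qed.

(** The polynomials (1 - t^k)^(2^k) map [0, 1] to itself and converge to the
    indicator of t < 1/2. *)
Lemma step_poly_bound (t : R) k : 0 <= t <= 1 -> 0 <= (1 - t ^+ k) ^+ (2 ^ k) <= 1.
Proof.
move=> /andP[t0 t1]; have h : 0 <= 1 - t ^+ k <= 1.
  by rewrite subr_ge0 exprn_ile1// gerBl exprn_ge0.
by move: h => /andP[h0 h1]; rewrite exprn_ge0// exprn_ile1.
Qed.

Lemma step_poly_cvg1 (t : R) : 0 <= t < 2^-1 ->
  (fun k => (1 - t ^+ k) ^+ (2 ^ k)) @ \oo --> (1 : R).
Proof.
move=> /andP[t0 t1]; apply: (@squeeze_cvgr _ _ _ _ (fun k => 1 - (2 * t) ^+ k) (fun=> 1)).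
- apply: nearW => k; have h : 0 <= t <= 1 by apply/andP; split; lra.
  have /andP[_ ->] := step_poly_bound k h; rewrite andbT.
  have := @bernoulli_le (- t ^+ k) (2 ^ k)%N.
  rewrite lerNr opprK exprn_ile1 ?(andP h).2// => /(_ isT).
  by rewrite mulrN natrX -exprMn.
- rewrite -[X in _ --> X]subr0; apply: cvgB; first exact: cvg_cst.
  apply: cvg_expr; rewrite ger0_norm ?mulr_ge0//; lra.
- exact: cvg_cst.
Qed.

Lemma step_poly_cvg0 (t : R) : 2^-1 < t <= 1 ->
  (fun k => (1 - t ^+ k) ^+ (2 ^ k)) @ \oo --> (0 : R).
Proof.
move=> /andP[t0 t1]; have tp : 0 < 2 * t by lra.
apply: (@squeeze_cvgr _ _ _ _ (fun=> 0) (fun k => ((2 * t)^-1) ^+ k)).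
- apply: nearW => k; have h : 0 <= t <= 1 by apply/andP; split; lra.
  have /andP[h0 _] := step_poly_bound k h; rewrite h0/=.
  have s0 : 0 <= t ^+ k by rewrite exprn_ge0// (andP h).1.
  have s1 : t ^+ k <= 1 by rewrite exprn_ile1// (andP h).1.
  (* (1 - s)^N (1 + s)^N <= 1 and (1 + s)^N >= 1 + N s *)
  have s2 : -1 <= t ^+ k by apply: le_trans s0; rewrite lerN10.
  have b := bernoulli_le (2 ^ k)%N s2.
  rewrite exprVn -[leRHS]mul1r ler_pdivlMr ?exprn_gt0//.
  apply: (@le_trans _ _ ((1 - t ^+ k) ^+ (2 ^ k) * (1 + t ^+ k) ^+ (2 ^ k))).
    apply: ler_wpM2l => //; apply: le_trans b.
    by rewrite exprMn -natrX lerDr ler01.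
  rewrite -exprMn exprn_ile1// ?mulr_ge0 ?subr_ge0 ?addr_ge0//.
  by rewrite (_ : _ * _ = 1 - (t ^+ k) ^+ 2) ?gerBl ?sqr_ge0//; ring.
- exact: cvg_cst.
- apply: cvg_expr; rewrite ger0_norm ?invr_ge0 ?(ltW tp)//.
  by rewrite invf_lt1//; lra.
Qed.

Definition fourier_null u := circle_L2 u /\ forall n, fourier u n = 0.

Lemma L2_mul_emode u m : circle_L2 u -> circle_L2 (fun x => u x * emode m x).
Proof.
move=> [pu u1 u2 u3]; have [m1 m2] := measurable_ReM u1 u2
  (@measurable_Re_emode R m) (@measurable_Im_emode R m).
split => //; first exact: periodicM pu (emode_periodic m).
rewrite (_ : (fun x => _) = (fun x => (sqnormc (u x))%:E))//.
by apply/funext => x; rewrite sqnormcM sqnormc_emode mulr1.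
Qed.

Lemma fourier_null_lin a u v : fourier_null u -> fourier_null v ->
  fourier_null (fun x => a * u x + v x).
Proof.
move=> [Lu u0] [Lv v0]; split; first exact: L2_lin.
by move=> n; rewrite fourier_lin// u0 v0 mulr0 addr0.
Qed.

Lemma fourier_null_mode u m : fourier_null u -> fourier_null (fun x => u x * emode m x).
Proof.
by move=> [Lu u0]; split; [exact: L2_mul_emode|move=> n; rewrite fourierM_emode u0].
Qed.

Lemma fourier_null0 : fourier_null (fun=> 0 : R[i]).
Proof. by split; [exact: L2_0|move=> n; rewrite fourier0]. Qed.

(** A trigonometric polynomial of degree 1 with values in [0, 1] that is below
    1/2 exactly on (0, a) within a period: the product of sines in [bumpE]
    changes sign only at 0 and a. *)
Let bump (a x : R) : R := 2^-1 - (cos (x - a / 2) - cos (a / 2)) / 4.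

Let bumpE a x : bump a x = 2^-1 - sin (x / 2) * sin ((a - x) / 2) / 2.
Proof.
rewrite /bump; have -> : x - a / 2 = x / 2 - (a - x) / 2 by field.
have -> : cos (a / 2) = cos (x / 2 + (a - x) / 2) by congr cos; field.
by rewrite cosB cosD; field.
Qed.

Let bump_itv a x : 0 <= bump a x <= 1.
Proof.
rewrite bumpE; set s := sin _; set r := sin _.
have : `|s * r| <= 1.
  rewrite normrM mulr_ile1// ler_norml ?sin_geN1 ?sin_le1//.
by rewrite ler_norml => /andP[? ?]; apply/andP; split; lra.
Qed.

(** Vanishing of all Fourier coefficients is preserved by multiplication by
    trigonometric polynomials. *)
Let fourier_null_bump a u : fourier_null u -> fourier_null (fun x => (bump a x)%:C * u x).
Proof.
move=> zu; pose z : R[i] := cos (a / 2) +i* (- sin (a / 2)).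
pose z' : R[i] := cos (a / 2) +i* sin (a / 2).
pose c : R[i] := (- 8^-1)%:C.
have h := fourier_null_lin (2^-1 + cos (a / 2) / 4)%:C zu
  (fourier_null_lin (c * z) (fourier_null_mode 1 zu)
    (fourier_null_lin (c * z') (fourier_null_mode (-1) zu) fourier_null0)).
congr fourier_null: h; apply/funext => x.
rewrite addr0 !mulrA ![_ * u x * _]mulrAC -!mulrDl; congr (_ * _).
rewrite /bump /c /z /z' /emode cosB; apply: cplx_eq; reim;
  rewrite !(mul1r, intrN, mulNr, cosN, sinN, mulr1z); by field.
Qed.

Let fourier_null_bumpX a u k : fourier_null u ->
  fourier_null (fun x => (bump a x ^+ k)%:C * u x).
Proof.
move=> zu; elim: k => [|k IH].
  by congr fourier_null: zu; apply/funext => x; rewrite expr0 mul1r.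
have := @fourier_null_bump a _ IH; congr fourier_null; apply/funext => x.
by rewrite exprS RCM mulrA.
Qed.

Let fourier_null_step a u k j : fourier_null u ->
  fourier_null (fun x => ((1 - bump a x ^+ k) ^+ j)%:C * u x).
Proof.
move=> zu; elim: j => [|j IH].
  by congr fourier_null: zu; apply/funext => x; rewrite expr0 mul1r.
have := fourier_null_lin (-1) (@fourier_null_bumpX a _ k IH) IH.
congr fourier_null; apply/funext => x.
rewrite exprS RCM (_ : (1 - bump a x ^+ k)%:C = 1 - (bump a x ^+ k)%:C); first by ring.
by apply: cplx_eq; reim; rewrite ?subr0 ?oppr0 ?addr0.
Qed.

Let step_cvg a x : 0 < a < 2 * pi -> 0 < x < 2 * pi -> x != a ->
  (fun k => (1 - bump a x ^+ k) ^+ (2 ^ k)) @ \oo --> (\1_(`]0, a[%classic) x : R).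
Proof.
move=> /andP[a0 a2] /andP[x0 x2] xa.
have sx : 0 < sin (x / 2) by apply: sin_gt0_pi; apply/andP; split; lra.
have /andP[b0 b1] := bump_itv a x.
rewrite indicE; have [lxa|lax|/eqP] := ltgtP x a; last by rewrite (negbTE xa).
  rewrite mem_set/=; last by rewrite in_itv/= x0.
  apply: step_poly_cvg1; rewrite b0/= bumpE ltrBlDr ltrDl divr_gt0// mulr_gt0//.
  by apply: sin_gt0_pi; apply/andP; split; lra.
rewrite memNset/=; last by rewrite in_itv/= x0/=; apply/negP; rewrite -leNgt ltW.
apply: step_poly_cvg0; rewrite b1 andbT bumpE.
have -> : sin ((a - x) / 2) = - sin ((x - a) / 2).
  by rewrite -sinN -mulNr opprB.
have s2 : 0 < sin ((x - a) / 2) by apply: sin_gt0_pi; apply/andP; split; lra.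
by have := mulr_gt0 sx s2; lra.
Qed.

(** A function orthogonal to all trigonometric polynomials is orthogonal to the
    approximate indicators of (0, a) built from [bump], hence to the indicator
    itself by dominated convergence. P stands for the real or imaginary part. *)
Let null_integral0 (P : R[i] -> R) u a :
  (forall (r : R) z, P (r%:C * z) = r * P z) ->
  (forall v, fourier_null v -> mu.-integrable circ (EFin \o (fun x => P (v x))) /\
     \int[mu]_(x in circ) P (v x) = 0) ->
  measurable_fun setT (fun x => P (u x)) ->
  fourier_null u -> 0 < a < 2 * pi -> \int[mu]_(x in `[0, a]) P (u x) = 0.
Proof.
move=> PZ P0 mP zu a2pi; have [a0 a2] := andP a2pi.
have [Iu _] := P0 u zu.
have mq k : measurable_fun setT (fun x => P (((1 - bump a x ^+ k) ^+ (2 ^ k))%:C * u x)).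
  have [/integrableP[m _] _] := P0 _ (fourier_null_step a k (2 ^ k) zu).
  under eq_fun do rewrite PZ; apply: measurable_funM => //.
  apply: measurable_funX; apply: measurable_funB => //; apply: measurable_funX.
  apply: measurable_funB => //; apply: measurable_funM => //.
  apply: measurable_funB => //; apply: continuous_measurable_fun => x.
  apply: (@continuous_comp _ _ _ (fun x => x - a / 2) cos); last exact: continuous_cos.
  by apply: cvgB; [exact: cvg_id|exact: cvg_cst].
have mf : measurable_fun setT (fun x => \1_(`]0, a[%classic) x * P (u x)).
  by apply: measurable_funM => //; apply: measurable_indic; exact: measurable_itv.
pose f_ k x := (P (((1 - bump a x ^+ k) ^+ (2 ^ k))%:C * u x))%:E.
pose f x := (\1_(`]0, a[%classic) x * P (u x))%:E.
have [] := @dominated_convergence _ _ _ mu circ (measurable_circ (R := R)) f_ f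
  (fun x => `|P (u x)|%:E).
- by move=> k; apply/measurable_EFinP; apply: measurable_funTS; exact: (mq k).
- by apply/measurable_EFinP; apply: measurable_funTS; exact: mf.
- have n1 (t : R) : {ae mu, forall x : R, x != t}.
    exists [set t]; split; [exact: measurable_set1|exact: lebesgue_measure_set1|].
    by move=> x /= /negP; rewrite negbK => /eqP.
  have := aeI (n1 0) (aeI (n1 a) (n1 (2 * pi))).
  apply: aeS => x [x0 [xa x2]] /=; rewrite in_itv/= => /andP[h0 h2].
  apply/fine_cvgP; split; first exact: nearW.
  rewrite /f_ /f /comp/=; under eq_fun do rewrite PZ.
  by apply: cvgMl; apply: step_cvg => //; rewrite !lt_neqAle h0 h2 x2 eq_sym x0.
- exact: integrable_norm.
- apply: aeW => x k _; rewrite /f_ PZ lee_fin normrM ler_piMl//.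
  by have /andP[h0 h1] := step_poly_bound k (bump_itv a x); rewrite ger0_norm.
move=> If _ cf.
have E0 : (fun k => \int[mu]_(x in circ) f_ k x)%E = fun=> 0%E.
  apply/funext => k; have [I0 J0] := P0 _ (fourier_null_step a k (2 ^ k) zu).
  rewrite -[LHS]fineK; last exact: integrable_fin_num.
  by congr EFin.
have : (\int[mu]_(x in circ) f x = 0)%E.
  have /cvg_lim <- // := cf; by rewrite [X in lim (X @ _)]E0 lim_cst.
move=> /(congr1 fine)/= h.
have If' : mu.-integrable `]0, a[ (EFin \o (fun x => P (u x))).
  apply: integrableS Iu => // x /=; rewrite !in_itv/= => /andP[? ?].
  by apply/andP; split; lra.
have Ih : mu.-integrable `[0, a[ (EFin \o (fun x => P (u x))).
  apply: integrableS Iu => // x /=; rewrite !in_itv/= => /andP[? ?].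
  by apply/andP; split; lra.
rewrite -Rintegral_itv_bndo_bndc// -Rintegral_itv_obnd_cbnd//.
rewrite -[RHS]h -/(Rintegral mu _ (fun x => \1_(`]0, a[%classic) x * P (u x))).
rewrite (_ : `]0, a[%classic = circ `&` `]0, a[%classic); last first.
  apply/seteqP; split=> x /=; last by case.
  by rewrite !in_itv/= => /andP[? ?]; split; apply/andP; split; lra.
rewrite Rintegral_mkcondr; apply: eq_Rintegral => x xc.
rewrite patchE indicE in_setI xc /=.
by case: (x \in _); rewrite ?mul1r ?mul0r.
Qed.

(** Lebesgue differentiation: a locally integrable function is a.e. the
    derivative of its primitive. *)
Lemma ae0_of_integrals0 f : mu.-integrable circ (EFin \o f) ->
  (forall a, 0 < a < 2 * pi -> \int[mu]_(x in `[0, a]) f x = 0) ->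
  {ae mu, forall x : R, 0 < x < 2 * pi -> f x = 0}.
Proof.
move=> If f0; pose g := f \_ circ.
have Ig : mu.-integrable [set: measurableTypeR R] (EFin \o g).
  have /(integrable_mkcond _ (measurable_circ (R := R))).1 := If.
  by congr (mu.-integrable _ _); apply/funext => x; rewrite /g/= !patchE; case: ifP.
have := @FTC1 R g (BLeft 0).
case.
- by move=> y; apply: integrableS Ig => //; exact: measurable_itv.
- by apply: open_integrable_locally => //; exact: openT.
move=> N hN; exists N; case: hN => mN N0 sN; split => //.
apply: subset_trans sN => x /= hx hF; apply: hx => /andP[x0 x2].
have [_ dF] := hF x0; pose F y := \int[mu]_(t in `[0, y]) g t.
have Fz : \forall y \near x, F y = cst 0 y.
  near=> y.
  have y0 : 0 < y by near: y; exact: lt_nbhsr.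
  have y2 : y < 2 * pi by near: y; exact: lt_nbhsl.
  transitivity (\int[mu]_(t in `[0, y]) f t); last by rewrite f0 ?y0.
  apply: eq_Rintegral => t; rewrite inE/= in_itv/= => /andP[t0 ty].
  by rewrite /g patchE mem_set//= in_itv/= t0 (le_trans ty (ltW y2)).
have gx : g x = f x by rewrite /g patchE mem_set//= in_itv/= !ltW.
rewrite -gx -dF derive1E (near_eq_derive _ Fz); exact: derive_cst.
Unshelve. all: by end_near.
Qed.

(** Uniqueness of Fourier coefficients. The integrals of u over all intervals
    [0, a] within a period vanish by [null_integral0], hence u vanishes a.e. on
    one period, and on its countably many translates. *)
Lemma fourier_null_ae0 u : fourier_null u -> {ae mu, forall x : R, u x = 0}.
Proof.
move=> zu; have [[pu mr mi _] z] := zu; have p0 := @twopi_gt0 R.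
have pi0 : (((2 * pi)^-1)%:C : R[i]) != 0.
  by rewrite eq_complex/= eqxx andbT invr_eq0 gt_eqF.
have c0 v : fourier_null v -> cintegral v = 0.
  move=> [Lv /(_ 0)/eqP]; rewrite /fourier mulf_eq0 (negbTE pi0)/= => /eqP <-.
  by apply: eq_cintegral => x _; rewrite oppr0 emode0 mulr1.
have Iv v : fourier_null v -> Cint v.
  move=> [Lv _]; have := Cint_emode 0 Lv; congr Cint; apply/funext => x.
  by rewrite emode0 mulr1.
have r0 : {ae mu, forall x : R, 0 < x < 2 * pi -> complex.Re (u x) = 0}.
  apply: ae0_of_integrals0; first exact: (Iv u zu).1.
  move=> a; apply: null_integral0 => //; first by move=> r w; reim; rewrite mul0r subr0.
  move=> v zv; split; first exact: (Iv v zv).1.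
  by have := congr1 (@complex.Re R) (c0 v zv).
have i0 : {ae mu, forall x : R, 0 < x < 2 * pi -> complex.Im (u x) = 0}.
  apply: ae0_of_integrals0; first exact: (Iv u zu).2.
  move=> a; apply: null_integral0 => //; first by move=> r w; reim; rewrite mul0r addr0.
  move=> v zv; split; first exact: (Iv v zv).2.
  by have := congr1 (@complex.Im R) (c0 v zv).
have n0 : {ae mu, forall x : R, x != 0}.
  exists [set 0]; split; [exact: measurable_set1|exact: lebesgue_measure_set1|].
  by move=> x /= /negP; rewrite negbK => /eqP.
have base : {ae mu, forall x : R, 0 <= x < 2 * pi -> u x = 0}.
  apply: aeS (aeI n0 (aeI r0 i0)) => x [x0 [hr hi]] /andP[h1 h2].
  have h : 0 < x < 2 * pi by rewrite lt_neqAle eq_sym x0 h1.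
  by apply: cplx_eq; rewrite ?hr ?hi.
have shift (t : R) : {ae mu, forall x : R, 0 <= x + t < 2 * pi -> u (x + t) = 0}.
  apply: (@negligible_preimage _ (fun x => x + t) 1) base => //.
    by move=> x; apply: cvgD; [exact: cvg_id|exact: cvg_cst].
  by move=> x y; rewrite mul1r opprD addrACA subrr addr0.
have all := aeI (ae_foralln (fun k : nat => shift (k%:R * (2 * pi))))
  (ae_foralln (fun k : nat => shift (- (k%:R * (2 * pi))))).
apply: aeS all => x [h1 h2].
have pn (k : nat) y : u (y + k%:R * (2 * pi)) = u y.
  elim: k y => [|k IH] y; first by rewrite mul0r addr0.
  by rewrite -natr1 mulrDl mul1r addrA pu IH.
have := floor_itv (x / (2 * pi)); case: (Num.floor _) => k /andP[k1 k2].
  have e : u (x - k%:R * (2 * pi)) = u x by rewrite -(pn k (x - _)) subrK.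
  rewrite -e; apply: h2; rewrite subr_ge0 -ler_pdivlMr// k1/= ltrBlDl.
  by move: k2; rewrite intrD ltr_pdivrMr// mulrDl mul1r.
rewrite -(pn k.+1 x); apply: h1; move: k1 k2; rewrite NegzE intrD !intrN.
rewrite ler_pdivlMr// ltr_pdivrMr// mulrDl mul1r mulNr -pmulrn => k1 k2.
by apply/andP; split; lra.
Qed.

Lemma fourier_cst a n : fourier (fun _ : R => a) n = a * (0 == n)%:R.
Proof.
rewrite -(fourier_emode (R := R)) -fourierZ; last exact: L2_emode.
by apply: eq_fourier => x; rewrite emode0 mulr1.
Qed.

(** Square integrable functions with the same nonconstant modes represent the
    same element of the Hilbert space. *)
Lemma eqH_fourier u v : circle_L2 u -> circle_L2 v ->
  (forall n, n != 0 -> fourier u n = fourier v n) -> eqH u v.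
Proof.
move=> Lu Lv uv; pose c := fourier u 0 - fourier v 0; exists c.
have : fourier_null (fun x => (u x - v x) - c).
  split; first by apply: L2B; [exact: L2B|exact: L2_cst].
  move=> n; rewrite (fourierB n (L2B Lu Lv) (L2_cst c)) (fourierB n Lu Lv) fourier_cst.
  have [->|n0] := eqVneq n 0; first by rewrite mulr1 subrr.
  by rewrite mulr0 subr0 uv ?subrr.
move=> /fourier_null_ae0; apply: aeS => x /eqP; rewrite subr_eq0 => /eqP <-.
by rewrite addrC subrK.
Qed.

(** A constant only contributes to the mode 0. *)
Lemma fourier_eqH u v n : circle_L2 u -> circle_L2 v -> eqH u v -> n != 0 ->
  fourier u n = fourier v n.
Proof.
move=> Lu Lv [c uv] n0; have Lvc := L2D Lv (L2_cst c).
have [_ m1 m2 _] := Lvc.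
rewrite (fourier_ae n Lu m1 m2 uv) fourierD//; last exact: L2_cst.
by rewrite fourier_cst eq_sym (negbTE n0) mulr0 addr0.
Qed.

End FourierUniqueness.

(** * Series of nonnegative terms and absolutely convergent complex series *)

Section NonnegativeSeries.
Context {R : realType}.
Implicit Types (a b : nat -> R) (N M k : nat).

Definition nsum N a : \bar R := (\sum_(N <= k <oo) (a k)%:E)%E.

Lemma nsum_cvg N a : (forall k, 0 <= a k) ->
  cvgn (fun n => \sum_(N <= k < n) (a k)%:E)%E.
Proof. by move=> a0; apply: is_cvg_nneseries => k _ _; rewrite lee_fin. Qed.

Lemma nsum_ge0 N a : (forall k, 0 <= a k) -> (0 <= nsum N a)%E.
Proof. by move=> a0; apply: nneseries_ge0 => k _ _; rewrite lee_fin. Qed.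

Lemma nsum_le N a b : (forall k, 0 <= a k) -> (forall k, 0 <= b k) ->
  (forall k, (N <= k)%N -> a k <= b k) -> (nsum N a <= nsum N b)%E.
Proof.
move=> a0 b0 ab; apply: lee_lim; [exact: nsum_cvg|exact: nsum_cvg|].
apply: nearW => n; rewrite big_nat [leRHS]big_nat; apply: lee_sum => k /andP[Nk _].
by rewrite lee_fin ab.
Qed.

Lemma eq_nsum N a b : (forall k, (N <= k)%N -> a k = b k) -> nsum N a = nsum N b.
Proof.
move=> ab; apply/congr_lim/funext => n /=; apply: eq_big_nat => k /andP[Nk _].
by rewrite ab.
Qed.

Lemma nsum_split N M a : (forall k, 0 <= a k) -> (N <= M)%N ->
  nsum N a = ((\sum_(N <= k < M) a k)%:E + nsum M a)%E.
Proof.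
move=> a0 NM; rewrite /nsum (nneseries_split N (M - N)); last by move=> *; rewrite lee_fin.
by rewrite subnKC// sumEFin.
Qed.

Lemma nsum_partial N M a : (forall k, 0 <= a k) ->
  ((\sum_(N <= k < M) a k)%:E <= nsum N a)%E.
Proof.
by move=> a0; rewrite -sumEFin; apply: nneseries_lim_ge => k _ _; rewrite lee_fin.
Qed.

Lemma nsum_bound N a (B : R) : (forall k, 0 <= a k) ->
  (forall M, \sum_(N <= k < M) a k <= B) -> (nsum N a <= B%:E)%E.
Proof.
move=> a0 aB; apply: lime_le; first exact: nsum_cvg.
by apply: nearW => n; rewrite sumEFin lee_fin.
Qed.

Lemma nsum_geqN N M a : (forall k, 0 <= a k) -> (N <= M)%N -> (nsum M a <= nsum N a)%E.
Proof.
move=> a0 NM; rewrite (nsum_split a0 NM) leeDr// lee_fin; exact: sumr_ge0.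
Qed.

Lemma nsum_term N k a : (forall j, 0 <= a j) -> (N <= k)%N -> ((a k)%:E <= nsum N a)%E.
Proof.
move=> a0 Nk; apply: le_trans (nsum_geqN a0 Nk); rewrite (nsum_split a0 (leqnSn k)).
by rewrite big_nat1 leeDl// nsum_ge0.
Qed.

Lemma nsum_tail N a (e : R) : (forall k, 0 <= a k) -> (nsum N a < +oo)%E -> 0 < e ->
  exists2 M, (N <= M)%N & forall m, (M <= m)%N -> (nsum m a < e%:E)%E.
Proof.
move=> a0 afin e0.
have h k : xpredT k -> (0 <= (a k)%:E)%E by rewrite lee_fin.
have a0fin : (\sum_(0 <= k <oo | xpredT k) (a k)%:E < +oo)%E.
  by rewrite -/(nsum 0 a) (nsum_split a0 (leq0n N)) lte_add_pinfty// ltry.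
have /fine_cvgP[fn /cvgr_lt/(_ e e0) lt_e] := nneseries_tail_cvg a0fin h.
have [M _ hM] := filterI fn lt_e; exists (maxn N M); first exact: leq_maxl.
move=> m; rewrite geq_max => /andP[_ /hM[fm le]].
by rewrite /nsum -(fineK fm) lte_fin.
Qed.

Lemma nsumD N a b : (forall k, 0 <= a k) -> (forall k, 0 <= b k) ->
  nsum N (fun k => a k + b k) = (nsum N a + nsum N b)%E.
Proof.
move=> a0 b0; rewrite /nsum -nneseriesD; try by move=> *; rewrite lee_fin.
by apply: eq_eseriesr => k _; rewrite EFinD.
Qed.

Lemma nsumZ N (c : R) a : (forall k, 0 <= a k) ->
  nsum N (fun k => c * a k) = (c%:E * nsum N a)%E.
Proof.
move=> a0; rewrite /nsum -nneseriesZl; last by move=> *; rewrite lee_fin.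
by apply: eq_eseriesr => k _; rewrite EFinM.
Qed.

Lemma nsum_shift N k a : (forall j, 0 <= a j) ->
  nsum N (fun j => a (j + k)%N) = nsum (N + k) a.
Proof.
move=> a0; rewrite /nsum -(@nneseries_addn _ (fun j => (a j)%:E) (N + k)) => [|j]; last by rewrite lee_fin.
rewrite -(@nneseries_addn _ (fun j => (a (j + k)%N)%:E) N) => [|j]; last by rewrite lee_fin.
by apply: eq_eseriesr => j _; rewrite addnA.
Qed.

Lemma nsum_interchange N M (a : nat -> nat -> R) : (forall i j, 0 <= a i j) ->
  (\sum_(N <= i <oo) nsum M (a i) = \sum_(M <= j <oo) nsum N (a ^~ j))%E.
Proof.
move=> a0; rewrite /nsum.
rewrite eseries_cond [RHS]eseries_cond.
under eq_eseriesr do rewrite eseries_cond.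
under [RHS]eq_eseriesr do rewrite eseries_cond.
by apply: nneseries_interchange => i j; rewrite lee_fin.
Qed.

(** 1/(M+1)^2 <= 1/M - 1/(M+1), and the right-hand side telescopes. *)
Lemma invsq_telescope N M : (0 < N <= M)%N ->
  \sum_(N.+1 <= k < M.+1) (k%:R ^+ 2)^-1 <= N%:R^-1 - M%:R^-1 :> R.
Proof.
move=> /andP[N0]; elim: M => [|M IH]; first by rewrite leqn0 => /eqP E; rewrite E in N0.
rewrite leq_eqVlt => /predU1P[<-|]; first by rewrite big_geq// subrr.
rewrite ltnS => NM; rewrite big_nat_recr/= ?ltnS//.
apply: le_trans (lerD (IH NM) (lexx _)) _.
rewrite -addrA lerD2l addrC -subr_ge0.
have M0 : 0 < M%:R :> R by rewrite ltr0n (leq_trans N0).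
have E : M.+1%:R = M%:R + 1 :> R by rewrite natr1.
rewrite E (_ : _ - _ = (M%:R * (M%:R + 1) ^+ 2)^-1).
  by rewrite invr_ge0 mulr_ge0 ?sqr_ge0// ltW.
by field; rewrite !gt_eqF// addr_gt0.
Qed.

Lemma nsum_invsq_tail m : (0 < m)%N ->
  (nsum m.+1 (fun k => (k%:R ^+ 2)^-1 : R)%R <= (m%:R^-1)%:E)%E.
Proof.
move=> m0; apply: nsum_bound => [k|M]; first by rewrite invr_ge0 sqr_ge0.
case: (leqP M m) => [Mm|]; first by rewrite big_geq ?invr_ge0// ltnW.
case: M => // M; rewrite ltnS => mM; apply: le_trans (invsq_telescope _) _.
  by rewrite m0.
by rewrite gerBl invr_ge0.
Qed.

Lemma nsum_invsq : (nsum 1 (fun k => (k%:R ^+ 2)^-1 : R)%R < +oo)%E.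
Proof.
have a0 k : 0 <= (k%:R ^+ 2)^-1 :> R by rewrite invr_ge0 sqr_ge0.
rewrite (nsum_split a0 (leqnSn 1)) lte_add_pinfty ?ltry//.
by apply: le_lt_trans (nsum_invsq_tail (ltn0Sn 0)) _; rewrite ltry.
Qed.

End NonnegativeSeries.

Section ComplexSeries.
Context {R : realType}.
Implicit Types (a b : nat -> R[i]) (z w : R[i]) (N M k : nat).

(** A real-valued norm on the complex numbers, convenient for bounding real and
    imaginary parts at once. *)
Definition nrm1 z : R := `|complex.Re z| + `|complex.Im z|.

Lemma nrm1_ge0 z : 0 <= nrm1 z. Proof. by rewrite addr_ge0. Qed.

Lemma nrm1_0 : nrm1 0 = 0. Proof. by rewrite /nrm1; reim; rewrite normr0 addr0. Qed.

Lemma nrm1D z w : nrm1 (z + w) <= nrm1 z + nrm1 w.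
Proof. by rewrite /nrm1; reim; rewrite addrACA lerD// ler_normD. Qed.

Lemma nrm1N z : nrm1 (- z) = nrm1 z.
Proof. by rewrite /nrm1; reim; rewrite !normrN. Qed.

Lemma nrm1B z w : nrm1 (z - w) <= nrm1 z + nrm1 w.
Proof. by rewrite -(nrm1N w) nrm1D. Qed.

Lemma nrm1_sum (I : Type) (r : seq I) (P : pred I) (F : I -> R[i]) :
  nrm1 (\sum_(i <- r | P i) F i) <= \sum_(i <- r | P i) nrm1 (F i).
Proof.
elim/big_rec2: _ => [|i x y _ h]; first by rewrite nrm1_0.
by apply: le_trans (nrm1D _ _) _; rewrite lerD2l.
Qed.

Lemma nrm1M z w : nrm1 (z * w) <= nrm1 z * nrm1 w.
Proof.
rewrite /nrm1; reim; apply: le_trans (lerD (ler_normB _ _) (ler_normD _ _)) _.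
by rewrite !normrM le_eqVlt; apply/orP; left; apply/eqP; ring.
Qed.

Lemma nrm1_sq z : nrm1 z ^+ 2 <= 2 * sqnormc z.
Proof.
rewrite /nrm1 /sqnormc -(real_normK (num_real (complex.Re z))).
rewrite -(real_normK (num_real (complex.Im z))).
by set p := `|_|; set q := `|_|; have := sqr_ge0 (p - q); nra.
Qed.

Lemma sqnormc_nrm1 z : sqnormc z <= nrm1 z ^+ 2.
Proof.
rewrite /nrm1 /sqnormc -(real_normK (num_real (complex.Re z))).
rewrite -(real_normK (num_real (complex.Im z))) sqrrD.
by rewrite -addrA lerD2l lerDr mulrn_wge0// mulr_ge0.
Qed.

(** The inequality of the means. With weights c = k^2 it turns weighted square
    summability into absolute summability. *)
Lemma nrm1_amgm z (c : R) : 0 < c -> nrm1 z <= c * sqnormc z + c^-1.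
Proof.
move=> c0; have := nrm1_sq z; have := nrm1_ge0 z.
move: (nrm1 z) (sqnormc z) => t s t0 h; have : 0 <= (c * t - 1) ^+ 2 by exact: sqr_ge0.
have ci : 0 < c^-1 by rewrite invr_gt0.
move=> h2; rewrite -(ler_pM2l c0) mulrDr mulfV ?gt_eqF//.
nra.
Qed.

(** The limits of the real and imaginary parts, as in the inner product
    [innerH]. *)
Definition csum a : R[i] :=
  limn (fun N => \sum_(1 <= n < N) complex.Re (a n)) +i*
  limn (fun N => \sum_(1 <= n < N) complex.Im (a n)).

Definition csummable a := (nsum 1 (fun k => nrm1 (a k)) < +oo)%E.

Lemma csum_fin a N : (forall k, (N <= k)%N -> a k = 0) ->
  csum a = \sum_(1 <= k < N) a k.
Proof.
move=> aN; have E (P : R[i] -> R) : P 0 = 0 ->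
    limn (fun n => \sum_(1 <= k < n) P (a k)) = \sum_(1 <= k < N) P (a k).
  move=> P0; apply: lim_near_cst => //; near=> n.
  have Nn : (N <= n)%N by near: n; exact: nbhs_infty_ge.
  have [N0|N0] := posnP N.
    by rewrite N0 [RHS]big_geq// big_nat big1// => k _; rewrite aN ?N0.
  rewrite (big_cat_nat N0 Nn)/= [X in _ + X]big_nat [X in _ + X]big1 ?addr0// => k /andP[Nk _].
  by rewrite aN.
by rewrite /csum !E//; apply: cplx_eq; rewrite ?Re_sum ?Im_sum.
Unshelve. all: by end_near. Qed.

Lemma csum_is_cvg a (P : R[i] -> R) : (forall z, `|P z| <= nrm1 z) -> csummable a ->
  cvgn (fun n => \sum_(1 <= k < n) P (a k)).
Proof.
move=> Pn sa.
have s0 k : 0 <= nrm1 (a k) by exact: nrm1_ge0.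
rewrite (_ : (fun n => _) = series (fun k => if k is 0%N then 0 else P (a k))); last first.
  apply/funext => n; rewrite /series/=.
  case: n => [|n]; first by rewrite !big_geq.
  by rewrite [RHS]big_ltn// add0r; apply: eq_big_nat => k /andP[k0 _]; case: k k0.
apply: normed_cvg; apply: (@series_le_cvg _ _ (fun k => nrm1 (a k))) => //.
- by move=> k /=; exact: normr_ge0.
- by case=> [|k] /=; rewrite ?normr0.
- apply: nnseries_is_cvg => //; rewrite -/(nsum 0 _) (nsum_split s0 (leqnSn 0)).
  by rewrite lte_add_pinfty ?ltry.
Qed.

Lemma csum_cvg a : csummable a ->
  ((fun n => complex.Re (\sum_(1 <= k < n) a k)) @ \oo --> complex.Re (csum a)) /\
  ((fun n => complex.Im (\sum_(1 <= k < n) a k)) @ \oo --> complex.Im (csum a)).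
Proof.
move=> sa; split.
  under eq_fun do rewrite Re_sum.
  by apply: (csum_is_cvg (P := @complex.Re R)) => // z; rewrite lerDl.
under eq_fun do rewrite Im_sum.
by apply: (csum_is_cvg (P := @complex.Im R)) => // z; rewrite lerDr.
Qed.

Lemma csum_unique a z : csummable a ->
  ((fun n => complex.Re (\sum_(1 <= k < n) a k)) @ \oo --> complex.Re z) ->
  ((fun n => complex.Im (\sum_(1 <= k < n) a k)) @ \oo --> complex.Im z) ->
  csum a = z.
Proof.
move=> /csum_cvg[h1 h2] g1 g2; apply: cplx_eq.
  exact: (cvg_unique _ h1 g1).
exact: (cvg_unique _ h2 g2).
Qed.

Lemma csummable_lin (c : R[i]) a b : csummable a -> csummable b ->
  csummable (fun k => c * a k + b k).
Proof.
move=> sa sb; apply: (@le_lt_trans _ _ (nsum 1 (fun k => nrm1 c * nrm1 (a k) + nrm1 (b k)))).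
  apply: nsum_le => k; rewrite ?addr_ge0 ?mulr_ge0 ?nrm1_ge0// => _.
  by apply: le_trans (nrm1D _ _) _; rewrite lerD2r nrm1M.
rewrite nsumD => [|k|k]; rewrite ?mulr_ge0 ?nrm1_ge0//.
rewrite nsumZ => [|k]; rewrite ?nrm1_ge0// lte_add_pinfty//.
by rewrite lte_mul_pinfty// lee_fin nrm1_ge0.
Qed.

Lemma csum_lin (c : R[i]) a b : csummable a -> csummable b ->
  csum (fun k => c * a k + b k) = c * csum a + csum b.
Proof.
move=> sa sb; have [a1 a2] := csum_cvg sa; have [b1 b2] := csum_cvg sb.
have E n : \sum_(1 <= k < n) (c * a k + b k) =
    c * (\sum_(1 <= k < n) a k) + \sum_(1 <= k < n) b k.
  by rewrite big_split/= mulr_sumr.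
apply: csum_unique; first exact: csummable_lin.
  under eq_fun do (rewrite E; reim); reim.
  by apply: cvgD => //; apply: cvgB; apply: cvgMr.
under eq_fun do (rewrite E; reim); reim.
by apply: cvgD => //; apply: cvgD; apply: cvgMr.
Qed.

Lemma csum_tail a N : csummable a ->
  ((nrm1 (csum a - \sum_(1 <= k < N) a k))%:E <= nsum (maxn 1 N) (fun k => nrm1 (a k)))%E.
Proof.
move=> sa; have s0 k : 0 <= nrm1 (a k) by exact: nrm1_ge0.
have [c1 c2] := csum_cvg sa.
have tfin : nsum (maxn 1 N) (fun k => nrm1 (a k)) \is a fin_num.
  rewrite ge0_fin_numE ?nsum_ge0//; apply: le_lt_trans sa; apply: nsum_geqN => //.
  exact: leq_maxl.
rewrite -(fineK tfin) lee_fin.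
set S := \sum_(1 <= k < N) a k.
have cv : (fun n => nrm1 (\sum_(1 <= k < n) a k - S)) @ \oo --> nrm1 (csum a - S).
  rewrite /nrm1; reim; under eq_fun do reim.
  by apply: cvgD; apply: cvg_norm; apply: cvgB => //; exact: cvg_cst.
rewrite -(cvg_lim _ cv)//; apply: limr_le; first by apply/cvg_ex; eexists; exact: cv.
near=> n; have Nn : (N <= n)%N by near: n; exact: nbhs_infty_ge.
rewrite -lee_fin fineK//; apply: le_trans (nsum_partial (maxn 1 N) n s0); rewrite lee_fin /S.
have [N0|N0] := posnP N.
  by rewrite N0 [X in _ - X]big_geq// subr0; exact: nrm1_sum.
rewrite (big_cat_nat N0 Nn)/= addrAC subrr add0r (maxn_idPr _)//; exact: nrm1_sum.
Unshelve. all: by end_near. Qed.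

Lemma csum_bound a : csummable a ->
  ((nrm1 (csum a))%:E <= nsum 1 (fun k => nrm1 (a k)))%E.
Proof. by move=> sa; have := csum_tail 0 sa; rewrite big_geq// subr0. Qed.

(** The induction step is Cauchy-Schwarz in two dimensions: twice the real part
    X of the cross term is at most x B + y A. *)
Lemma csum_CS_fin (a b : nat -> R[i]) (r : seq nat) :
  sqnormc (\sum_(k <- r) a k * b k) <=
  (\sum_(k <- r) sqnormc (a k)) * (\sum_(k <- r) sqnormc (b k)).
Proof.
elim: r => [|k r IH]; first by rewrite !big_nil sqnormc0 mulr0.
rewrite !big_cons.
set S := \sum_(j <- r) _ in IH *; set A := \sum_(j <- r) _ in IH *.
set B := \sum_(j <- r) _ in IH *.
have A0 : 0 <= A by apply: sumr_ge0 => *; exact: sqnormc_ge0.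
have B0 : 0 <= B by apply: sumr_ge0 => *; exact: sqnormc_ge0.
have := sqnormcM (a k) (b k); move: (a k * b k) => p; move: (sqnormc_ge0 (a k)) (sqnormc_ge0 (b k)).
move: (sqnormc (a k)) (sqnormc (b k)) => x y x0 y0 pE.
pose X := complex.Re S * complex.Re p + complex.Im S * complex.Im p.
have XE : sqnormc (p + S) = sqnormc p + sqnormc S + 2 * X.
  by rewrite /sqnormc /X; reim; ring.
have X2 : X ^+ 2 <= (x * B) * (y * A).
  apply: (@le_trans _ _ (sqnormc S * sqnormc p)).
    rewrite -subr_ge0 (_ : _ - _ = (complex.Re S * complex.Im p - complex.Im S * complex.Re p) ^+ 2) ?sqr_ge0//.
    by rewrite /X /sqnormc; ring.
  rewrite pE (_ : x * B * (y * A) = (A * B) * (x * y)); last by ring.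
  by rewrite ler_wpM2r// mulr_ge0.
have X1 : 2 * X <= x * B + y * A.
  have h0 : 0 <= x * B + y * A by rewrite addr_ge0 ?mulr_ge0.
  apply: le_trans (ler_norm _) _; rewrite -(@ler_pXn2r _ 2) ?nnegrE//.
  rewrite real_normK ?num_real// exprMn.
  have := sqr_ge0 (x * B - y * A); move: X2; move: (X ^+ 2) => Q; nra.
by rewrite XE pE; nra.
Qed.

(** The finite inequality passes to the limit. *)
Lemma csum_CS (a b : nat -> R[i]) : csummable (fun k => a k * b k) ->
  ((sqnormc (csum (fun k => a k * b k)))%:E <=
   nsum 1 (fun k => sqnormc (a k)) * nsum 1 (fun k => sqnormc (b k)))%E.
Proof.
move=> sab; have [c1 c2] := csum_cvg sab.
have cv : (fun n => sqnormc (\sum_(1 <= k < n) a k * b k)) @ \oo -->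
    sqnormc (csum (fun k => a k * b k)).
  by rewrite /sqnormc !expr2; under eq_fun do rewrite !expr2; apply: cvgD; apply: cvgM.
have : ((fun n => (sqnormc (\sum_(1 <= k < n) a k * b k))%:E) @ \oo -->
    (sqnormc (csum (fun k => a k * b k)))%:E)%E by apply: cvg_EFin; [exact: nearW|].
move=> cvE; rewrite -(cvg_lim _ cvE)//; apply: lime_le; first by apply/cvg_ex; eexists; exact: cvE.
apply: nearW => n; apply: le_trans (_ : ((\sum_(1 <= k < n) sqnormc (a k)) *
    (\sum_(1 <= k < n) sqnormc (b k)))%:E <= _)%E; first by rewrite lee_fin csum_CS_fin.
rewrite EFinM; apply: lee_pmul; rewrite ?lee_fin ?sumr_ge0//; try by move=> *; exact: sqnormc_ge0.
  by apply: nsum_partial => k; exact: sqnormc_ge0.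
by apply: nsum_partial => k; exact: sqnormc_ge0.
Qed.

End ComplexSeries.

(** * Sobolev norms and synthesis from Fourier coefficients *)

Section Sobolev.
Context {R : realType}.
Implicit Types (u v : R -> R[i]) (c : int -> R[i]) (k N : nat) (n m : int).

(** The integers are partitioned by their absolute values. *)
Lemma esum_int (a : int -> R) : (forall n, 0 <= a n) -> a 0 = 0 ->
  (\esum_(n in [set: int]) (a n)%:E = nsum 1 (fun k => (a k%:Z + a (- k%:Z))%R))%E.
Proof.
move=> a0 az; pose J k := [set n : int | `|n|%N = k].
have tJ : trivIset setT J by move=> i j _ _ [n [<- <-]].
have UJ : \bigcup_(k in setT) J k = [set: int].
  by apply/seteqP; split => // n _; exists `|n|%N.
rewrite -UJ esum_bigcupT//.
have EJ k : (\esum_(j in J k.+1) (a j)%:E = (a k.+1%:Z + a (- k.+1%:Z))%:E)%E.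
  rewrite (esumID [set k.+1%:Z]); last by move=> *; rewrite lee_fin.
  rewrite (_ : J k.+1 `&` [set k.+1%:Z] = [set k.+1%:Z]); last first.
    by apply/seteqP; split => [n [_ //]|n /= ->].
  rewrite (_ : J k.+1 `&` ~` [set k.+1%:Z] = [set (- k.+1%:Z)]); last first.
    apply/seteqP; split => [n [/= h1 h2]|n /= ->].
      by case: n h1 h2 => j /= h1 h2; [case: h2; congr Posz|rewrite NegzE -h1].
    by split => //=; rewrite abszN.
  by rewrite !esum_set1 ?lee_fin// -EFinD.
have E0 : (\esum_(j in J 0%N) (a j)%:E = 0)%E.
  apply: esum1 => n /= /eqP; rewrite absz_eq0 => /eqP ->; by rewrite az.
rewrite -nneseries_esumT => [|k]; last by apply: esum_ge0 => *; rewrite lee_fin.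
rewrite nneseries_recl//; last by move=> k _; apply: esum_ge0 => *; rewrite lee_fin.
rewrite E0 add0e /nsum.
rewrite eseries_cond [RHS]eseries_cond; by apply: eq_eseriesr => -[|k]//= _; exact: EJ.
Qed.

Definition mode_energy u k : R :=
  sqnormc (fourier u k%:Z) + sqnormc (fourier u (- k%:Z)).

Lemma mode_energy_ge0 u k : 0 <= mode_energy u k.
Proof. by rewrite addr_ge0 ?sqnormc_ge0. Qed.

Lemma sobolevE (s : nat) u : (0 < s)%N ->
  sobolev s u = nsum 1 (fun k => k%:R ^+ s * mode_energy u k).
Proof.
move=> s0; rewrite /sobolev (esum_int (a := fun n => `|n|%N%:R ^+ s * sqnormc (fourier u n))).
- apply: eq_nsum => k _; rewrite abszN absz_nat /mode_energy; ring.
- by move=> n; rewrite mulr_ge0 ?sqnormc_ge0// exprn_ge0.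
- by rewrite absz0 expr0n gtn_eqF// mul0r.
Qed.

Lemma normH2E u : normH2 u = nsum 1 (fun k => k%:R * mode_energy u k).
Proof. by rewrite /normH2 sobolevE//; apply: eq_nsum => k _; rewrite expr1. Qed.

Lemma normH2_ge0 u : (0 <= normH2 u)%E.
Proof. by rewrite normH2E; apply: nsum_ge0 => k; rewrite mulr_ge0 ?mode_energy_ge0. Qed.

Lemma normH2_mode u n : ((`|n|%N%:R * sqnormc (fourier u n))%:E <= normH2 u)%E.
Proof.
have [->|n0] := eqVneq n 0; first by rewrite absz0 mul0r normH2_ge0.
rewrite normH2E; apply: le_trans (@nsum_term _ 1 `|n|%N _ _ _); last by rewrite absz_gt0.
  rewrite lee_fin ler_wpM2l// /mode_energy; case: n {n0} => k.
    by rewrite lerDl sqnormc_ge0.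
  by rewrite NegzE abszN lerDr sqnormc_ge0.
by move=> k; rewrite mulr_ge0 ?mode_energy_ge0.
Qed.

Lemma normH2Z (a : R[i]) u : circle_L2 u ->
  normH2 (fun x => a * u x) = ((sqnormc a)%:E * normH2 u)%E.
Proof.
move=> Lu; rewrite !normH2E -nsumZ => [|k]; last by rewrite mulr_ge0 ?mode_energy_ge0.
by apply: eq_nsum => k _; rewrite /mode_energy !fourierZ// !sqnormcM; ring.
Qed.

Lemma normH2D u v : circle_L2 u -> circle_L2 v ->
  (normH2 (fun x => (u x + v x)%R) <= 2%:E * normH2 u + 2%:E * normH2 v)%E.
Proof.
move=> Lu Lv; rewrite !normH2E.
have h w k : 0 <= k%:R * mode_energy w k by rewrite mulr_ge0 ?mode_energy_ge0.
rewrite -!nsumZ// -nsumD; try by move=> k; rewrite mulr_ge0.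
apply: nsum_le => k; first exact: h; first by rewrite addr_ge0// mulr_ge0.
move=> _; rewrite (_ : 2 * _ + 2 * _ =
  k%:R * (2 * mode_energy u k + 2 * mode_energy v k)); last by ring.
rewrite ler_wpM2l// /mode_energy !fourierD//.
have := sqnormcD (fourier u k%:Z) (fourier v k%:Z).
have := sqnormcD (fourier u (- k%:Z)) (fourier v (- k%:Z)).
lra.
Qed.

(** * Synthesis of functions from absolutely summable modes *)

Definition synth c (x : R) : R[i] :=
  csum (fun k => c k%:Z * emode k%:Z x + c (- k%:Z) * emode (- k%:Z) x).

Definition modes_summable c :=
  (nsum 1 (fun k => (nrm1 (c k%:Z) + nrm1 (c (- k%:Z)))%R) < +oo)%E.

Lemma nrm1_mode (z : R[i]) n (x : R) : nrm1 (z * emode n x) <= 2 * nrm1 z.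
Proof.
apply: le_trans (nrm1M _ _) _; rewrite mulrC ler_wpM2r ?nrm1_ge0//.
rewrite (_ : 2 = 1 + 1); last by ring.
by rewrite /nrm1 lerD ?Re_emode_le ?Im_emode_le.
Qed.

Section Synthesis.
Variable c : int -> R[i].
Hypothesis sc : modes_summable c.

Let term k x := c k%:Z * emode k%:Z x + c (- k%:Z) * emode (- k%:Z) x.
Let bnd k : R := 2 * (nrm1 (c k%:Z) + nrm1 (c (- k%:Z))).

Let bnd_ge0 k : 0 <= bnd k.
Proof. by rewrite mulr_ge0 ?addr_ge0 ?nrm1_ge0. Qed.

Let term_bnd k x : nrm1 (term k x) <= bnd k.
Proof. by apply: le_trans (nrm1D _ _) _; rewrite /bnd mulrDr lerD ?nrm1_mode. Qed.

Let bnd_fin : (nsum 1 bnd < +oo)%E.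
Proof.
rewrite nsumZ => [|k]; last by rewrite addr_ge0 ?nrm1_ge0.
by rewrite lte_mul_pinfty ?lee_fin.
Qed.

Let term_summable x : csummable (term ^~ x).
Proof.
by apply: le_lt_trans bnd_fin; apply: nsum_le => k; rewrite ?nrm1_ge0// => _; exact: term_bnd.
Qed.

Let partial N x := \sum_(1 <= k < N) term k x.

Let L2_term k : circle_L2 (term k).
Proof. by apply: L2D; apply: L2Z; exact: L2_emode. Qed.

Let L2_partial N : circle_L2 (partial N).
Proof. exact: L2_sum. Qed.

Let synth_tail N x : ((nrm1 (synth c x - partial N x))%:E <= nsum (maxn 1 N) bnd)%E.
Proof.
apply: le_trans (csum_tail N (term_summable x)) _.
by apply: nsum_le => k; rewrite ?nrm1_ge0// => _; exact: term_bnd.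
Qed.

(** The series converges uniformly, so its sum is bounded and measurable. *)
Lemma L2_synth : circle_L2 (synth c).
Proof.
have [M M0 hM] : exists2 M, 0 <= M & forall x, nrm1 (synth c x) <= M.
  have tf : nsum (maxn 1 0) bnd \is a fin_num.
    by rewrite ge0_fin_numE ?nsum_ge0//; apply: le_lt_trans bnd_fin; exact: nsum_geqN.
  exists (fine (nsum (maxn 1 0) bnd)); first by rewrite fine_ge0// nsum_ge0.
  by move=> x; have := synth_tail 0 x; rewrite /partial big_geq// subr0 -lee_fin (fineK tf).
apply: (@L2_bounded _ _ (M ^+ 2)).
- by move=> x; congr csum; apply/funext => k; rewrite !emode_periodic.
- apply: (@measurable_fun_cvg _ _ _ _ (fun N x => complex.Re (partial N x))).
    by move=> N; have [_ ? _ _] := L2_partial N.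
  by move=> x _; have [] := csum_cvg (term_summable x).
- apply: (@measurable_fun_cvg _ _ _ _ (fun N x => complex.Im (partial N x))).
    by move=> N; have [_ _ ? _] := L2_partial N.
  by move=> x _; have [] := csum_cvg (term_summable x).
- move=> x; apply: le_trans (sqnormc_nrm1 _) _.
  by rewrite ler_pXn2r ?nnegrE ?nrm1_ge0.
Qed.

Lemma fourier_partial N n : (`|n| < N)%N -> n != 0 -> fourier (partial N) n = c n.
Proof.
move=> nN n0; rewrite fourier_sum//.
have E k : fourier (term k) n = c k%:Z * (k%:Z == n)%:R + c (- k%:Z) * (- k%:Z == n)%:R.
  rewrite fourierD ?fourierZ ?fourier_emode//; try exact: L2_emode; apply: L2Z; exact: L2_emode.
rewrite (bigD1_seq `|n|%N) ?iota_uniq//=; last by rewrite mem_index_iota nN absz_gt0 n0.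
rewrite big_nat_cond big1 => [|k /andP[/andP[k0 _] kn]].
  rewrite E addr0; case: n n0 {nN E} => k k0.
    rewrite absz_nat eqxx mulr1 (_ : (- k%:Z == k%:Z) = false) ?mulr0 ?addr0//.
    by apply/negP => /eqP; move: k0; case: k.
  by rewrite NegzE abszN absz_nat eqxx mulr1 (_ : (k.+1%:Z == - k.+1%:Z) = false) ?mulr0 ?add0r.
rewrite E; have -> : (k%:Z == n) = false by apply: contraNF kn => /eqP <-; rewrite absz_nat.
have -> : (- k%:Z == n) = false by apply: contraNF kn => /eqP <-; rewrite abszN absz_nat.
by rewrite !mulr0 addr0.
Qed.

Lemma fourier_partial_out N n : (N <= `|n|)%N -> n != 0 -> fourier (partial N) n = 0.
Proof.
move=> nN n0; rewrite fourier_sum// big_nat big1// => k /andP[_ kN].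
rewrite fourierD ?fourierZ ?fourier_emode//; try exact: L2_emode;
  try (apply: L2Z; exact: L2_emode).
have kn : k != `|n|%N by rewrite ltn_eqF// (leq_trans kN).
have -> : (k%:Z == n) = false by apply: contraNF kn => /eqP <-; rewrite absz_nat.
have -> : (- k%:Z == n) = false by apply: contraNF kn => /eqP <-; rewrite abszN absz_nat.
by rewrite !mulr0 addr0.
Qed.

(** Uniform convergence, and a Fourier coefficient is bounded by the supremum of
    the function. *)
Lemma fourier_synth n : n != 0 -> fourier (synth c) n = c n.
Proof.
move=> n0; apply/eqP; rewrite -subr_eq0; apply/eqP/sqnormc_eq0.
apply/eqP; rewrite eq_le sqnormc_ge0 andbT.
apply/ler_addgt0Pr => e e0; rewrite add0r.
pose d := Num.min 1 (e / 2).
have d0 : 0 < d by rewrite lt_min ltr01 divr_gt0.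
have [M M1 hM] := nsum_tail bnd_ge0 bnd_fin d0.
pose N := maxn M (`|n|.+1)%N.
have NM : (M <= N)%N by exact: leq_maxl.
rewrite -(@fourier_partial N) ?leq_maxr// -fourierB//; last exact: L2_synth.
apply: le_trans (fourier_bound (M := d) n _ _ (ltW d0)) _.
- exact: L2B L2_synth (L2_partial N).
- move=> x; apply: le_trans (sqnormc_nrm1 _) _.
  rewrite ler_pXn2r ?nnegrE ?nrm1_ge0 ?(ltW d0)//.
  rewrite -lee_fin; apply: le_trans (synth_tail N x) (ltW _).
  by rewrite (maxn_idPr _) ?hM// (leq_trans M1).
have d1 : d <= 1 by rewrite ge_min lexx.
have d2 : d <= e / 2 by rewrite ge_min lexx orbT.
nra.
Qed.

End Synthesis.

End Sobolev.

(** * The half spaces, their projections, and bounded operators *)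

Section ClosedSpan.
Context {R : realType}.
Implicit Types (u v w : R -> R[i]) (k N : nat) (n m : int).
Variable f : nat -> int.
Hypothesis absf : forall k, `|f k|%N = k.

(* f is k |-> k or k |-> - k, so that both half spaces are treated at once. *)
Let fsign k : f k = k%:Z \/ f k = - k%:Z.
Proof.
case: (f k) (absf k) => j /=; first by move=> ->; left.
by move=> <-; right; rewrite NegzE.
Qed.

Let f_inj j k : (f j == f k) = (j == k).
Proof. by apply/eqP/eqP => [/(congr1 absz)|->//]; rewrite !absf. Qed.

Let f_opp j k : (0 < k)%N -> (f j == - f k) = false.
Proof.
move=> k0; apply/negP => /eqP h.
have jk : j = k by have := congr1 absz h; rewrite abszN !absf.
by move: h k0; rewrite jk; case: (fsign k) => ->; case: k {jk}.
Qed.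

Let f_neq0 k : (0 < k)%N -> f k != 0.
Proof. by move=> k0; rewrite -absz_eq0 absf -lt0n. Qed.

Let mode_energyE u k :
  mode_energy u k = sqnormc (fourier u (f k)) + sqnormc (fourier u (- f k)).
Proof. by rewrite /mode_energy; case: (fsign k) => ->; rewrite ?opprK// addrC. Qed.

Let S := closed_span (fun k => @emode R (f k)).

Let cut u (c : nat -> R[i]) N x := u x - \sum_(1 <= j < N) c j * emode (f j) x.

Let L2_cut u c N : circle_L2 u -> circle_L2 (cut u c N).
Proof. by move=> Lu; apply: L2B => //; apply: L2_sum => k; apply: L2Z; exact: L2_emode. Qed.

Let fourier_cut u c N n : circle_L2 u ->
  fourier (cut u c N) n = fourier u n - \sum_(1 <= j < N) c j * (f j == n)%:R.
Proof.
move=> Lu; have Le k : circle_L2 (fun x => c k * emode (f k) x) by apply: L2Z; exact: L2_emode.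
rewrite fourierB//; last exact: L2_sum.
rewrite fourier_sum//; congr (_ - _); apply: eq_bigr => j _.
by rewrite fourierZ ?fourier_emode//; exact: L2_emode.
Qed.

(** A truncated Fourier series approximates a function without the modes - f k;
    conversely no combination of the modes f j comes closer to u in norm than
    the size of its coefficient at - f k. *)
Lemma closed_spanP u : S u <-> H12 u /\ forall k, (0 < k)%N -> fourier u (- f k) = 0.
Proof.
split=> [[Hu dense]|[Hu u0]]; split => //; have [Lu fu] := Hu.
  move=> k k0; apply: sqnormc_eq0; apply/eqP; rewrite eq_le sqnormc_ge0 andbT.
  apply/ler_addgt0Pr => e e0; rewrite add0r.
  have [N [c Nc]] := dense e e0.
  have h := le_lt_trans (normH2_mode (cut u c N) (- f k)) Nc.
  move: h; rewrite lte_fin fourier_cut// big1 ?subr0 => [|j _]; last first.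
    by rewrite f_opp ?mulr0.
  rewrite abszN absf => /ltW; apply: le_trans.
  by rewrite ler_peMl ?sqnormc_ge0// ler1n.
move=> eps e0.
have fin : (nsum 1 (fun k => (k%:R * mode_energy u k)%R) < +oo)%E by rewrite -normH2E.
have pos k : 0 <= k%:R * mode_energy u k by rewrite mulr_ge0 ?mode_energy_ge0.
have [N N1 hN] := nsum_tail pos fin e0.
exists N, (fun k => fourier u (f k)).
have posw w k : 0 <= k%:R * mode_energy w k by rewrite mulr_ge0 ?mode_energy_ge0.
rewrite -/(cut u _ N) normH2E (nsum_split (posw _) N1) big_nat big1 => [|k /andP[k0 kN]].
  rewrite add0e; apply: le_lt_trans (hN N (leqnn N)).
  apply: nsum_le => // k Nk; rewrite !mode_energyE !fourier_cut//.
  rewrite big_nat big1 => [|j /andP[_ jN]]; last first.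
    by rewrite f_inj (ltn_eqF (leq_trans jN Nk)) mulr0.
  rewrite big1 ?subr0// => j _; rewrite f_opp ?mulr0//.
  exact: leq_trans Nk.
rewrite mode_energyE !fourier_cut//.
rewrite (bigD1_seq k) ?iota_uniq//= ?mem_index_iota ?k0// eqxx mulr1.
rewrite big1 => [|j jk]; last by rewrite f_inj (negbTE jk) mulr0.
rewrite big1 => [|j _]; last by rewrite f_opp ?mulr0.
by rewrite addr0 subrr u0// subr0 sqnormc0 addr0 mulr0.
Qed.

Lemma closed_span_mode k : (0 < k)%N -> S (emode (f k)).
Proof.
move=> k0; apply/closed_spanP; split.
  split; first exact: L2_emode.
  rewrite -/(normH2 _) normH2E.
  have pos j : 0 <= j%:R * mode_energy (@emode R (f k)) j.
    by rewrite mulr_ge0 ?mode_energy_ge0.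
  rewrite (nsum_split pos (ltn0Sn k)) lte_add_pinfty ?ltry//.
  rewrite (eq_nsum (b := fun j => 0 * (j%:R ^+ 2)^-1)) => [|j kj].
    rewrite nsumZ ?mul0e ?ltry// => j; by rewrite invr_ge0 sqr_ge0.
  rewrite mul0r mode_energyE !fourier_emode f_inj (ltn_eqF kj).
  by rewrite f_opp ?(leq_ltn_trans _ kj)// sqnormc0 addr0 mulr0.
by move=> j j0; rewrite fourier_emode f_opp.
Qed.

Lemma closed_span_L2 u : S u -> circle_L2 u. Proof. by case=> -[]. Qed.

Lemma closed_span_fin u : S u -> (normH2 u < +oo)%E. Proof. by case=> -[]. Qed.

Lemma closed_span_lin (a : R[i]) u v : S u -> S v -> S (fun x => a * u x + v x).
Proof.
move=> /closed_spanP[[Lu fu] u0] /closed_spanP[[Lv fv] v0].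
apply/closed_spanP; split; last first.
  by move=> k k0; rewrite fourier_lin// u0// v0// mulr0 addr0.
split; first exact: L2_lin.
apply: le_lt_trans (normH2D (L2Z a Lu) Lv) _; rewrite normH2Z//.
by rewrite lte_add_pinfty// !lte_mul_pinfty ?mule_ge0 ?normH2_ge0 ?lee_fin ?sqnormc_ge0//.
Qed.

Lemma closed_span0 : S (fun=> 0).
Proof.
have h := closed_span_mode (ltn0Sn 0); have := closed_span_lin (-1) h h.
by congr S; apply/funext => x; rewrite mulN1r addNr.
Qed.

(** The series of [csum] has the shape of the one that defines [innerH]. *)
Lemma innerH_csum u v : innerH u v =
  csum (fun k => `|k%:Z|%N%:R * (fourier u k%:Z * (fourier v k%:Z)^*) +
    `|- k%:Z|%N%:R * (fourier u (- k%:Z) * (fourier v (- k%:Z))^*)).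
Proof. by []. Qed.

Lemma innerH_eq0 u v : (forall n, n != 0 -> fourier u n = 0 \/ fourier v n = 0) ->
  innerH u v = 0.
Proof.
move=> uv; rewrite innerH_csum (@csum_fin _ _ 0%N) ?big_geq// => k _.
have z n : n != 0 -> fourier u n * (fourier v n)^* = 0.
  by case/uv => ->; rewrite ?mul0r// conjC0 mulr0.
case: k => [|k]; last by rewrite !z ?mulr0 ?addr0.
by rewrite oppr0 absz0 !mul0r addr0.
Qed.

Lemma innerH_mode u k : (0 < k)%N ->
  innerH u (emode (f k)) = k%:R * fourier u (f k).
Proof.
move=> k0; rewrite innerH_csum (@csum_fin _ _ k.+1) => [|j kj]; last first.
  rewrite !fourier_emode.
  have -> : (f k == j%:Z) = false.
    by apply/negP => /eqP /(congr1 absz); rewrite absf absz_nat => E; rewrite E ltnn in kj.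
  have -> : (f k == - j%:Z) = false.
    by apply/negP => /eqP /(congr1 absz); rewrite absf abszN absz_nat => E; rewrite E ltnn in kj.
  by rewrite !conjC0 !mulr0 addr0.
rewrite big_nat_recr//= big_nat big1 => [|j /andP[j0 jk]]; last first.
  rewrite !fourier_emode.
  have -> : (f k == j%:Z) = false.
    by apply/negP => /eqP /(congr1 absz); rewrite absf absz_nat => E; rewrite E ltnn in jk.
  have -> : (f k == - j%:Z) = false.
    by apply/negP => /eqP /(congr1 absz); rewrite absf abszN absz_nat => E; rewrite E ltnn in jk.
  by rewrite !conjC0 !mulr0 addr0.
rewrite add0r abszN absz_nat !fourier_emode.
case: (fsign k) => ->.
  rewrite eqxx conjC1 mulr1 (_ : (k%:Z == - k%:Z) = false) ?conjC0 ?mulr0 ?addr0//.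
  by case: k k0.
rewrite eqxx conjC1 mulr1 (_ : (- k%:Z == k%:Z) = false) ?conjC0 ?mulr0 ?add0r//.
by case: k k0.
Qed.

(** The function v0 meets the condition that defines the projection of u, so the
    projection exists; testing that condition against the modes determines the
    coefficients of whichever representative is chosen. *)
Lemma proj_spec u v0 : circle_L2 u -> S v0 ->
  (forall k, (0 < k)%N -> fourier v0 (f k) = fourier u (f k)) ->
  S (proj S u) /\ forall k, (0 < k)%N -> fourier (proj S u) (f k) = fourier u (f k).
Proof.
move=> Lu Sv0 v0u.
pose Q := [set v | S v /\ forall w, S w -> innerH (fun x => u x - v x) w = 0].
have Qv0 : Q v0.
  split=> // w /closed_spanP[_ w0]; apply: innerH_eq0 => n n0.
  have Lv0 := closed_span_L2 Sv0.
  have k0 : (0 < `|n|)%N by rewrite absz_gt0.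
  have [nE|nE] : n = f `|n|%N \/ n = - f `|n|%N.
    by case: (fsign `|n|%N) => ->; case: n {n0 k0} => j; rewrite ?NegzE ?abszN ?absz_nat ?opprK; auto.
  - by left; rewrite fourierB// nE -v0u// subrr.
  - by right; rewrite nE w0.
have [Sv vu] : Q (proj S u) by rewrite /proj; case: xgetP => [v _ //|/(_ v0)].
split => // k k0; have := vu _ (closed_span_mode k0); rewrite innerH_mode//.
move=> /eqP; rewrite mulf_eq0 natC; case/orP.
  by rewrite eq_complex/= eqxx andbT pnatr_eq0 gtn_eqF.
rewrite fourierB//; last exact: closed_span_L2.
by rewrite subr_eq0 => /eqP.
Qed.

(** The orthogonality condition that selects the projection sees u only through
    its nonconstant modes. *)
Lemma proj_congr u u' :
  (forall v n, S v -> n != 0 ->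
    fourier (fun x => u x - v x) n = fourier (fun x => u' x - v x) n) ->
  proj S u = proj S u'.
Proof.
move=> uu'.
have E v w : S v -> innerH (fun x => u x - v x) w = innerH (fun x => u' x - v x) w.
  move=> Sv; rewrite !innerH_csum; congr csum; apply/funext => -[|k].
    by rewrite oppr0 absz0 !mul0r.
  by rewrite !uu'.
pose Q t := [set v | S v /\ forall w, S w -> innerH (fun x => t x - v x) w = 0].
suff QE : Q u = Q u' by exact: (congr1 (xget (fun=> 0)) QE).
apply/seteqP; split=> v [Sv h]; split; try exact: Sv; move=> w Sw.
  exact: etrans (esym (E v w Sv)) (h w Sw).
exact: etrans (E v w Sv) (h w Sw).
Qed.

Let half (c : int -> R[i]) n := if n == f `|n|%N then c n else 0.

(** For an absolutely convergent Fourier series, keeping half of the modes gives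
    the projection as an actual function. *)
Lemma half_synth u : H12 u -> modes_summable (fourier u) ->
  S (synth (half (fourier u))) /\
  forall k, (0 < k)%N -> fourier (synth (half (fourier u))) (f k) = fourier u (f k).
Proof.
move=> [Lu fu] su.
have hE k : (0 < k)%N -> half (fourier u) (f k) = fourier u (f k).
  by move=> k0; rewrite /half absf eqxx.
have hN k : (0 < k)%N -> half (fourier u) (- f k) = 0.
  by move=> k0; rewrite /half abszN absf eq_sym f_opp.
have hle n : nrm1 (half (fourier u) n) <= nrm1 (fourier u n).
  by rewrite /half; case: ifP => // _; rewrite nrm1_0 nrm1_ge0.
have hle2 n : sqnormc (half (fourier u) n) <= sqnormc (fourier u n).
  by rewrite /half; case: ifP => // _; rewrite sqnormc0 sqnormc_ge0.
have sh : modes_summable (half (fourier u)).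
  apply: le_lt_trans su; apply: nsum_le => k; rewrite ?addr_ge0 ?nrm1_ge0// => _.
  by rewrite lerD ?hle.
have f0 k : (0 < k)%N -> - f k != 0 by move=> k0; rewrite oppr_eq0 f_neq0.
split; last by move=> k k0; rewrite fourier_synth ?hE ?f_neq0.
apply/closed_spanP; split; last by move=> k k0; rewrite fourier_synth ?hN ?f0.
split; first exact: L2_synth.
apply: le_lt_trans fu; rewrite -!/(normH2 _) !normH2E.
apply: nsum_le => k; rewrite ?mulr_ge0 ?mode_energy_ge0// => k0.
have kz : k%:Z != 0 by case: k k0.
rewrite ler_wpM2l// /mode_energy !fourier_synth ?oppr_eq0//.
exact: lerD (hle2 _) (hle2 _).
Qed.

End ClosedSpan.

Section Operators.
Context {R : realType}.
Implicit Types (u v w : R -> R[i]) (T U : (R -> R[i]) -> R -> R[i]).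
Implicit Types (k N m j : nat) (n : int).

Lemma absz_pos k : `|k%:Z|%N = k. Proof. exact: absz_nat. Qed.
Lemma absz_neg k : `|- k%:Z|%N = k. Proof. by rewrite abszN absz_nat. Qed.

Lemma posz_neq0 k : (0 < k)%N -> k%:Z != 0. Proof. by case: k. Qed.
Lemma negz_neq0 k : (0 < k)%N -> - k%:Z != 0. Proof. by rewrite oppr_eq0; case: k. Qed.

Lemma HplusP u : Hplus u <-> H12 u /\ forall k, (0 < k)%N -> fourier u (- k%:Z) = 0.
Proof. exact: (closed_spanP absz_pos). Qed.

Lemma HminusP u : Hminus u <-> H12 u /\ forall k, (0 < k)%N -> fourier u k%:Z = 0.
Proof.
rewrite /Hminus (closed_spanP absz_neg); split=> -[h u0]; split => // k k0.
  by rewrite -[k%:Z]opprK u0.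
by rewrite opprK u0.
Qed.

Lemma Hplus_L2 u : Hplus u -> circle_L2 u. Proof. by case=> -[]. Qed.
Lemma Hminus_L2 u : Hminus u -> circle_L2 u. Proof. by case=> -[]. Qed.

Lemma Hplus_lin (a : R[i]) u v : Hplus u -> Hplus v -> Hplus (fun x => a * u x + v x).
Proof. exact: (closed_span_lin absz_pos). Qed.

Lemma Hplus0 : Hplus (fun _ : R => 0 : R[i]).
Proof. exact: (closed_span0 absz_pos). Qed.

Lemma Hplus_emode m : (0 < m)%N -> Hplus (@emode R m%:Z).
Proof. exact: (closed_span_mode absz_pos). Qed.

Lemma Hplus_sum (c : nat -> R[i]) N :
  Hplus (fun x => \sum_(1 <= j < N) c j * emode j%:Z x).
Proof.
elim: N => [|N IH].
  by congr Hplus: Hplus0; apply/funext => x; rewrite big_geq.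
have [->|N0] := posnP N.
  by congr Hplus: Hplus0; apply/funext => x; rewrite big_geq.
have := Hplus_lin (c N) (Hplus_emode N0) IH; congr Hplus; apply/funext => x.
by rewrite big_nat_recr//= addrC.
Qed.

Lemma eq_op T u v n : u =1 v -> fourier (T u) n = fourier (T v) n.
Proof. by move=> /funext ->. Qed.

Section OneOperator.
Variable T : (R -> R[i]) -> R -> R[i].
Hypothesis bT : bounded_op Hplus Hminus T.

Lemma op_L2 u : Hplus u -> circle_L2 (T u).
Proof. by move=> Hu; have [h _ _] := bT; exact: Hminus_L2 (h u Hu). Qed.

Lemma op_lin (a : R[i]) u v n : Hplus u -> Hplus v -> n != 0 ->
  fourier (T (fun x => a * u x + v x)) n = a * fourier (T u) n + fourier (T v) n.
Proof.
move=> Hu Hv n0; have [_ lin _] := bT.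
rewrite (fourier_eqH _ _ (lin a u v Hu Hv) n0).
- by rewrite fourier_lin//; exact: op_L2.
- by apply: op_L2; exact: Hplus_lin.
- by apply: L2_lin; exact: op_L2.
Qed.

Lemma op_coef_bound (M : R) u n : op_norm_le Hplus T M -> Hplus u -> n != 0 ->
  ((sqnormc (fourier (T u) n))%:E <= (M ^+ 2)%:E * normH2 u)%E.
Proof.
move=> [_ hM] Hu n0; apply: le_trans (hM u Hu); apply: le_trans (normH2_mode _ n).
by rewrite lee_fin ler_peMl ?sqnormc_ge0// ler1n absz_gt0.
Qed.

Lemma op0 n : n != 0 -> fourier (T (fun=> 0)) n = 0.
Proof.
move=> n0; have := op_lin (-1) Hplus0 Hplus0 n0.
rewrite (_ : (fun x : R => _) = (fun=> 0)); last by apply/funext => x; rewrite mulN1r addNr.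
by move=> ->; rewrite mulN1r addNr.
Qed.

Lemma op_scale (a : R[i]) u n : Hplus u -> n != 0 ->
  fourier (T (fun x => a * u x)) n = a * fourier (T u) n.
Proof.
move=> Hu n0; have := op_lin a Hu Hplus0 n0; rewrite op0// addr0 => <-.
by apply: eq_op => x; rewrite addr0.
Qed.

Lemma op_sum (c : nat -> R[i]) N n : n != 0 ->
  fourier (T (fun x => \sum_(1 <= j < N) c j * emode j%:Z x)) n =
  \sum_(1 <= j < N) c j * fourier (T (emode j%:Z)) n.
Proof.
move=> n0.
have Z K : (K <= 1)%N ->
    fourier (T (fun x => \sum_(1 <= j < K) c j * emode j%:Z x)) n =
    \sum_(1 <= j < K) c j * fourier (T (emode j%:Z)) n.
  move=> K1; rewrite [RHS]big_geq// -[RHS](op0 n0); apply: eq_op => x.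
  by rewrite big_geq.
elim: N => [|N IH]; first exact: Z.
have [N0|N0] := posnP N; first by apply: Z; rewrite N0.
rewrite big_nat_recr//= addrC -IH -op_lin//; [|exact: Hplus_emode|exact: Hplus_sum].
by apply: eq_op => x; rewrite big_nat_recr//= addrC.
Qed.

Lemma op_eplus m n : (0 < m)%N -> n != 0 ->
  fourier (T (eplus m)) n = ((Num.sqrt m%:R)^-1)%:C * fourier (T (emode m%:Z)) n.
Proof. by move=> m0 n0; rewrite -op_scale//; exact: Hplus_emode. Qed.

Lemma op_neg_modes u : Hplus u ->
  normH2 (T u) = nsum 1 (fun k => k%:R * sqnormc (fourier (T u) (- k%:Z))).
Proof.
move=> Hu; have [h _ _] := bT; have /HminusP[_ z] := h u Hu.
rewrite normH2E; apply: eq_nsum => k k0.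
by rewrite /mode_energy z// sqnormc0 add0r.
Qed.

Lemma Hplus_eplus m : (0 < m)%N -> Hplus (@eplus R m).
Proof.
move=> m0; have := Hplus_lin ((Num.sqrt m%:R)^-1)%:C (Hplus_emode m0) Hplus0.
by congr Hplus; apply/funext => x; rewrite addr0.
Qed.

Lemma sqnormc_invsqrt m : (0 < m)%N ->
  sqnormc (((Num.sqrt m%:R)^-1)%:C : R[i]) = m%:R^-1.
Proof. by move=> m0; rewrite sqnormcC exprVn sqr_sqrtr. Qed.

Lemma op_eplus_norm m : (0 < m)%N ->
  normH2 (T (eplus m)) =
  nsum 1 (fun k => m%:R^-1 * (k%:R * sqnormc (fourier (T (emode m%:Z)) (- k%:Z)))).
Proof.
move=> m0; rewrite op_neg_modes; last exact: Hplus_eplus.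
apply: eq_nsum => k k0; rewrite op_eplus// ?negz_neq0// sqnormcM sqnormc_invsqrt//.
by rewrite mulrCA.
Qed.

End OneOperator.

(** Bounded operators are determined by their values on the exponentials, whose
    combinations approximate every element of the domain. *)
Lemma op_ext T U : bounded_op Hplus Hminus T -> bounded_op Hplus Hminus U ->
  (forall m n, (0 < m)%N -> n != 0 ->
    fourier (T (emode m%:Z)) n = fourier (U (emode m%:Z)) n) ->
  eq_op_plus T U.
Proof.
move=> bT bU TU u Hu; apply: eqH_fourier; [exact: op_L2|exact: op_L2|].
move=> n n0; apply/eqP; rewrite -subr_eq0; apply/eqP/sqnormc_eq0.
apply/eqP; rewrite eq_le sqnormc_ge0 andbT; apply/ler_addgt0Pr => e e0; rewrite add0r.
have [_ _ [M1 hM1]] := bT; have [_ _ [M2 hM2]] := bU.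
pose K := 2 * M1 ^+ 2 + 2 * M2 ^+ 2 + 1.
have K0 : 0 < K by rewrite ltr_wpDl// addr_ge0// mulr_ge0// sqr_ge0.
have eK : 0 < e / K by rewrite divr_gt0.
have [N [c hN]] := Hu.2 _ eK.
set p := (fun x => \sum_(1 <= j < N) c j * emode j%:Z x).
pose r x := u x - p x.
have Hp : Hplus p by exact: Hplus_sum.
have Hr : Hplus r.
  have := Hplus_lin (-1) Hp Hu; congr Hplus; apply/funext => x.
  by rewrite mulN1r addrC.
have E W : bounded_op Hplus Hminus W ->
    fourier (W u) n = fourier (W r) n + fourier (W p) n.
  move=> bW; rewrite -[X in X + _]mul1r -op_lin//; apply: eq_op => x; by rewrite mul1r subrK.
have Tp : fourier (T p) n = fourier (U p) n.
  rewrite !op_sum//; apply: eq_big_nat => j /andP[j0 _]; by rewrite TU.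
rewrite (E T bT) (E U bU) Tp opprD addrACA subrr addr0.
apply: le_trans (sqnormcB _ _) _.
have rf : normH2 r \is a fin_num.
  by rewrite ge0_fin_numE ?normH2_ge0//; apply: lt_trans hN _; rewrite ltry.
have hr : fine (normH2 r) <= e / K by rewrite -lee_fin fineK// ltW.
have r0 : 0 <= fine (normH2 r) by rewrite fine_ge0// normH2_ge0.
have B W M : bounded_op Hplus Hminus W -> op_norm_le Hplus W M ->
    sqnormc (fourier (W r) n) <= M ^+ 2 * fine (normH2 r).
  move=> bW hM; have := op_coef_bound hM Hr n0.
  by rewrite -(fineK rf) -EFinM lee_fin.
apply: le_trans (_ : K * (e / K) <= _); last by rewrite mulrC divfK// gt_eqF.
apply: le_trans (_ : K * fine (normH2 r) <= _); last by rewrite ler_wpM2l// ltW.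
have h1 := B _ _ bT hM1; have h2 := B _ _ bU hM2.
by rewrite /K mulrDl mul1r mulrDl; lra.
Qed.

(** * Hilbert-Schmidt norms and sums along antidiagonals *)

(** The source of the factor 1/6 and of the weight k^3 - k. *)
Lemma sum_convolution k : (6 * \sum_(1 <= m < k) (k - m) * m)%N = (k ^ 3 - k)%N.
Proof.
have T j : (2 * \sum_(1 <= m < j.+1) m)%N = (j * j.+1)%N.
  elim: j => [|j IH]; first by rewrite big_geq.
  by rewrite big_nat_recr//= mulnDr IH; nia.
have S j : (\sum_(1 <= m < j.+1) (j.+1 - m) * m =
    \sum_(1 <= m < j) (j - m) * m + \sum_(1 <= m < j.+1) m)%N.
  case: j => [|j]; first by rewrite !big_geq.
  rewrite [LHS]big_nat_recr//= [X in _ = (_ + X)%N]big_nat_recr//= addnA -big_split/=.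
  by congr addn; [apply: eq_big_nat => m /andP[? ?]; nia|nia].
elim: k => [|k IH]; first by rewrite big_geq.
rewrite S mulnDr IH; have := T k; set t := (\sum_(1 <= m < k.+1) m)%N => Tk.
have k3 : (k <= k ^ 3)%N by case: (k) => // j; rewrite -[leqLHS]expn1 leq_pexp2l.
by rewrite !expnS expn0 !muln1 in k3 *; nia.
Qed.

(** The substitution j = k + m, followed by an exchange of sums. *)
Lemma antidiagonals (F : nat -> nat -> R) : (forall m j, 0 <= F m j) ->
  (\sum_(1 <= m <oo) nsum 1 (fun k => F m (k + m)%N) =
   nsum 1 (fun j => (\sum_(1 <= m < j) F m j)%R))%E.
Proof.
move=> F0; pose G m j := if (m < j)%N then F m j else 0.
have G0 m j : 0 <= G m j by rewrite /G; case: ifP.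
have E m : nsum 1 (fun k => F m (k + m)%N) = nsum 1 (G m).
  rewrite (nsum_split (G0 m) (leq_addr m 1)) big_nat big1 ?add0e => [|j /andP[_ jm]].
    by rewrite -(nsum_shift 1 m (G0 m)); apply: eq_nsum => k k0; rewrite /G -[X in (X < _)%N]add0n ltn_add2r k0.
  by rewrite /G ltnNge -ltnS jm.
under eq_eseriesr do rewrite E.
rewrite nsum_interchange//; apply: eq_eseriesr => j _.
have p m : 0 <= G m j by [].
rewrite (nsum_split p (ltn0Sn j)) (eq_nsum (b := fun=> 0 * 0)) => [|m jm]; last first.
  by rewrite /G ltnNge (ltnW jm) mul0r.
rewrite nsumZ// mul0e adde0; congr EFin.
have [->|j0] := posnP j; first by rewrite !big_geq.
rewrite big_nat_recr//= {2}/G ltnn addr0.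
by apply: eq_big_nat => m /andP[_ mj]; rewrite /G mj.
Qed.

Lemma antidiagonal_sum (G : nat -> R) : (forall k, 0 <= G k) ->
  (\sum_(1 <= m <oo) nsum 1 (fun k => (k%:R * m%:R * G (k + m)%N)%R) =
   (6^-1)%:E * nsum 2 (fun k => ((k ^ 3 - k)%N%:R * G k)%R))%E.
Proof.
move=> G0.
have := @antidiagonals (fun m j => (j - m)%N%:R * m%:R * G j).
move=> /(_ (fun m j => mulr_ge0 (mulr_ge0 (ler0n _ _) (ler0n _ _)) (G0 j))) h.
rewrite (_ : (\sum_(1 <= m <oo) _)%E =
  (\sum_(1 <= m <oo) nsum 1 (fun k => ((k + m - m)%N%:R * m%:R * G (k + m)%N)%R))%E); last first.
  by apply: eq_eseriesr => m _; apply: eq_nsum => k _; rewrite addnK.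
rewrite h -nsumZ => [|k]; last by rewrite mulr_ge0.
rewrite (eq_nsum (b := fun k => 6^-1 * ((k ^ 3 - k)%N%:R * G k))) => [|k _]; last first.
  rewrite -mulr_suml mulrA; congr (_ * _).
  rewrite -sum_convolution natrM natr_sum mulrA mulVf ?pnatr_eq0// mul1r.
  by apply: eq_bigr => m _; rewrite natrM.
have p k : 0 <= 6^-1 * ((k ^ 3 - k)%N%:R * G k) by rewrite !mulr_ge0.
by rewrite (nsum_split p (leqnSn 1)) big_nat1 exp1n subnn mul0r mulr0 add0e.
Qed.

(** The orthonormal basis vectors carry 1/m and the norm of the target carries
    k, so the entry (k, m) contributes (k / m) m^2 |g (k + m)|^2, which is
    k m |g (k + m)|^2: summing along antidiagonals gives the formula. *)
Lemma hankel_HS T (g : nat -> R[i]) : bounded_op Hplus Hminus T ->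
  (forall m k, (0 < m)%N -> (0 < k)%N ->
    fourier (T (emode m%:Z)) (- k%:Z) = 'i%C * m%:R * g (k + m)%N) ->
  HS_norm2 T = ((6^-1)%:E * nsum 2 (fun k => ((k ^ 3 - k)%N%:R * sqnormc (g k))%R))%E.
Proof.
move=> bT Tg; rewrite -antidiagonal_sum => [|k]; last exact: sqnormc_ge0.
rewrite /HS_norm2 eseries_cond [RHS]eseries_cond; apply: eq_eseriesr => m /= m0.
rewrite op_eplus_norm//; apply: eq_nsum => k k0; rewrite Tg// !sqnormcM sqnormci mul1r.
rewrite sqnormc_nat; have : m%:R != 0 :> R by rewrite pnatr_eq0 -lt0n.
by move=> h; field.
Qed.

End Operators.

(** * Smooth fields and the path x + t A(x) *)

Section SmoothFields.
Context {R : realType}.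
Implicit Types (A f g : R -> R) (F : nat -> R -> R) (k n : nat).

Lemma deriv_unique f (x a b : R) : is_derive x 1 f a -> is_derive x 1 f b -> a = b.
Proof.
move=> ha hb; have := @derive_val _ _ _ _ _ _ _ ha.
by have := @derive_val _ _ _ _ _ _ _ hb => -> ->.
Qed.

Lemma derive1_is_derive f (x a : R) : is_derive x 1 f a -> derive1 f x = a.
Proof. by move=> h; rewrite derive1E; exact: (@derive_val _ _ _ _ _ _ _ h). Qed.

(** Higher derivatives are computed by exhibiting all of them at once, each the
    derivative of the previous one. *)
Lemma derive1n_tower F : (forall k (x : R), is_derive x 1 (F k) (F k.+1 x)) ->
  forall k, derive1n k (F 0%N) = F k.
Proof.
move=> dF; elim=> [|k IH]; first by rewrite derive1n0.
by rewrite derive1nS IH; apply/funext => x; exact: derive1_is_derive.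
Qed.

Lemma smooth_tower F : (forall k (x : R), is_derive x 1 (F k) (F k.+1 x)) -> smooth (F 0%N).
Proof.
move=> dF k x; rewrite (derive1n_tower dF).
exact: (@ex_derive _ _ _ _ _ _ _ (dF k x)).
Qed.

Lemma smooth_deriv A k (x : R) : smooth A -> is_derive x 1 (derive1n k A) (derive1n k.+1 A x).
Proof.
move=> sA; rewrite derive1nS derive1E; apply: DeriveDef => //; exact: sA.
Qed.

Lemma smooth_continuous A k : smooth A -> continuous (derive1n k A).
Proof. by move=> sA; apply: deriv_continuous => x; exact: smooth_deriv. Qed.

Lemma smooth_periodic A k : smooth_field A -> Defs.periodic (derive1n k A).
Proof.
move=> [pA sA]; elim: k => [|k IH] x; first by rewrite derive1n0 pA.
have d : is_derive (x + 2 * pi) 1 (derive1n k A) (derive1n k.+1 A (x + 2 * pi)).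
  exact: smooth_deriv.
have s : is_derive x 1 (fun y : R => y + 2 * pi) 1.
  by apply: deriv_eq (deriv_add (is_derive_id x 1) (deriv_cst x (2 * pi))) _; rewrite addr0.
have h := deriv_comp s d.
have e : (fun y : R => derive1n k A (y + 2 * pi)) = derive1n k A by apply/funext => y; exact: IH.
rewrite e mulr1 in h.
exact: (deriv_unique h (smooth_deriv k x sA)).
Qed.

Lemma smooth_bounded A k : smooth_field A -> exists2 M, 0 <= M & forall x, `|derive1n k A x| <= M.
Proof.
move=> sA; apply: periodic_bounded; [exact: smooth_periodic|exact: smooth_continuous sA.2].
Qed.

Lemma lipschitz_deriv f f' (M : R) : (forall x : R, is_derive x 1 f (f' x)) ->
  (forall x, `|f' x| <= M) -> forall x y, `|f x - f y| <= M * `|x - y|.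
Proof.
move=> df bM; have cf := deriv_continuous df.
have L a b : a <= b -> `|f b - f a| <= M * `|b - a|.
  move=> ab; have [c _ ->] := @MVT_segment R f f' a b ab (fun x _ => df x) (continuous_subspaceT cf).
  by rewrite normrM ler_wpM2r.
move=> x y; have [/L|/ltW/L//] := leP x y.
by rewrite distrC [X in _ <= _ * X]distrC.
Qed.

Lemma sin_lipschitz (x y : R) : `|sin x - sin y| <= `|x - y|.
Proof.
rewrite -[leRHS]mul1r; apply: (lipschitz_deriv (f' := cos)) => z.
by rewrite ler_norml cos_geN1 cos_le1.
Qed.

Lemma cos_lipschitz (x y : R) : `|cos x - cos y| <= `|x - y|.
Proof.
rewrite -[leRHS]mul1r; apply: (lipschitz_deriv (f' := fun z => - sin z)) => z.
by rewrite normrN ler_norml sin_geN1 sin_le1.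
Qed.

Lemma cos_taylor (s : R) : `|cos s - 1| <= s ^+ 2.
Proof.
have -> : cos s - 1 = - (2 * sin (s / 2) ^+ 2).
  by rewrite {1}(_ : s = s / 2 + s / 2) ?cosD; [have := cos2Dsin2 (s / 2) => h; nra|field].
have h0 : 0 <= 2 * sin (s / 2) ^+ 2 by rewrite mulr_ge0// sqr_ge0.
rewrite normrN (ger0_norm h0).
have := sin_lipschitz (s / 2) 0; rewrite sin0 !subr0 => h.
have : sin (s / 2) ^+ 2 <= (s / 2) ^+ 2.
  by rewrite -real_normK ?num_real// -[leRHS]real_normK ?num_real// ler_pXn2r ?nnegrE.
move=> h2; have := sqr_ge0 s; nra.
Qed.

Lemma sin_taylor (s : R) : `|sin s - s| <= `|s| ^+ 3.
Proof.
have d (x : R) : is_derive x 1 (fun y : R => sin y - y) (cos x - 1).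
  by apply: deriv_sub; exact: is_derive_id.
have cd : continuous (fun y : R => sin y - y) by exact: deriv_continuous d.
have L (r : R) : 0 <= r -> `|sin r - r| <= r ^+ 3.
  move=> r0; have [c cr] := @MVT_segment R (fun y : R => sin y - y) _ 0 r r0 (fun x _ => d x) (continuous_subspaceT cd).
  rewrite sin0 !subr0 => ->; rewrite normrM (ger0_norm r0) exprSr ler_wpM2r//.
  apply: le_trans (cos_taylor c) _; move: cr; rewrite in_itv/= => /andP[c0 c1].
  by rewrite ler_pXn2r ?nnegrE.
have [s0|s0] := leP 0 s; first by rewrite [X in _ <= X ^+ _]ger0_norm// L.
have s1 : 0 <= - s by rewrite oppr_ge0 ltW.
by have := L (- s) s1; rewrite sinN opprK -normrN opprD opprK (ltr0_norm s0).
Qed.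

Definition field_path A (t x : R) : R := x + t * A x.

Let path_tower A t k : R -> R := fun x =>
  match k with 0%N => x | 1%N => 1 | _ => 0 end + t * derive1n k A x.

Let path_tower_deriv A t k (x : R) : smooth A ->
  is_derive x 1 (path_tower A t k) (path_tower A t k.+1 x).
Proof.
move=> sA; apply: deriv_add; last by apply: deriv_scale; exact: smooth_deriv.
by case: k => [|[|k]]; [exact: is_derive_id|exact: deriv_cst|exact: deriv_cst].
Qed.

Let path_tower0 A t : field_path A t = path_tower A t 0.
Proof. by apply/funext => x; rewrite /path_tower derive1n0. Qed.

Lemma field_path_deriv A t (x : R) : smooth A ->
  is_derive x 1 (field_path A t) (1 + t * derive1n 1 A x).
Proof. by move=> sA; rewrite path_tower0; exact: path_tower_deriv. Qed.

(** As the derivative of Z is the same along all paths with initial vector field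
    A, this path alone determines it. It is affine in t, so it has no remainder;
    its maps are diffeomorphisms as long as |t| sup |A'| < 1. *)
Lemma field_path_smooth A : smooth_field A -> smooth_path (field_path A) A.
Proof.
move=> sA; have [pA smA] := sA; have [M M0 hM] := smooth_bounded 1 sA.
have M1 : 0 < 1 + M by rewrite ltr_pwDl.
split.
- by move=> x; rewrite /field_path mul0r addr0.
- exists (1 + M)^-1; split; first by rewrite invr_gt0.
    pose D (i j : nat) (t x : R) : R :=
      match i with 0%N => path_tower A t j x | 1%N => derive1n j A x | _ => 0 end.
    exists D; split; first by apply/funext => t; rewrite path_tower0.
    move=> i j t x _; split.
    + case: i => [|[|i]] /=; [|exact: deriv_cst|exact: deriv_cst].
      apply: deriv_eq (deriv_add (deriv_cst _ _) (deriv_mul (is_derive_id t 1) (deriv_cst _ _))) _.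
      by rewrite add0r mul1r mulr0 addr0.
    + case: i => [|[|i]] /=; [exact: path_tower_deriv|exact: smooth_deriv|exact: deriv_cst].
    + have cA : (fun p : R * R => derive1n j A p.2) @ (t, x) --> derive1n j A x.
        have h2 : (fun p : R * R => p.2) @ (t, x) --> x by exact: cvg_snd.
        by apply: (cvg_comp _ _ h2); exact: (smooth_continuous (k := j) smA).
      case: i => [|[|i]] /=; [|exact: cA|exact: cvg_cst].
      apply: cvgD; last by apply: cvgM; [exact: cvg_fst|exact: cA].
      by case: j {cA} => [|[|j]]; [exact: cvg_snd|exact: cvg_cst|exact: cvg_cst].
  move=> t td; split.
  + by rewrite path_tower0; apply: smooth_tower => k x; exact: path_tower_deriv.
  + by move=> x; rewrite /field_path pA addrAC.
  + move=> x; rewrite (derive1_is_derive (field_path_deriv t x smA)).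
    have : `|t * derive1n 1 A x| <= `|t| * M by rewrite normrM ler_wpM2l.
    have : `|t| * (1 + M) < 1 by rewrite -ltr_pdivlMr// div1r.
    rewrite mulrDr mulr1 ler_norml => h /andP[h1 _]; have := normr_ge0 t; lra.
- move=> k e e0; apply/nbhs_ballP; exists 1 => [|t _ x]; first exact: ltr01.
  rewrite (_ : (fun y => _) = (fun=> 0)); last first.
    by apply/funext => y; rewrite /field_path; ring.
  have -> : derive1n k (fun _ : R => 0 : R) = (fun=> 0).
    exact: (@derive1n_tower (fun _ _ => 0) (fun _ _ => deriv_cst _ _) k).
  by rewrite normr0 mulr_ge0 ?(ltW e0).
Qed.

End SmoothFields.

(** * The derivative of Z along x + t A(x) *)

Section Perturbation.
Context {R : realType}.
Implicit Types (u v : R -> R[i]) (k N : nat) (n : int) (t x : R).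
Notation mu := (@lebesgue_measure R).

Lemma nrm1C (r : R) : nrm1 (r%:C) = `|r|.
Proof. by rewrite /nrm1; reim; rewrite normr0 addr0. Qed.

Lemma nrm1iC (r : R) : nrm1 ('i%C * r%:C) = `|r|.
Proof.
rewrite (_ : 'i%C * r%:C = 0 +i* r); last by apply: cplx_eq; reim; ring.
by rewrite /nrm1; reim; rewrite normr0 add0r.
Qed.

Lemma emode_lipschitz (m : nat) x y :
  nrm1 (emode m%:Z x - emode m%:Z y) <= 2 * (m%:R * `|x - y|).
Proof.
rewrite /nrm1 /emode; reim.
have E : m%:R * `|x - y| = `|m%:~R * x - m%:~R * y|.
  by rewrite -mulrBr normrM ger0_norm.
rewrite (_ : 2 * _ = m%:R * `|x - y| + m%:R * `|x - y|); last by ring.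
by rewrite E lerD// ?cos_lipschitz ?sin_lipschitz.
Qed.

(** Two derivatives are enough to belong to the Hilbert space and to have an
    absolutely convergent Fourier series. *)
Lemma decay_normH2 u (B : R) :
  (forall n, n != 0 -> `|n|%N%:R ^+ 4 * sqnormc (fourier u n) <= 2 * B ^+ 2) ->
  (normH2 u <= (4 * B ^+ 2)%:E * nsum 1 (fun k => ((k%:R ^+ 2)^-1)%R))%E.
Proof.
move=> dec; have i0 k : 0 <= (k%:R ^+ 2)^-1 :> R by rewrite invr_ge0 sqr_ge0.
have B0 : 0 <= 4 * B ^+ 2 by rewrite mulr_ge0// sqr_ge0.
rewrite normH2E -nsumZ//; apply: nsum_le => [k|k|k k0].
- by rewrite mulr_ge0 ?mode_energy_ge0.
- exact: mulr_ge0 B0 (i0 k).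
have k1 : 1 <= k%:R :> R by rewrite ler1n.
rewrite ler_pdivlMr; last by rewrite exprn_gt0// ltr0n.
have h1 := dec _ (posz_neq0 k0); have h2 := dec _ (negz_neq0 k0).
rewrite absz_pos in h1; rewrite absz_neg in h2.
apply: (@le_trans _ _ (k%:R ^+ 4 * mode_energy u k)); last first.
  by rewrite /mode_energy; move: h1 h2; set p := sqnormc _; set q := sqnormc _; lra.
rewrite mulrAC -exprS ler_wpM2r ?mode_energy_ge0//.
by rewrite ler_weXn2l.
Qed.

Lemma decay_summable u (B : R) : 0 <= B ->
  (forall n, n != 0 -> `|n|%N%:R ^+ 4 * sqnormc (fourier u n) <= 2 * B ^+ 2) ->
  modes_summable (fourier u).
Proof.
move=> B0 dec; have i0 k : 0 <= (k%:R ^+ 2)^-1 :> R by rewrite invr_ge0 sqr_ge0.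
have h n : n != 0 -> nrm1 (fourier u n) <= 2 * B * (`|n|%N%:R ^+ 2)^-1.
  move=> n0; have n1 : 0 < `|n|%N%:R :> R by rewrite ltr0n absz_gt0.
  rewrite ler_pdivlMr ?exprn_gt0//.
  rewrite -(@ler_pXn2r _ 2) ?nnegrE ?mulr_ge0 ?nrm1_ge0 ?sqr_ge0//.
  rewrite exprMn -exprM mulrC; apply: le_trans (ler_wpM2l _ (nrm1_sq _)) _.
    by rewrite exprn_ge0// ltW.
  have := dec n n0; set p := _ ^+ _; set q := sqnormc _; nra.
apply: (@le_lt_trans _ _ (nsum 1 (fun k => 4 * B * (k%:R ^+ 2)^-1))).
  apply: nsum_le => k; rewrite ?addr_ge0 ?nrm1_ge0 ?mulr_ge0//.
  move=> k0; have := h _ (posz_neq0 k0); have := h _ (negz_neq0 k0).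
  rewrite absz_pos absz_neg; lra.
rewrite nsumZ// lte_mul_pinfty ?lee_fin ?mulr_ge0//; exact: nsum_invsq.
Qed.

Variables (A : R -> R) (m : nat).
Hypothesis sA : smooth_field A.

Let phi := field_path A.

Definition perturb t x : R[i] := emode m%:Z (phi t x) - emode m%:Z x.

Let phi_per t x : phi t (x + 2 * pi) = phi t x + 2 * pi.
Proof. by rewrite /phi /field_path sA.1 addrAC. Qed.

(** V_t e_m - e_m and its first two derivatives in x are O(t) uniformly, which
    the second derivative turns into decay of the modes. *)
Lemma perturb_decay : exists2 C : R, 0 <= C & forall t, `|t| <= 1 ->
  circle_L2 (perturb t) /\
  forall n, n != 0 -> `|n|%N%:R ^+ 4 * sqnormc (fourier (perturb t) n) <= 2 * (C * `|t|) ^+ 2.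
Proof.
have [M0 M00 hM0] := smooth_bounded 0 sA.
have [M1 M10 hM1] := smooth_bounded 1 sA.
have [M2 M20 hM2] := smooth_bounded 2 sA.
set c : R := m%:R; have c0 : 0 <= c by rewrite ler0n.
pose C := 2 * (c * M2) + 2 * (c ^+ 2 * (2 * M1 + M1 ^+ 2)) + c ^+ 2 * (2 * (c * M0)).
have C0 : 0 <= C by rewrite !addr_ge0// !mulr_ge0 ?addr_ge0 ?mulr_ge0 ?sqr_ge0.
exists C => // t t1.
pose P x := 1 + t * derive1n 1 A x.
pose P' x := t * derive1n 2 A x.
have dphi x : is_derive x 1 (phi t) (P x) by exact: field_path_deriv sA.2.
have dP x : is_derive x 1 P (P' x).
  apply: deriv_eq (deriv_add (deriv_cst x 1) (deriv_scale t (smooth_deriv 1 x sA.2))) _.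
  by rewrite add0r.
pose e x : R[i] := emode m%:Z (phi t x).
pose e0 x : R[i] := emode m%:Z x.
pose U1 x : R[i] := 'i%C * (c * P x)%:C * e x - 'i%C * c%:C * e0 x.
pose U2 x : R[i] := ('i%C * (c * P' x)%:C * e x + 'i%C * (c * P x)%:C * ('i%C * (c * P x)%:C * e x))
  - 'i%C * c%:C * ('i%C * c%:C * e0 x).
have de : cderiv e (fun x => 'i%C * (c * P x)%:C * e x) by exact: cderiv_emode_comp.
have de0 : cderiv e0 (fun x => 'i%C * c%:C * e0 x) by exact: cderiv_emode.
have neg w w' : cderiv w w' -> cderiv (fun x => - w x) (fun x => - w' x).
  move=> dw; have := cderivM (cderiv_cst (-1)) dw.
  rewrite (_ : (fun x : R => -1 * w x) = (fun x => - w x)); last by apply/funext => x; rewrite mulN1r.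
  by move=> h; apply: eq_cderiv h _ => x; rewrite mul0r add0r mulN1r.
have d0 : cderiv (perturb t) U1 by exact: (cderivD de (neg _ _ de0)).
have dcP : cderiv (fun x => 'i%C * (c * P x)%:C) (fun x => 'i%C * (c * P' x)%:C).
  apply: eq_cderiv (cderivM (cderiv_cst 'i%C) (cderiv_real (fun x => deriv_scale c (dP x)))) _ => x.
  by rewrite mul0r add0r.
have d1 : cderiv U1 U2.
  apply: (cderivD (cderivM dcP de)).
  apply: neg; apply: eq_cderiv (cderivM (cderiv_cst ('i%C * c%:C)) de0) _ => x.
  by rewrite mul0r add0r.
have pe : Defs.periodic e by move=> x; rewrite /e phi_per emode_periodic.
have pe0 : Defs.periodic e0 by exact: emode_periodic.
have pP : Defs.periodic P by move=> x; rewrite /P (smooth_periodic 1 sA).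
have pP' : Defs.periodic P' by move=> x; rewrite /P' (smooth_periodic 2 sA).
have p0 : Defs.periodic (perturb t) by move=> x; rewrite /perturb -/(e _) -/(e0 _) pe pe0.
have p1 : Defs.periodic U1 by move=> x; rewrite /U1 pe pe0 pP.
have p2 : Defs.periodic U2 by move=> x; rewrite /U2 pe pe0 pP pP'.
have ce := cderiv_ccont de; have ce0 := cderiv_ccont de0.
have cP' : ccont (fun x => 'i%C * (c * P' x)%:C).
  apply: ccontM (ccont_cst _) (ccont_real _) => x.
  by apply: cvgMr; apply: cvgMr; exact: (smooth_continuous (k := 2) sA.2).
have cP := cderiv_ccont dcP.
have cU2 : ccont U2.
  apply: ccontD; first by apply: ccontD; apply: ccontM => //; exact: ccontM.
  rewrite (_ : (fun x => - _) = (fun x => (- ('i%C * c%:C * ('i%C * c%:C))) * e0 x)).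
    exact: ccontM (ccont_cst _) ce0.
  by apply/funext => x; ring.
have bU2 x : nrm1 (U2 x) <= C * `|t|.
  (* each of the three terms is visibly O(t): P' and P^2 - 1 have a factor t *)
  have -> : U2 x = 'i%C * (c * P' x)%:C * e x - (c ^+ 2 * (P x ^+ 2 - 1))%:C * e x
      - (c ^+ 2)%:C * (e x - e0 x).
    rewrite /U2; move: (e x) (e0 x) (P x) (P' x) => z w p q.
    by apply: cplx_eq; reim; ring.
  have b1 : nrm1 ('i%C * (c * P' x)%:C * e x) <= 2 * (c * M2) * `|t|.
    apply: le_trans (nrm1M _ _) _; rewrite nrm1iC mulrC.
    have n2 : nrm1 (e x) <= 2.
      by have := nrm1_mode 1 m%:Z (phi t x); rewrite mul1r nrm1C normr1 mulr1.
    apply: le_trans (ler_wpM2r _ n2) _; first exact: normr_ge0.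
    rewrite -mulrA ler_wpM2l// /P' !normrM (ger0_norm c0) -mulrA ler_wpM2l//.
    by rewrite mulrC ler_wpM2r.
  have b2 : nrm1 ((c ^+ 2 * (P x ^+ 2 - 1))%:C * e x) <=
      2 * (c ^+ 2 * (2 * M1 + M1 ^+ 2)) * `|t|.
    apply: le_trans (nrm1_mode _ _ _) _; rewrite nrm1C -mulrA ler_wpM2l//.
    rewrite normrM (ger0_norm (sqr_ge0 c)) -mulrA ler_wpM2l ?sqr_ge0//.
    have -> : P x ^+ 2 - 1 = t * (derive1n 1 A x * (2 + t * derive1n 1 A x)) by rewrite /P; ring.
    rewrite normrM mulrC ler_wpM2r// normrM.
    apply: (@le_trans _ _ (M1 * (2 + M1))); last first.
      by rewrite (_ : M1 * (2 + M1) = 2 * M1 + M1 ^+ 2)//; ring.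
    apply: ler_pM => //; apply: le_trans (ler_normD _ _) _.
    rewrite ger0_norm// lerD2l normrM -[leRHS]mul1r.
    exact: ler_pM.
  have b3 : nrm1 ((c ^+ 2)%:C * (e x - e0 x)) <= c ^+ 2 * (2 * (c * M0)) * `|t|.
    apply: le_trans (nrm1M _ _) _; rewrite nrm1C (ger0_norm (sqr_ge0 c)) -mulrA.
    rewrite ler_wpM2l ?sqr_ge0//; apply: le_trans (emode_lipschitz _ _ _) _.
    rewrite -mulrA ler_wpM2l// -mulrA ler_wpM2l//.
    rewrite /phi /field_path addrAC subrr add0r normrM mulrC ler_wpM2r//.
  apply: le_trans (nrm1B _ _) _; apply: le_trans (lerD (nrm1B _ _) (lexx _)) _.
  rewrite (_ : C * `|t| = 2 * (c * M2) * `|t| + 2 * (c ^+ 2 * (2 * M1 + M1 ^+ 2)) * `|t|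
    + c ^+ 2 * (2 * (c * M0)) * `|t|); last by rewrite /C; ring.
  exact: lerD (lerD b1 b2) b3.
split; first exact: L2_ccont p0 (cderiv_ccont d0).
move=> n n0.
apply: (@fourier_decay _ (fun j => if j is 0%N then perturb t else if j is 1%N then U1 else U2) 2).
- by move=> [|[|j]].
- by move=> [|[|]].
- exact: cU2.
- by rewrite mulr_ge0.
- move=> x /=; apply: le_trans (sqnormc_nrm1 _) _.
  by rewrite ler_pXn2r ?nnegrE ?nrm1_ge0 ?mulr_ge0.
Qed.

(** The difference quotient of V_t e_m converges uniformly to i m A e_m, by the
    Taylor expansions of cos and sin at 0. *)
Lemma perturb_coef : exists2 C : R, 0 <= C & forall t, t != 0 -> `|t| <= 1 -> forall n,
  sqnormc ((t^-1)%:C * fourier (perturb t) n - 'i%C * m%:R * fourierR A (n - m%:Z)) <=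
    2 * (C * `|t|) ^+ 2.
Proof.
have [M M00 hM] := smooth_bounded 0 sA.
pose K := m%:R * M; have K0 : 0 <= K by rewrite mulr_ge0.
have C0 : 0 <= K ^+ 2 + K ^+ 3 by rewrite addr_ge0 ?exprn_ge0.
exists (K ^+ 2 + K ^+ 3) => // t t0 t1 n.
have [C' _ /(_ t t1)[Lp _]] := perturb_decay.
have cA : continuous A by have := smooth_continuous (k := 0) sA.2; rewrite derive1n0.
have LA : circle_L2 (fun x => (A x)%:C).
  by apply: L2_ccont; [move=> x; rewrite sA.1|exact: ccont_real].
have LAe : circle_L2 (fun x => (A x)%:C * emode m%:Z x) by exact: L2_mul_emode.
pose d x := (t^-1)%:C * perturb t x - 'i%C * m%:R * ((A x)%:C * emode m%:Z x).
have -> : (t^-1)%:C * fourier (perturb t) n - 'i%C * m%:R * fourierR A (n - m%:Z) = fourier d n.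
  rewrite /d (fourierB n (L2Z (t^-1)%:C Lp) (L2Z ('i%C * m%:R) LAe)).
  by rewrite (fourierZ _ n Lp) (fourierZ _ n LAe) fourierM_emode.
apply: fourier_bound; [by apply: L2B; exact: L2Z| |by rewrite mulr_ge0].
move=> x; pose s := m%:R * (t * A x).
have sb : `|s| <= K * `|t|.
  rewrite /s /K !normrM ger0_norm// -mulrA ler_wpM2l// mulrC ler_wpM2r//.
have -> : d x = ((cos s - 1) / t +i* ((sin s - s) / t)) * emode m%:Z x.
  rewrite /d /perturb /phi /field_path.
  have -> : emode m%:Z (x + t * A x) = (cos s +i* sin s) * emode m%:Z x.
    rewrite /emode mulrDr cosD sinD -/s; apply: cplx_eq; reim; ring.
  move: (emode m%:Z x) => z; rewrite natC.
  by apply: cplx_eq; reim; rewrite /s; field.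
rewrite sqnormcM sqnormc_emode mulr1 /sqnormc; reim.
have at0 : 0 < `|t| by rewrite normr_gt0.
have h1 : `|(cos s - 1) / t| <= K ^+ 2 * `|t|.
  rewrite normrM normrV ?unitfE// ler_pdivrMr//; apply: le_trans (cos_taylor s) _.
  rewrite -mulrA -expr2 -exprMn -real_normK ?num_real//.
  by rewrite ler_pXn2r ?nnegrE ?mulr_ge0.
have h2 : `|(sin s - s) / t| <= K ^+ 3 * `|t|.
  rewrite normrM normrV ?unitfE// ler_pdivrMr//; apply: le_trans (sin_taylor s) _.
  apply: (@le_trans _ _ ((K * `|t|) ^+ 3)); first by rewrite ler_pXn2r ?nnegrE ?mulr_ge0.
  rewrite (_ : (K * `|t|) ^+ 3 = K ^+ 3 * (`|t| * (`|t| * `|t|))); last by ring.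
  rewrite (_ : K ^+ 3 * `|t| * `|t| = K ^+ 3 * (`|t| * `|t|)); last by ring.
  apply: ler_wpM2l; first by rewrite exprn_ge0.
  by rewrite ler_piMl// mulr_ge0.
rewrite -(real_normK (num_real ((cos s - 1) / t))) -(real_normK (num_real ((sin s - s) / t))).
have a1 : 0 <= K ^+ 2 * `|t| by rewrite mulr_ge0 ?sqr_ge0.
have a2 : 0 <= K ^+ 3 * `|t| by rewrite mulr_ge0 ?exprn_ge0.
apply: (@le_trans _ _ ((K ^+ 2 * `|t|) ^+ 2 + (K ^+ 3 * `|t|) ^+ 2)).
  by rewrite lerD// ler_pXn2r ?nnegrE.
rewrite mulrDl; move: a1 a2; set p := _ * _; set q := _ * _ => a1 a2.
by have := mulr_ge0 a1 a2; nra.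
Qed.

(** For small t the maps of the path have inverses that are Lipschitz with
    constant 2. *)
Lemma field_path_null : exists2 d : R, 0 < d & forall t, `|t| < d -> forall P : R -> Prop,
  {ae mu, forall x, P x} -> {ae mu, forall x, P (phi t x)}.
Proof.
have [M M0 hM] := smooth_bounded 1 sA.
have M1 : 0 < 2 * (M + 1) by rewrite mulr_gt0// ltr_wpDl.
exists (2 * (M + 1))^-1; first by rewrite invr_gt0.
move=> t td P; apply: (@negligible_preimage _ (phi t) 2) => //.
  by apply: deriv_continuous => x; exact: field_path_deriv sA.2.
move=> x y; have L : `|A x - A y| <= M * `|x - y|.
  apply: lipschitz_deriv (hM) _ _ => z.
  by have := smooth_deriv 0 z sA.2; rewrite derive1n0.
have tM : `|t| * M <= 2^-1.
  have : `|t| * (2 * (M + 1)) < 1 by rewrite -ltr_pdivlMr// div1r.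
  by have := normr_ge0 t; nra.
have -> : phi t x - phi t y = (x - y) + t * (A x - A y) by rewrite /phi /field_path; ring.
have h : `|x - y| <= `|(x - y) + t * (A x - A y)| + `|t * (A x - A y)|.
  have := ler_normB ((x - y) + t * (A x - A y)) (t * (A x - A y)).
  by rewrite addrK.
rewrite [`|t * _|]normrM in h.
have h2 : `|t| * `|A x - A y| <= 2^-1 * `|x - y|.
  apply: le_trans (ler_wpM2l (normr_ge0 t) L) _.
  by rewrite mulrA ler_wpM2r.
by move: h h2; set a := `|x - y|; set b := `|t| * _; set z := `|_|; lra.
Qed.

End Perturbation.

Section Differential.
Context {R : realType}.
Implicit Types (u v w : R -> R[i]) (k N : nat) (n : int) (t x : R).
Notation mu := (@lebesgue_measure R).

Lemma Pplus_spec u : H12 u -> modes_summable (fourier u) ->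
  Hplus (Pplus u) /\ forall k, (0 < k)%N -> fourier (Pplus u) k%:Z = fourier u k%:Z.
Proof.
move=> Hu su; have [S1 S2] := half_synth absz_pos Hu su.
exact: (proj_spec absz_pos Hu.1 S1 S2).
Qed.

Lemma Pminus_spec u : H12 u -> modes_summable (fourier u) ->
  Hminus (Pminus u) /\ forall k, (0 < k)%N -> fourier (Pminus u) (- k%:Z) = fourier u (- k%:Z).
Proof.
move=> Hu su; have [S1 S2] := half_synth absz_neg Hu su.
exact: (proj_spec absz_neg Hu.1 S1 S2).
Qed.

(** The zero function satisfies the condition that defines this projection. *)
Lemma Pminus_Hplus u k : Hplus u -> (0 < k)%N -> fourier (Pminus u) (- k%:Z) = 0.
Proof.
move=> /HplusP[[Lu fu] u0] k0.
have [|_ ->//] := @proj_spec _ _ absz_neg u (fun=> 0) Lu (closed_span0 absz_neg).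
  by move=> j j0; rewrite fourier0 u0.
by rewrite u0.
Qed.

(** The projection of u o phi does not see a change of representative of u, as
    phi pulls null sets back to null sets. *)
Lemma Pminus_comp u v (phi : R -> R) : continuous phi -> circle_L2 u -> circle_L2 (v \o phi) ->
  (forall P : R -> Prop, {ae mu, forall x, P x} -> {ae mu, forall x, P (phi x)}) ->
  eqH u v -> Pminus (u \o phi) = Pminus (v \o phi).
Proof.
move=> cphi [_ u1 u2 _] Lv null [c uv]; apply: proj_congr => w n Sw n0.
have Lw : circle_L2 w by exact: closed_span_L2 Sw.
have mphi : measurable_fun [set: R] phi by exact: continuous_measurable_fun.
have m1 : measurable_fun [set: R] (fun x => complex.Re (u (phi x))).
  by apply: (measurableT_comp u1).
have m2 : measurable_fun [set: R] (fun x => complex.Im (u (phi x))).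
  by apply: (measurableT_comp u2).
have [_ w1 w2 _] := Lw.
have Lb : circle_L2 (fun x => (v (phi x) - w x) + c).
  by apply: L2D; [exact: L2B|exact: L2_cst].
have -> : fourier (fun x => (u \o phi) x - w x) n = fourier (fun x => (v (phi x) - w x) + c) n.
  symmetry; apply: fourier_ae => //.
  - rewrite (_ : (fun x => _) = fun x => complex.Re (u (phi x)) - complex.Re (w x)).
      exact: measurable_funB.
    by apply/funext => x; rewrite cReD cReN.
  - rewrite (_ : (fun x => _) = fun x => complex.Im (u (phi x)) - complex.Im (w x)).
      exact: measurable_funB.
    by apply/funext => x; rewrite cImD cImN.
  by apply: aeS (null _ uv) => x /= ->; rewrite addrAC.
rewrite (fourierD n (L2B Lv Lw) (L2_cst c)) fourier_cst eq_sym (negbTE n0) mulr0 addr0.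
by [].
Qed.

Lemma sqnormcD3 (a b c : R[i]) :
  sqnormc (a + b + c) <= 4 * sqnormc a + 4 * sqnormc b + 2 * sqnormc c.
Proof.
apply: le_trans (sqnormcD _ _) _; have := sqnormcD a b.
by move: (sqnormc (a + b)) (sqnormc a) (sqnormc b) (sqnormc c) => *; lra.
Qed.

Variables (A : R -> R) (T : (R -> R[i]) -> R -> R[i]).
Hypothesis sA : smooth_field A.
Let phi := field_path A.

Section Mode.
Variable m : nat.
Hypothesis m0 : (0 < m)%N.

Let V t x : R[i] := emode m%:Z (phi t x).
Let W t := Aop (phi t) (emode m%:Z).

Let fourier_V t n : circle_L2 (perturb A m t) ->
  fourier (V t) n = fourier (perturb A m t) n + (m%:Z == n)%:R.
Proof.
move=> Lp; rewrite -fourier_emode -fourierD//; last exact: L2_emode.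
by apply: eq_fourier => x; rewrite subrK.
Qed.

Let V_good : forall t, `|t| <= 1 -> H12 (V t) /\ modes_summable (fourier (V t)).
Proof.
have [C C0 hC] := perturb_decay m sA; move=> t t1.
have [Lp dec] := hC t t1.
have LV : circle_L2 (V t).
  have := L2D Lp (L2_emode m%:Z); congr circle_L2; apply/funext => x; by rewrite subrK.
pose B := 2 * (C * `|t|) + m%:R ^+ 2.
have C1 : 0 <= C * `|t| by rewrite mulr_ge0.
have B0 : 0 <= B by rewrite addr_ge0 ?mulr_ge0 ?exprn_ge0.
have decV n : n != 0 -> `|n|%N%:R ^+ 4 * sqnormc (fourier (V t) n) <= 2 * B ^+ 2.
  move=> n0; have h := dec n n0; rewrite fourier_V//.
  apply: le_trans (ler_wpM2l _ (sqnormcD _ _)) _; first by rewrite exprn_ge0.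
  have h2 : `|n|%N%:R ^+ 4 * sqnormc ((m%:Z == n)%:R : R[i]) <= (m%:R ^+ 2) ^+ 2.
    have [<-|_] := eqVneq m%:Z n; last by rewrite sqnormc0 mulr0 sqr_ge0.
    by rewrite absz_nat sqnormc_nat expr1n mulr1 -exprM.
  move: h h2; rewrite /B; set a := _ ^+ 4; set b := sqnormc _; set c := sqnormc _.
  set p := C * `|t| in C1 *; set q := m%:R ^+ 2 => h h2.
  have q0 : 0 <= q by rewrite /q exprn_ge0.
  have := mulr_ge0 C1 q0; nra.
split; last exact: decay_summable decV.
split=> //; apply: le_lt_trans (decay_normH2 decV) _.
by rewrite lte_mul_pinfty ?lee_fin ?mulr_ge0 ?sqr_ge0// nsum_invsq.
Qed.

Let W_spec t : `|t| <= 1 ->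
  Hplus (W t) /\ forall k, (0 < k)%N -> fourier (W t) k%:Z = fourier (V t) k%:Z.
Proof. by move=> /V_good[h1 h2]; exact: Pplus_spec h1 h2. Qed.

Let W_near t : `|t| <= 1 ->
  (normH2 (fun x => (W t x - emode m%:Z x)%R) <= normH2 (perturb A m t))%E.
Proof.
move=> t1; have [C _ /(_ t t1)[Lp _]] := perturb_decay m sA.
have [HW Wk] := W_spec t1; have LW := Hplus_L2 HW.
have /HplusP[_ W0] := HW.
rewrite !normH2E; apply: nsum_le => [k|k|k k0]; rewrite ?mulr_ge0 ?mode_energy_ge0//.
rewrite ler_wpM2l// /mode_energy (fourierB _ LW (L2_emode _)) (fourierB _ LW (L2_emode _)).
rewrite Wk// fourier_V// fourier_emode addrK lerD//.
have mk : (m%:Z == - k%:Z) = false by move: k0; clear -m0; case: k; case: m m0.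
by rewrite W0// fourier_emode mk subr0 sqnormc0 sqnormc_ge0.
Qed.

Let Z_of_W t Zt k : `|t| <= 1 -> (0 < k)%N ->
  (forall P : R -> Prop, {ae mu, forall x, P x} -> {ae mu, forall x, P (phi t x)}) ->
  is_Z (phi t) Zt -> fourier (Zt (W t)) (- k%:Z) = fourier (perturb A m t) (- k%:Z).
Proof.
move=> t1 k0 null [bZ [Ainv [bA AinvA _ ZB]]].
have [HV sV] := V_good t1; have [HW _] := W_spec t1.
have He := @Hplus_emode R m m0.
have [hA _ _] := bA; have HA : Hplus (Ainv (W t)) by exact: hA.
have eA : eqH (Ainv (W t)) (emode m%:Z) by exact: AinvA.
have cphi : continuous (phi t) by apply: deriv_continuous => x; exact: field_path_deriv sA.2.
have E : Bop (phi t) (Ainv (W t)) = Pminus (V t).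
  by rewrite /Bop /Vop (Pminus_comp cphi (Hplus_L2 HA) _ null eA)//; exact: HV.1.
have [HP Pk] := Pminus_spec HV sV.
have eZ := ZB _ HW; rewrite E in eZ.
apply: etrans (fourier_eqH (op_L2 bZ HW) (Hminus_L2 HP) eZ (negz_neq0 k0)) _.
apply: etrans (Pk k k0) _.
have [C _ /(_ t t1)[Lp _]] := perturb_decay m sA.
have mk : (m%:Z == - k%:Z) = false by move: k0; clear -m0; case: k; case: m m0.
rewrite (fourier_V _ Lp) mk; exact: addr0.
Qed.

Let Z_at_0 Z0 w k : Hplus w -> (0 < k)%N -> is_Z (phi 0) Z0 -> fourier (Z0 w) (- k%:Z) = 0.
Proof.
move=> Hw k0 [bZ [Ainv [bA _ _ ZB]]].
have [hA _ _] := bA; have HA : Hplus (Ainv w) by exact: hA.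
have E : Bop (phi 0) (Ainv w) = Pminus (Ainv w).
  by congr Pminus; apply/funext => x; rewrite /Vop/= /phi /field_path mul0r addr0.
have HP : Hminus (Pminus (Ainv w)).
  have /HplusP[[Lu fu] u0] := HA.
  have [|//] := @proj_spec _ _ absz_neg (Ainv w) (fun=> 0) Lu (closed_span0 absz_neg).
  by move=> j j0; rewrite fourier0 u0.
have eZ := ZB _ Hw; rewrite E in eZ.
apply: etrans (fourier_eqH (op_L2 bZ Hw) (Hminus_L2 HP) eZ (negz_neq0 k0)) _.
exact: Pminus_Hplus.
Qed.

(** Z_t maps w_t = P_+ V_t e_m to P_- V_t e_m, and w_t tends to e_m: dividing
    by t, the coefficients of T e_m are those of the derivative of V_t e_m. This
    avoids any formula for the inverse of A_t. *)
Lemma Z_derivative_coef k : (0 < k)%N -> Z_derivative phi T ->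
  fourier (T (emode m%:Z)) (- k%:Z) = 'i%C * m%:R * fourierR A (- (k + m)%N%:Z).
Proof.
move=> k0 [bT [Z [nZ dZ]]].
set F := fourier _ _; set L := _ * fourierR _ _.
apply/eqP; rewrite -subr_eq0; apply/eqP/sqnormc_eq0/eqP; rewrite eq_le sqnormc_ge0 andbT.
apply/ler_addgt0Pr => e e0; rewrite add0r.
have [C C0 hC] := perturb_decay m sA.
have [D D0 hD] := perturb_coef m sA.
have [d d0 hd] := field_path_null sA.
have [_ _ [M [M0 hM]]] := bT.
pose sig := fine (nsum 1 (fun k => (k%:R ^+ 2)^-1 : R)).
have i0 j : 0 <= (j%:R ^+ 2)^-1 :> R by rewrite invr_ge0 sqr_ge0.
have sigE : nsum 1 (fun k => (k%:R ^+ 2)^-1 : R) = sig%:E.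
  by rewrite fineK// ge0_fin_numE ?nsum_ge0// nsum_invsq.
have sig0 : 0 <= sig by rewrite fine_ge0// nsum_ge0.
have He := @Hplus_emode R m m0.
have Nf : normH2 (@emode R m%:Z) = (fine (normH2 (@emode R m%:Z)))%:E.
  rewrite fineK// ge0_fin_numE ?normH2_ge0//; exact: (closed_span_fin He).
set ne := fine (normH2 (@emode R m%:Z)) in Nf.
have ne0 : 0 <= ne by rewrite fine_ge0// normH2_ge0.
pose S := 4 * C ^+ 2 * sig.
have S0 : 0 <= S by rewrite !mulr_ge0 ?sqr_ge0.
pose B := 2 * S + 2 * ne.
have B0 : 0 <= B by rewrite addr_ge0 ?mulr_ge0.
(* total error: 4 M^2 S t^2 + 4 eps^2 B + 4 D^2 t^2 *)
pose K := 4 * (M ^+ 2 * S) + 4 * D ^+ 2 + 4 * B + 1.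
have K1 : 1 <= K by rewrite lerDr !addr_ge0 ?mulr_ge0 ?sqr_ge0.
have K0 : 0 < K by apply: lt_le_trans K1.
pose eps := Num.min 1 (e / K).
have eps0 : 0 < eps by rewrite lt_min ltr01 divr_gt0.
have eps1 : eps <= 1 by rewrite ge_min lexx.
have epsK : eps <= e / K by rewrite ge_min lexx orbT.
have [t [t0 [te [Zt dt]]]] : exists t, t != 0 /\ (`|t| < Num.min d eps) /\
    is_Z (phi t) (Z t) /\ op_norm_le Hplus
        (fun u x => (t^-1)%:C * (Z t u x - Z 0 u x) - T u x) eps.
  have P1 : \forall t \near (0 : R)^', is_Z (phi t) (Z t).
    exact: (@nbhs_dnbhs R 0 _ nZ).
  have P2 : \forall t \near (0 : R)^', `|t| < Num.min d eps.
    apply: (@nbhs_dnbhs R 0); apply/nbhs_ballP; exists (Num.min d eps) => /=; first by rewrite lt_min d0.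
    by move=> t; rewrite /ball/= sub0r normrN.
  have P3 : \forall t \near (0 : R)^', t != 0 by exact: nbhs_dnbhs_neq.
  have FF := @dnbhs_filter R 0; have PF := Proper_dnbhs_numFieldType (0 : R).
  have P4 := @filterI _ _ FF _ _ (@filterI _ _ FF _ _ (@filterI _ _ FF _ _ P1 P2) P3) (dZ eps eps0).
  have [t [[[h1 h2] h3] h4]] := @filter_ex _ _ PF _ P4.
  by exists t.
have [td teps] : `|t| < d /\ `|t| < eps by move: te; rewrite lt_min => /andP.
have t1 : `|t| <= 1 by apply: le_trans (ltW teps) eps1.
have Z0 : is_Z (phi 0) (Z 0) by exact: nbhs_singleton nZ.
have [Lp dec] := hC t t1.
have [HW Wk] := W_spec t1; have LW := Hplus_L2 HW.
have ts : `|t| ^+ 2 <= eps.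
  rewrite expr2; apply: le_trans (ler_piMl _ t1) (ltW teps); exact: normr_ge0.
have S_t : (normH2 (perturb A m t) <= (S * `|t| ^+ 2)%:E)%E.
  apply: le_trans (decay_normH2 dec) _; rewrite sigE -EFinM lee_fin.
  by rewrite le_eqVlt; apply/orP; left; apply/eqP; rewrite /S; ring.
pose dW x := W t x - emode m%:Z x.
have HdW : Hplus dW.
  have := Hplus_lin (-1) He HW; congr Hplus; apply/funext => x.
  by rewrite mulN1r addrC.
have ndW : (normH2 dW <= (S * `|t| ^+ 2)%:E)%E by apply: le_trans (W_near t1) S_t.
have nW : (normH2 (W t) <= B%:E)%E.
  have -> : W t = (fun x => dW x + emode m%:Z x) by apply/funext => x; rewrite subrK.
  apply: le_trans (normH2D (Hplus_L2 HdW) (L2_emode _)) _.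
  have -> : B%:E = (2%:E * S%:E + 2%:E * ne%:E)%E by [].
  rewrite Nf; apply: leeD => //.
  apply: lee_wpmul2l => //; apply: le_trans ndW _; rewrite lee_fin ler_piMr//.
  exact: le_trans ts eps1.
(* first error: T (w_t - e_m) *)
have E1 : sqnormc (F - fourier (T (W t)) (- k%:Z)) <= M ^+ 2 * (S * `|t| ^+ 2).
  have WE : fourier (T (W t)) (- k%:Z) = fourier (T dW) (- k%:Z) + F.
    rewrite -[X in X + _]mul1r -(op_lin bT)// ?negz_neq0//; apply: eq_op => x.
    by rewrite mul1r subrK.
  rewrite WE opprD addrCA subrr addr0 sqnormcN -lee_fin.
  apply: le_trans (op_coef_bound (M := M) _ HdW (negz_neq0 k0)) _; first by split.
  by rewrite [leRHS]EFinM; apply: lee_wpmul2l => //; rewrite lee_fin sqr_ge0.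
(* second error: the difference quotient of Z at w_t *)
have E2 : sqnormc (fourier (T (W t)) (- k%:Z) - (t^-1)%:C * fourier (perturb A m t) (- k%:Z))
    <= eps ^+ 2 * B.
  have LZt := op_L2 Zt.1 HW; have LZ0 := op_L2 Z0.1 HW; have LT := op_L2 bT HW.
  have [_ /(_ _ HW) h] := dt.
  have := le_trans (normH2_mode _ (- k%:Z)) h.
  have Lq : circle_L2 (fun x => (t^-1)%:C * (Z t (W t) x - Z 0 (W t) x)).
    by apply: L2Z; exact: L2B.
  rewrite (fourierB _ Lq LT) (fourierZ _ _ (L2B LZt LZ0)) (fourierB _ LZt LZ0).
  rewrite (Z_of_W t1 k0 (hd t td) Zt) (Z_at_0 HW k0 Z0) subr0 absz_neg => hh.
  rewrite -sqnormcN opprB -lee_fin.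
  apply: le_trans (le_trans hh _).
    by rewrite lee_fin ler_peMl ?sqnormc_ge0// ler1n.
  by rewrite [leRHS]EFinM; apply: lee_wpmul2l => //; rewrite lee_fin sqr_ge0.
(* third error: the difference quotient of V_t e_m *)
have E3 : sqnormc ((t^-1)%:C * fourier (perturb A m t) (- k%:Z) - L) <= 2 * (D * `|t|) ^+ 2.
  have := hD t t0 t1 (- k%:Z); rewrite /L.
  by rewrite (_ : - k%:Z - m%:Z = - (k + m)%N%:Z)// PoszD opprD.
set a := fourier (T (W t)) _ in E1 E2; set b := (t^-1)%:C * _ in E2 E3.
have -> : F - L = (F - a) + (a - b) + (b - L) by ring.
apply: le_trans (sqnormcD3 _ _ _) _.
apply: (@le_trans _ _ (K * eps)); last first.
  by apply: le_trans (ler_wpM2l (ltW K0) epsK) _; rewrite mulrC divfK// gt_eqF.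
have MS0 : 0 <= M ^+ 2 * S by rewrite mulr_ge0 ?sqr_ge0.
have q1 : M ^+ 2 * (S * `|t| ^+ 2) <= M ^+ 2 * S * eps by rewrite mulrA ler_wpM2l.
have q2 : eps ^+ 2 * B <= B * eps.
  by rewrite mulrC ler_wpM2l// expr2 ler_piMl// ltW.
have q3 : (D * `|t|) ^+ 2 <= D ^+ 2 * eps by rewrite exprMn ler_wpM2l ?sqr_ge0.
have K_E : K * eps = 4 * (M ^+ 2 * S * eps) + 4 * (D ^+ 2 * eps) + 4 * (B * eps) + eps.
  by rewrite /K; ring.
rewrite K_E; move: E1 E2 E3 q1 q2 q3.
set x1 := sqnormc _; set x2 := sqnormc _; set x3 := sqnormc _.
set y1 := _ * (S * _); set y2 := _ * B; set y3 := (D * _) ^+ 2.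
move=> *; lra.
Qed.

End Mode.

Lemma Zdot_coef m k : is_Zdot A T -> (0 < m)%N -> (0 < k)%N ->
  fourier (T (emode m%:Z)) (- k%:Z) = 'i%C * m%:R * fourierR A (- (k + m)%N%:Z).
Proof.
move=> dT m0 k0; have Z := dT _ (field_path_smooth sA).
exact: (Z_derivative_coef m0 k0 Z).
Qed.

Lemma Zdot_bounded : is_Zdot A T -> bounded_op Hplus Hminus T.
Proof. by move=> /(_ _ (field_path_smooth sA))[]. Qed.

End Differential.

(** * The extension to H^{3/2} *)

Section Extension.
Context {R : realType}.
Implicit Types (u v : R -> R[i]) (f g : R -> R) (k m j N : nat) (n : int).

(** The coefficients found for smooth fields make sense for all f in H^{3/2}:
    the entry (k, m) of the operator is i m f^(-(k+m)). *)
Definition hankel_term f u k m : R[i] :=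
  'i%C * m%:R * fourierR f (- (k + m)%N%:Z) * fourier u m%:Z.

Definition hankel f u n : R[i] :=
  if n is Negz k then csum (hankel_term f u k.+1) else 0.

Definition extension f u : R -> R[i] := synth (hankel f u).

Lemma hankel_neg f u k : (0 < k)%N -> hankel f u (- k%:Z) = csum (hankel_term f u k).
Proof. by case: k. Qed.

Definition wp_energy f := nsum 1 (fun k => k%:R ^+ 3 * sqnormc (fourierR f (- k%:Z))).

Lemma H32_energy f : H32 f -> (wp_energy f < +oo)%E.
Proof.
move=> [_]; rewrite sobolevE//; apply: le_lt_trans; apply: nsum_le => k.
- by rewrite mulr_ge0 ?sqnormc_ge0 ?exprn_ge0.
- by rewrite mulr_ge0 ?mode_energy_ge0 ?exprn_ge0.
move=> _; rewrite ler_wpM2l ?exprn_ge0//.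
by rewrite /mode_energy lerDr sqnormc_ge0.
Qed.

Lemma wp_weight k : (k ^ 3 - k)%N%:R <= k%:R ^+ 3 :> R.
Proof. by rewrite -natrX ler_nat leq_subr. Qed.

Lemma wp_sum_fin f : H32 f -> (wp_sum f < +oo)%E.
Proof.
move=> /H32_energy; apply: le_lt_trans.
have p k : 0 <= k%:R ^+ 3 * sqnormc (fourierR f (- k%:Z)).
  by rewrite mulr_ge0 ?sqnormc_ge0 ?exprn_ge0.
apply: le_trans (nsum_geqN p (leqnSn 1%N)).
apply: nsum_le => // k; first by rewrite mulr_ge0 ?sqnormc_ge0.
by move=> _; rewrite ler_wpM2r ?sqnormc_ge0// wp_weight.
Qed.

Lemma wp_sumE f :
  wp_sum f = nsum 2 (fun k => (k ^ 3 - k)%N%:R * sqnormc (fourierR f (- k%:Z))).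
Proof. by []. Qed.

Lemma wp_sum_ge0 f : (0 <= wp_sum f)%E.
Proof. by apply: nsum_ge0 => k; rewrite mulr_ge0 ?sqnormc_ge0. Qed.

Section Bounded.
Variables (f : R -> R) (u : R -> R[i]).
Hypotheses (Hf : H32 f) (Hu : Hplus u).

Let q k : R := sqnormc (fourierR f (- k%:Z)).
Let p m : R := sqnormc (fourier u m%:Z).
Let q0 k : 0 <= q k. Proof. exact: sqnormc_ge0. Qed.
Let p0 m : 0 <= p m. Proof. exact: sqnormc_ge0. Qed.

Let normu : (nsum 1 (fun m => m%:R * p m)%R <= normH2 u)%E.
Proof.
rewrite normH2E; apply: nsum_le => k; rewrite ?mulr_ge0 ?mode_energy_ge0// => _.
by rewrite ler_wpM2l// lerDl sqnormc_ge0.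
Qed.

Let part1 k m : R := (m%:R ^+ 2 * p m) * ((k + m)%N%:R ^+ 2)^-1.
Let part2 k m : R := (k + m)%N%:R ^+ 2 * q (k + m)%N.

Let part1_ge0 k m : 0 <= part1 k m.
Proof. by rewrite /part1 !mulr_ge0 ?invr_ge0 ?exprn_ge0. Qed.

Let part2_ge0 k m : 0 <= part2 k m.
Proof. by rewrite /part2 !mulr_ge0 ?exprn_ge0. Qed.

(* the inequality of the means applied to (m/j) |u^(m)| and j |f^(-j)|, j = k + m *)
Let term_bound k m : (0 < k)%N -> nrm1 (hankel_term f u k m) <= part1 k m + part2 k m.
Proof.
move=> k0; rewrite /hankel_term.
set z := fourierR _ _; set w := fourier _ _.
apply: le_trans (nrm1M _ _) _; apply: le_trans (ler_wpM2r (nrm1_ge0 _) (nrm1M _ _)) _.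
have -> : nrm1 ('i%C * m%:R) = m%:R :> R by rewrite natC nrm1iC ger0_norm.
have j0 : 0 < (k + m)%N%:R :> R by rewrite ltr0n addn_gt0 k0.
have hz := nrm1_sq z; have hw := nrm1_sq w.
have z0 := nrm1_ge0 z; have w0 := nrm1_ge0 w.
rewrite /part1 /part2 -/(q _) /p /q -/z -/w.
move: hz hw z0 w0; move: (nrm1 z) (nrm1 w) (sqnormc z) (sqnormc w) => a b c d hz hw a0 b0.
set J := (k + m)%N%:R in j0 *; clearbody J.
have J2 : 0 < J ^+ 2 by rewrite exprn_gt0.
have ab : 0 <= (m%:R * b / J - J * a) ^+ 2 by exact: sqr_ge0.
have E : (m%:R * b / J - J * a) ^+ 2 =
    (m%:R ^+ 2 * b ^+ 2) / J ^+ 2 - 2 * (m%:R * a * b) + J ^+ 2 * a ^+ 2.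
  by field; rewrite gt_eqF.
have h1 : (m%:R ^+ 2 * b ^+ 2) / J ^+ 2 <= 2 * (m%:R ^+ 2 * d / J ^+ 2).
  rewrite (_ : 2 * (_ * d / _) = m%:R ^+ 2 * (2 * d) / J ^+ 2); last by ring.
  by rewrite ler_wpM2r ?invr_ge0 ?(ltW J2)// ler_wpM2l ?sqr_ge0.
have h2 : J ^+ 2 * a ^+ 2 <= 2 * (J ^+ 2 * c).
  rewrite (_ : 2 * (_ * c) = J ^+ 2 * (2 * c)); last by ring.
  by rewrite ler_wpM2l// ltW.
by move: ab; rewrite E; lra.
Qed.

Let sum1 : (\sum_(1 <= k <oo) nsum 1 (part1 k) < +oo)%E.
Proof.
rewrite (nsum_interchange 1 1 part1_ge0).
apply: (@le_lt_trans _ _ (nsum 1 (fun m => m%:R * p m)%R)); last first.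
  by apply: le_lt_trans normu _; exact: (closed_span_fin Hu).
rewrite eseries_cond [leRHS]/nsum [leRHS]eseries_cond.
apply: lee_nneseries => [m _ /= _|m /= m0]; first by apply: nsum_ge0.
have i0 j : 0 <= (j%:R ^+ 2)^-1 :> R by rewrite invr_ge0 sqr_ge0.
rewrite nsumZ => [|k]; last by rewrite invr_ge0 sqr_ge0.
rewrite (nsum_shift 1 m i0) add1n.
apply: le_trans (lee_wpmul2l _ (nsum_invsq_tail m0)) _.
  by rewrite lee_fin mulr_ge0 ?sqr_ge0.
rewrite -EFinM lee_fin; have mn : m%:R != 0 :> R by rewrite pnatr_eq0 -lt0n.
by rewrite le_eqVlt; apply/orP; left; apply/eqP; field.
Qed.

Let sum2 : (\sum_(1 <= k <oo) nsum 1 (part2 k) < +oo)%E.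
Proof.
rewrite (nsum_interchange 1 1 part2_ge0).
have h2 m j : 0 <= j%:R ^+ 2 * q j by rewrite mulr_ge0 ?sqr_ge0.
rewrite (antidiagonals h2); apply: le_lt_trans (H32_energy Hf).
apply: nsum_le => j; first by apply: sumr_ge0 => m _; exact: h2.
  by rewrite mulr_ge0 ?exprn_ge0 ?sqnormc_ge0.
move=> j0; rewrite sumr_const_nat -[leLHS]mulr_natl mulrA.
apply: ler_wpM2r; first exact: q0.
by rewrite (exprS _ 2) ler_wpM2r ?sqr_ge0// ler_nat leq_subr.
Qed.

(** After the bound above, the first half is summed over k first, using
    sum_k 1/(k+m)^2 <= 1/m, and is at most the squared norm of u; the second half
    is summed along antidiagonals and is at most sum_j j^3 |f^(-j)|^2. Absolute
    convergence makes the image of u an actual function. *)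
Lemma hankel_double_summable :
  (\sum_(1 <= k <oo) nsum 1 (fun m => nrm1 (hankel_term f u k m)) < +oo)%E.
Proof.
apply: (@le_lt_trans _ _ (\sum_(1 <= k <oo) (nsum 1 (part1 k) + nsum 1 (part2 k)))%E).
  rewrite eseries_cond [leRHS]eseries_cond.
  apply: lee_nneseries => [k _ /= _|k /= k0].
    by apply: nsum_ge0 => m; exact: nrm1_ge0.
  rewrite -nsumD//; apply: nsum_le => m; first exact: nrm1_ge0.
    exact: addr_ge0.
  by move=> _; exact: term_bound.
rewrite nneseriesD; [|by move=> k _ _; exact: nsum_ge0..].
by rewrite lte_add_pinfty.
Qed.

Lemma hankel_row_summable k : (0 < k)%N -> csummable (hankel_term f u k).
Proof.
move=> k0; apply: le_lt_trans hankel_double_summable.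
pose F j := nsum 1 (fun m => nrm1 (hankel_term f u j m)).
have F0 j : (0 <= F j)%E by apply: nsum_ge0 => m; exact: nrm1_ge0.
rewrite -/(F k); apply: le_trans (@nneseries_lim_ge _ F xpredT 1 k.+1 (fun _ _ _ => F0 _)).
rewrite big_nat_recr//= leeDr//; apply: sume_ge0 => j _; exact: F0.
Qed.

Lemma hankel_summable : modes_summable (hankel f u).
Proof.
apply: le_lt_trans hankel_double_summable.
rewrite /nsum eseries_cond [leRHS]eseries_cond.
apply: lee_nneseries => [k _ /= _|[//|k] /= _]; first by rewrite lee_fin addr_ge0 ?nrm1_ge0.
rewrite nrm1_0 add0r; apply: csum_bound; exact: hankel_row_summable.
Qed.

Lemma extension_L2 : circle_L2 (extension f u).
Proof. exact: L2_synth hankel_summable. Qed.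

Lemma fourier_extension n : n != 0 -> fourier (extension f u) n = hankel f u n.
Proof. exact: fourier_synth hankel_summable n. Qed.

(** Cauchy-Schwarz bounds the norm of the extension by its Hilbert-Schmidt norm,
    which the sum along antidiagonals evaluates. *)
Lemma extension_bound :
  (normH2 (extension f u) <= (6^-1)%:E * wp_sum f * normH2 u)%E.
Proof.
set N := normH2 u; have Nf : N \is a fin_num.
  by rewrite ge0_fin_numE ?normH2_ge0//; exact: (closed_span_fin Hu).
have N0 : (0 <= N)%E by exact: normH2_ge0.
rewrite wp_sumE -(antidiagonal_sum q0) -(fineK Nf) muleC.
rewrite (nsum_interchange 1 1 (fun m k => mulr_ge0 (mulr_ge0 (ler0n _ k) (ler0n _ m)) (q0 _))).
have c0 k : (0 <= nsum 1 (fun m => (k%:R * m%:R * q (k + m)%N)%R))%E.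
  by apply: nsum_ge0 => m; rewrite !mulr_ge0.
rewrite -nneseriesZl; last by move=> k _; exact: c0.
rewrite normH2E /nsum eseries_cond [leRHS]eseries_cond.
apply: lee_nneseries => [k _ /= _|k /= k0].
  by rewrite lee_fin mulr_ge0 ?mode_energy_ge0.
rewrite /mode_energy !fourier_extension ?posz_neq0 ?negz_neq0//.
rewrite sqnormc0 add0r (hankel_neg _ _ k0).
pose a m : R[i] := 'i%C * (Num.sqrt m%:R)%:C * fourierR f (- (k + m)%N%:Z).
pose b m : R[i] := (Num.sqrt m%:R)%:C * fourier u m%:Z.
have sq m : (Num.sqrt m%:R)%:C * (Num.sqrt m%:R)%:C = m%:R :> R[i].
  by rewrite -RCM -expr2 sqr_sqrtr// -natC.
have E : hankel_term f u k = (fun m => a m * b m).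
  by apply/funext => m; rewrite /hankel_term /a /b -sq; ring.
have CS := csum_CS (a := a) (b := b); rewrite -E in CS.
have {}CS := CS (hankel_row_summable k0).
rewrite EFinM; apply: le_trans (lee_wpmul2l _ CS) _; first by rewrite lee_fin.
have bE : nsum 1 (fun m => sqnormc (b m)) = nsum 1 (fun m => m%:R * p m).
  by apply: eq_nsum => m _; rewrite /b sqnormcM sqnormcC sqr_sqrtr.
have aE : (k%:R%:E * nsum 1 (fun m => sqnormc (a m)))%E =
    nsum 1 (fun m => k%:R * m%:R * q (k + m)%N).
  rewrite -nsumZ => [|m]; last exact: sqnormc_ge0.
  by apply: eq_nsum => m _; rewrite /a 2!sqnormcM sqnormci sqnormcC sqr_sqrtr// /q; ring.
rewrite muleA aE bE muleC; apply: lee_wpmul2r => //.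
by rewrite (fineK Nf).
Qed.

Lemma extension_Hminus : Hminus (extension f u).
Proof.
apply/HminusP; split.
  split; first exact: extension_L2.
  apply: le_lt_trans extension_bound _.
  have wf := wp_sum_fin Hf; have Nf := closed_span_fin Hu.
  rewrite lte_mul_pinfty ?mule_ge0 ?wp_sum_ge0 ?lee_fin//.
  by rewrite fin_numM// ge0_fin_numE// wp_sum_ge0.
by move=> k k0; rewrite fourier_extension ?posz_neq0.
Qed.

End Bounded.

Lemma extension_lin f (a : R[i]) u v n : H32 f -> Hplus u -> Hplus v -> n != 0 ->
  fourier (extension f (fun x => a * u x + v x)) n =
  a * fourier (extension f u) n + fourier (extension f v) n.
Proof.
move=> Hf Hu Hv n0; apply: etrans (fourier_extension Hf (Hplus_lin a Hu Hv) n0) _.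
apply: etrans (congr2 (fun x y => a * x + y)
  (esym (fourier_extension Hf Hu n0)) (esym (fourier_extension Hf Hv n0))).
case: n n0 => k _ /=; first by rewrite mulr0 addr0.
apply: etrans (csum_lin a (hankel_row_summable Hf Hu _) (hankel_row_summable Hf Hv _)) => //.
congr csum; apply/funext => m; rewrite /hankel_term.
rewrite (fourier_lin _ _ (Hplus_L2 Hu) (Hplus_L2 Hv)).
by ring.
Qed.

Lemma extension_bounded f : H32 f -> bounded_op Hplus Hminus (extension f).
Proof.
move=> Hf; split.
- by move=> u Hu; exact: extension_Hminus.
- move=> a u v Hu Hv; apply: eqH_fourier.
  + exact: extension_L2 Hf (Hplus_lin a Hu Hv).
  + by apply: L2_lin; [exact: extension_L2 Hf Hu|exact: extension_L2 Hf Hv].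
  + move=> n n0; apply: etrans (extension_lin a Hf Hu Hv n0) (esym _).
    exact: fourier_lin (extension_L2 Hf Hu) (extension_L2 Hf Hv).
- have wf : wp_sum f \is a fin_num.
    by rewrite ge0_fin_numE ?wp_sum_ge0// wp_sum_fin.
  exists (Num.sqrt (6^-1 * fine (wp_sum f))); split; first exact: sqrtr_ge0.
  move=> u Hu; rewrite sqr_sqrtr; last by rewrite mulr_ge0// fine_ge0// wp_sum_ge0.
  by rewrite EFinM (fineK wf); exact: extension_bound.
Qed.

(** The series in m has a single term when u is an exponential. *)
Lemma extension_coef f m k : H32 f -> (0 < m)%N -> (0 < k)%N ->
  fourier (extension f (emode m%:Z)) (- k%:Z) =
  'i%C * m%:R * fourierR f (- (k + m)%N%:Z).
Proof.
move=> Hf m0 k0; apply: etrans (fourier_extension Hf (Hplus_emode m0) (negz_neq0 k0)) _.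
rewrite hankel_neg// (@csum_fin _ _ m.+1) => [|j mj]; last first.
  by rewrite /hankel_term fourier_emode eqz_nat (ltn_eqF mj) mulr0.
rewrite big_nat_recr//= big_nat big1 ?add0r => [|j /andP[_ jm]]; last first.
  by rewrite /hankel_term fourier_emode eqz_nat gtn_eqF// mulr0.
by rewrite /hankel_term fourier_emode eqxx mulr1.
Qed.

Lemma extension_HS f : H32 f -> HS_norm2 (extension f) = ((6^-1)%:E * wp_sum f)%E.
Proof.
move=> Hf; exact: (@hankel_HS _ _ (fun k => fourierR f (- k%:Z)) (extension_bounded Hf)
  (fun m k => @extension_coef f m k Hf)).
Qed.

Lemma H32_lin (a : R) f g : H32 f -> H32 g -> H32 (fun x => a * f x + g x).
Proof.
move=> [Lf ff] [Lg fg].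
have E : (fun x => (a * f x + g x)%:C) = (fun x => a%:C * (f x)%:C + (g x)%:C).
  by apply/funext => x; apply: cplx_eq; reim; ring.
split; rewrite E; first exact: L2_lin.
pose F x := (f x)%:C; pose G x := (g x)%:C.
have E3 (w : R -> R[i]) : sobolev 3 w = nsum 1 (fun k => k%:R ^+ 3 * mode_energy w k) by exact: sobolevE.
rewrite (E3 F) in ff; rewrite (E3 G) in fg; rewrite E3.
have c0 (w : R -> R[i]) k : 0 <= k%:R ^+ 3 * mode_energy w k by rewrite mulr_ge0 ?mode_energy_ge0 ?exprn_ge0.
pose s := 2 * sqnormc (a%:C).
have s0 : 0 <= s by rewrite mulr_ge0 ?sqnormc_ge0.
have b1 k : 0 <= s * (k%:R ^+ 3 * mode_energy F k) by exact: mulr_ge0.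
have b2 k : 0 <= 2 * (k%:R ^+ 3 * mode_energy G k) by exact: mulr_ge0.
apply: (@le_lt_trans _ _ (nsum 1 (fun k =>
    s * (k%:R ^+ 3 * mode_energy F k) + 2 * (k%:R ^+ 3 * mode_energy G k)))).
  apply: nsum_le => k; [exact: c0|exact: addr_ge0|move=> _].
  have h n : sqnormc (fourier (fun x => a%:C * F x + G x) n) <=
      s * sqnormc (fourier F n) + 2 * sqnormc (fourier G n).
    rewrite (fourier_lin a%:C n Lf Lg); apply: le_trans (sqnormcD _ _) _.
    by rewrite (sqnormcM a%:C) /s mulrA.
  have := h k%:Z; have := h (- k%:Z); rewrite /mode_energy.
  set x1 := sqnormc _; set x2 := sqnormc _; set x3 := sqnormc _.
  set y1 := sqnormc _; set y2 := sqnormc _; set y3 := sqnormc _.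
  have k3 : 0 <= k%:R ^+ 3 :> R by rewrite exprn_ge0.
  move: k3; move: (_ ^+ 3) => K K0 h1 h2; clearbody x1 x2 x3 y1 y2 y3 s.
  by have := mulr_ge0 K0 (addr_ge0 (etrans (subr_ge0 _ _) h1) (etrans (subr_ge0 _ _) h2)); lra.
have c1 := nsumZ 1 s (c0 F); have c2 := nsumZ 1 2 (c0 G).
rewrite (nsumD _ b1 b2) c1 c2; apply: lte_add_pinfty.
  by rewrite lte_mul_pinfty ?lee_fin ?s0 ?ff.
by rewrite lte_mul_pinfty ?lee_fin ?fg ?ler0n.
Qed.

Lemma fourierR_lin (a : R) f g n : H32 f -> H32 g ->
  fourierR (fun x => a * f x + g x) n = a%:C * fourierR f n + fourierR g n.
Proof.
move=> [Lf _] [Lg _]; rewrite /fourierR -fourier_lin//; apply: eq_fourier => x.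
by apply: cplx_eq; reim; ring.
Qed.

Lemma extension_linf (a : R) f g : H32 f -> H32 g ->
  eq_op_plus (extension (fun x => a * f x + g x))
    (fun u x => a%:C * extension f u x + extension g u x).
Proof.
move=> Hf Hg u Hu; have Hfg := H32_lin a Hf Hg.
have Lf := extension_L2 Hf Hu; have Lg := extension_L2 Hg Hu.
apply: eqH_fourier; [exact: extension_L2 Hfg Hu|exact: L2_lin|] => n n0.
apply: etrans (fourier_extension Hfg Hu n0) _.
apply: esym; apply: etrans (fourier_lin _ n Lf Lg) _.
apply: etrans (congr2 (fun x y => a%:C * x + y)
  (fourier_extension Hf Hu n0) (fourier_extension Hg Hu n0)) _.
case: n n0 => k _ /=; first by rewrite mulr0 addr0.
apply: etrans (esym (csum_lin a%:C (hankel_row_summable Hf Hu _) (hankel_row_summable Hg Hu _))) _ => //.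
congr csum; apply/funext => m; rewrite /hankel_term (fourierR_lin _ _ Hf Hg).
by ring.
Qed.

Lemma extension_congr f g u :
  (forall k, (2 <= k)%N -> fourierR f (- k%:Z) = fourierR g (- k%:Z)) ->
  extension f u = extension g u.
Proof.
move=> fg; suff E : hankel f u = hankel g u by rewrite /extension E.
apply/funext => -[k|k]; first exact: erefl.
rewrite /hankel; congr csum; apply/funext => -[|m]; first by rewrite /hankel_term mulr0 !mul0r.
by rewrite /hankel_term (fg (k.+1 + m.+1)%N)// addSn addnS.
Qed.

End Extension.

(** * Infinitesimal Moebius transformations *)

Section Moebius.
Context {R : realType}.
Implicit Types (f g : R -> R) (k : nat) (n : int).
Notation mu := (@lebesgue_measure R).

Lemma fourierR_conj f n : circle_L2 (fun x => (f x)%:C) ->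
  fourierR f (- n) = (fourierR f n)^*%C.
Proof.
move=> Lf; rewrite /fourierR.
have [h1 h2] := Cint_emode (- n) Lf.
have E : fourier (fun x => (f x)%:C) (- n) =
    ((2 * pi)^-1)%:C * (cintegral (fun x => (f x)%:C * emode (- n) x))^*%C.
  rewrite /fourier; congr (_ * _); rewrite opprK; apply: cplx_eq; reim; rewrite ?subr0.
    by apply: eq_Rintegral => x _; rewrite emodeNJ; reim; ring.
  rewrite -mulN1r -RintegralZl//; apply: eq_Rintegral => x _.
  by rewrite emodeNJ; reim; ring.
rewrite E /fourier; set z := cintegral _.
by apply: cplx_eq; reim; ring.
Qed.

Definition trig (a b c x : R) : R := a + b * cos x + c * sin x.

Lemma trig_modes a b c : (fun x => (trig a b c x)%:C) =
  (fun x => (2^-1 * b +i* (- (2^-1 * c))) * emode 1 x +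
    ((2^-1 * b +i* (2^-1 * c)) * emode (-1) x + a%:C)).
Proof.
have h : 2^-1 + 2^-1 = 1 :> R by lra.
apply/funext => x; rewrite emodeNJ /trig /emode mul1r.
by apply: cplx_eq; reim; move: (cos x) (sin x) => C S; field.
Qed.

Lemma L2_trig a b c : circle_L2 (fun x => (trig a b c x)%:C).
Proof.
rewrite trig_modes; apply: L2_lin; first exact: L2_emode.
by apply: L2_lin; [exact: L2_emode|exact: L2_cst].
Qed.

Lemma fourierR_trig a b c n : fourierR (trig a b c) n =
  (2^-1 * b +i* (- (2^-1 * c))) * (1 == n)%:R +
    ((2^-1 * b +i* (2^-1 * c)) * (-1 == n)%:R + a%:C * (0 == n)%:R).
Proof.
rewrite /fourierR trig_modes.
have L1 := L2_lin (2^-1 * b +i* (2^-1 * c)) (@L2_emode R (-1)) (L2_cst a%:C).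
rewrite (fourier_lin _ n (@L2_emode R 1) L1).
rewrite (fourier_lin _ n (@L2_emode R (-1)) (L2_cst a%:C)).
by rewrite !fourier_emode fourier_cst.
Qed.

Lemma L2R_B f g : circle_L2 (fun x => (f x)%:C) -> circle_L2 (fun x => (g x)%:C) ->
  circle_L2 (fun x => (f x - g x)%:C).
Proof.
move=> Lf Lg; rewrite (_ : (fun x => _) = (fun x => (f x)%:C - (g x)%:C)).
  exact: L2B.
by apply/funext => x; apply: cplx_eq; reim; rewrite ?subr0.
Qed.

Lemma fourierR_B f g n : circle_L2 (fun x => (f x)%:C) -> circle_L2 (fun x => (g x)%:C) ->
  fourierR (fun x => f x - g x) n = fourierR f n - fourierR g n.
Proof.
move=> Lf Lg; apply: etrans _ (fourierB n Lf Lg); apply: eq_fourier => x.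
by apply: cplx_eq; reim; rewrite ?subr0.
Qed.

Lemma moebius_fourier f g k : circle_L2 (fun x => (f x)%:C) -> circle_L2 (fun x => (g x)%:C) ->
  eq_mod_mobius f g -> (2 <= k)%N -> fourierR f (- k%:Z) = fourierR g (- k%:Z).
Proof.
move=> Lf Lg [a [b [c fg]]] k2.
have L := L2D Lg (L2_trig a b c).
have [_ m1 m2 _] := Lf.
have h : {ae mu, forall x : R, (g x)%:C + (trig a b c x)%:C = (f x)%:C}.
  by apply: aeS fg => x ->; apply: cplx_eq; reim; rewrite ?addr0.
apply: etrans (esym (fourier_ae _ L m1 m2 h)) _.
apply: etrans (fourierD _ Lg (L2_trig a b c)) _.
have -> : fourier (fun x => (trig a b c x)%:C) (- k%:Z) = 0.
  apply: etrans (fourierR_trig a b c (- k%:Z)) _.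
  case: k k2 => [//|[//|k]] _.
  by rewrite (_ : (1 == _) = false)// (_ : (-1 == _) = false)// (_ : (0 == _) = false)//
    !mulr0 !addr0.
by rewrite addr0.
Qed.

(** By conjugation the difference of f and g only has the modes 0, 1 and -1, and
    a real function with these modes is an infinitesimal Moebius
    transformation. *)
Lemma fourier_moebius f g : circle_L2 (fun x => (f x)%:C) -> circle_L2 (fun x => (g x)%:C) ->
  (forall k, (2 <= k)%N -> fourierR f (- k%:Z) = fourierR g (- k%:Z)) ->
  eq_mod_mobius f g.
Proof.
move=> Lf Lg fg; pose D := fourierR (fun x => f x - g x).
have Ld := L2R_B Lf Lg.
pose a := complex.Re (D 0); pose b := 2 * complex.Re (D 1); pose c := - 2 * complex.Im (D 1).
exists a, b, c.
have D0 k : (2 <= k)%N -> D (- k%:Z) = 0.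
  by move=> k2; rewrite /D (fourierR_B _ Lf Lg) fg// subrr.
have DJ n : D (- n) = (D n)^*%C by exact: fourierR_conj.
have Dtrig n : D n = fourierR (trig a b c) n.
  rewrite fourierR_trig.
  have [->|n0] := eqVneq n 0.
    have := DJ 0; rewrite oppr0 => /(congr1 (fun z => complex.Im z)); rewrite cImJ => h.
    rewrite (_ : (1 == 0 :> int) = false)// (_ : (-1 == 0 :> int) = false)// !mulr0 !add0r mulr1.
    by apply: cplx_eq; reim; rewrite /a; lra.
  have [->|n1] := eqVneq n 1.
    rewrite (_ : (-1 == 1 :> int) = false)// !mulr0 !addr0 mulr1.
    by apply: cplx_eq; reim; rewrite /b /c; field.
  have [->|n2] := eqVneq n (-1).
    rewrite !mulr0 !addr0 add0r mulr1.
    by rewrite DJ; apply: cplx_eq; reim; rewrite /b /c; field.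
  rewrite !mulr0 !addr0.
  case: n n0 n1 n2 => [[//|[//|k]]|[//|k]] _ _ _; last exact: (D0 k.+2).
  rewrite -[Posz k.+2]opprK DJ D0//; apply: cplx_eq; reim => //.
  by rewrite oppr0.
have := @fourier_null_ae0 R (fun x => ((f x - g x) - trig a b c x)%:C).
have Lt := L2_trig a b c.
case=> [|N [mN N0 sN]].
  split; first exact: L2R_B Ld Lt.
  move=> n; apply: etrans (fourierR_B n Ld Lt) _.
  by rewrite -/(D n) Dtrig subrr.
exists N; split=> // x /= h; apply: sN => /= e; apply: h.
move: e => /(congr1 (fun z => complex.Re z)); reim => e.
by move: e; rewrite /trig; lra.
Qed.

(** The images of e_1 already recover all the modes n <= -2. *)
Lemma extension_moebius f g : H32 f -> H32 g ->
  eq_op_plus (extension f) (extension g) <-> eq_mod_mobius f g.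
Proof.
move=> Hf Hg; split=> [h|h]; last first.
  move=> u Hu; rewrite (extension_congr (g := g) u); last first.
    by move=> k k2; exact: moebius_fourier Hf.1 Hg.1 h k2.
  by exists 0; apply: aeW => x; rewrite addr0.
apply: (fourier_moebius Hf.1 Hg.1) => -[//|[//|k]] _.
have H1 := @Hplus_emode R 1 isT.
have e := fourier_eqH (extension_L2 Hf H1) (extension_L2 Hg H1) (h _ H1) (@negz_neq0 k.+1 isT).
have e1 := etrans (esym (extension_coef Hf (ltnSn 0) (ltn0Sn k)))
  (etrans e (extension_coef Hg (ltnSn 0) (ltn0Sn k))).
rewrite addn1 mulr1 in e1.
have i2 : - 'i%C * 'i%C = 1 :> R[i] by apply: cplx_eq; reim; ring.
by rewrite -[LHS]mul1r -[RHS]mul1r -i2 -!mulrA e1.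
Qed.

End Moebius.

(** * Density of the smooth fields *)

Section Density.
Context {R : realType}.
Implicit Types (f A : R -> R) (k N : nat) (n : int).

Lemma cderiv_sum (r : seq nat) (F F' : nat -> R -> R[i]) :
  (forall k, cderiv (F k) (F' k)) ->
  cderiv (fun x => \sum_(k <- r) F k x) (fun x => \sum_(k <- r) F' k x).
Proof.
move=> FF; elim: r => [|k r IH].
  rewrite (_ : (fun x => _) = fun=> 0); last by apply/funext => x; rewrite big_nil.
  by apply: eq_cderiv (cderiv_cst 0) _ => x; rewrite big_nil.
rewrite (_ : (fun x => _) = fun x => F k x + \sum_(j <- r) F j x); last first.
  by apply/funext => x; rewrite big_cons.
by apply: eq_cderiv (cderivD (FF k) IH) _ => x; rewrite big_cons.
Qed.

Definition real_trig (c : nat -> R[i]) N (x : R) : R :=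
  complex.Re (\sum_(1 <= k < N) c k * emode k%:Z x).

(** The derivative of order j multiplies the coefficient at k by (i k)^j, which
    leaves a finite sum of the same kind. *)
Lemma smooth_real_trig c N : smooth_field (real_trig c N).
Proof.
split.
  move=> x; rewrite /real_trig; congr complex.Re; apply: eq_bigr => k _.
  by rewrite emode_periodic.
pose U j x := \sum_(1 <= k < N) c k * ('i%C * (k%:Z%:~R : R)%:C) ^+ j * emode k%:Z x.
have := @smooth_tower R (fun j x => complex.Re (U j x)).
rewrite (_ : (fun x => complex.Re (U 0%N x)) = real_trig c N); last first.
  apply/funext => x; congr complex.Re; apply: eq_bigr => k _.
  by rewrite expr0 mulr1.
apply=> j x.
have h k : cderiv (fun x => c k * ('i%C * (k%:Z%:~R : R)%:C) ^+ j * emode k%:Z x)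
   (fun x => c k * ('i%C * (k%:Z%:~R : R)%:C) ^+ j.+1 * emode k%:Z x).
  apply: eq_cderiv (cderivM (cderiv_cst _) (cderiv_emode k%:Z)) _ => y.
  by rewrite mul0r add0r exprSr !mulrA.
by have [] := cderiv_sum (index_iota 1 N) h x.
Qed.

(** For the coefficients of a real function, twice the real part of the positive
    half of a Fourier sum is the whole sum. *)
Lemma real_trigE (c : int -> R[i]) N x :
  (forall n, c (- n) = (c n)^*%C) ->
  (real_trig (fun k => 2 * c k%:Z) N x)%:C =
  \sum_(1 <= k < N) (c k%:Z * emode k%:Z x + c (- k%:Z) * emode (- k%:Z) x).
Proof.
move=> cJ; apply: cplx_eq; reim.
  rewrite /real_trig 2!Re_sum; apply: eq_bigr => k _.
  by rewrite cJ emodeNJ natC; reim; ring.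
rewrite Im_sum big1// => k _.
by rewrite cJ emodeNJ; reim; ring.
Qed.

(** Three derivatives give |f^(n)|^2 = O(n^-6), more than the weight n^3
    requires. *)
Lemma smooth_H32 A : smooth_field A -> H32 A.
Proof.
move=> sA; pose U j x := (derive1n j A x)%:C.
have pU j : Defs.periodic (U j) by move=> x; rewrite /U (smooth_periodic j sA).
have cU j : ccont (U j) by apply: ccont_real; apply: smooth_continuous sA.2.
have LA : circle_L2 (fun x => (A x)%:C) by exact: (L2_ccont (pU 0%N) (cU 0%N)).
split=> //.
have [M M0 hM] := smooth_bounded 3 sA.
have dec n : `|n|%N%:R ^+ 6 * sqnormc (fourier (U 0%N) n) <= 2 * M ^+ 2.
  have dU j : cderiv (U j) (U j.+1).
    by apply: cderiv_real => x; exact: smooth_deriv sA.2.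
  apply: (@fourier_decay R U 3 n M (fun j _ => pU j) (fun j _ => dU j) (cU 3%N) M0).
  move=> x; rewrite /U sqnormcC.
  by rewrite -[leLHS]real_normK ?num_real// lerXn2r ?nnegrE.
have E3 (w : R -> R[i]) : sobolev 3 w = nsum 1 (fun k => k%:R ^+ 3 * mode_energy w k).
  exact: sobolevE.
rewrite (E3 (U 0%N)).
have i0 k : 0 <= (k%:R ^+ 2)^-1 :> R by rewrite invr_ge0 sqr_ge0.
have M4 : 0 <= 4 * M ^+ 2 by rewrite mulr_ge0 ?sqr_ge0.
apply: (@le_lt_trans _ _ (nsum 1 (fun k => 4 * M ^+ 2 * (k%:R ^+ 2)^-1))).
  apply: nsum_le => k; [by rewrite mulr_ge0 ?mode_energy_ge0 ?exprn_ge0|exact: mulr_ge0|].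
  move=> k1; have k0 : 1 <= k%:R :> R by rewrite ler1n.
  have kp : 0 < k%:R :> R by rewrite ltr0n.
  rewrite ler_pdivlMr ?exprn_gt0//.
  have := dec k%:Z; have := dec (- k%:Z); rewrite absz_neg absz_pos /mode_energy.
  have := sqnormc_ge0 (fourier (U 0%N) k%:Z); have := sqnormc_ge0 (fourier (U 0%N) (- k%:Z)).
  set a := sqnormc _; set b := sqnormc _ => a0 b0 h1 h2.
  rewrite mulrAC -exprD.
  apply: (@le_trans _ _ (k%:R ^+ 6 * (b + a))); last by rewrite mulrDr; lra.
  by apply: ler_wpM2r; [exact: addr_ge0|exact: ler_weXn2l].
by rewrite nsumZ// lte_mul_pinfty ?lee_fin// nsum_invsq.
Qed.

(** Subtracting the partial sums of the Fourier series leaves a tail of the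
    convergent series [wp_sum]. *)
Lemma smooth_fields_dense : @smooth_dense R.
Proof.
split; first exact: smooth_H32.
move=> f Hf eps eps0; have Lf := Hf.1.
pose q k := (k ^ 3 - k)%N%:R * sqnormc (fourierR f (- k%:Z)).
have q0 k : 0 <= q k by rewrite mulr_ge0 ?sqnormc_ge0.
have [N N2 hN] := nsum_tail q0 (wp_sum_fin Hf) eps0.
pose A := real_trig (fun k => 2 * fourierR f k%:Z) N.
have sA : smooth_field A by exact: smooth_real_trig.
exists A; split=> //.
have LA := (smooth_H32 sA).1.
have fA n : fourierR A n =
    fourier (fun x => \sum_(1 <= k < N) (fourierR f k%:Z * emode k%:Z x +
      fourierR f (- k%:Z) * emode (- k%:Z) x)) n.
  apply: eq_fourier => x; apply: real_trigE => m; exact: fourierR_conj.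
pose p k := (k ^ 3 - k)%N%:R * sqnormc (fourierR (fun x => f x - A x) (- k%:Z)).
have p0 k : 0 <= p k by rewrite mulr_ge0 ?sqnormc_ge0.
have pE : wp_sum (fun x => f x - A x) = nsum 2 p by [].
rewrite pE (nsum_split p0 N2) big_nat big1 => [|k /andP[k2 kN]]; last first.
  rewrite /p (fourierR_B _ Lf LA) fA.
  rewrite (@fourier_partial R (fourierR f) N (- k%:Z)) ?subrr ?sqnormc0 ?mulr0//.
    by rewrite absz_neg.
  by apply: negz_neq0; apply: leq_trans k2.
rewrite add0e (@eq_nsum _ _ _ q); first exact: hN.
move=> k Nk; rewrite /p (fourierR_B _ Lf LA) fA.
rewrite (@fourier_partial_out R (fourierR f) N (- k%:Z)) ?subr0 ?absz_neg//.
by apply: negz_neq0; apply: leq_trans (leq_trans N2 Nk).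
Qed.

End Density.

(** * Completeness of the Weil-Petersson tangent space *)

Section Completeness.
Context {R : realType}.
Implicit Types (f : R -> R) (a : nat -> R[i]) (k m N : nat) (n : int).

Definition ccvg (s : nat -> R[i]) (z : R[i]) :=
  ((fun m => complex.Re (s m)) @ \oo --> complex.Re z) /\
  ((fun m => complex.Im (s m)) @ \oo --> complex.Im z).

Lemma real_cauchy_cvg (x : nat -> R) :
  (forall eps : R, 0 < eps -> exists N, forall m k, (N <= m)%N -> (N <= k)%N ->
     (x m - x k) ^+ 2 < eps) -> cvgn x.
Proof.
move=> h; apply/cauchy_cvgP/cauchy_exP => eps eps0.
have [N hN] := h (eps ^+ 2) (exprn_gt0 _ eps0).
exists (x N); exists N => //= m Nm.
rewrite /ball/= -(ltr_pXn2r (n := 2)) ?nnegrE//; last exact: ltW.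
by rewrite real_normK ?num_real//; exact: hN.
Qed.

Lemma complex_cauchy_cvg (s : nat -> R[i]) :
  (forall eps : R, 0 < eps -> exists N, forall m k, (N <= m)%N -> (N <= k)%N ->
     sqnormc (s m - s k) < eps) -> exists z, ccvg s z.
Proof.
move=> h.
have cr : cvgn (fun m => complex.Re (s m)).
  apply: real_cauchy_cvg => eps /h[N hN]; exists N => m k mN kN.
  rewrite -cReN -cReD; apply: le_lt_trans (hN m k mN kN); exact: Re_le_sqnormc.
have ci : cvgn (fun m => complex.Im (s m)).
  apply: real_cauchy_cvg => eps /h[N hN]; exists N => m k mN kN.
  rewrite -cImN -cImD; apply: le_lt_trans (hN m k mN kN); exact: Im_le_sqnormc.
by exists (limn (fun m => complex.Re (s m)) +i* limn (fun m => complex.Im (s m))).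
Qed.

Lemma weighted_cvg (r : seq nat) (w : nat -> R) (s : nat -> nat -> R[i]) (z b : nat -> R[i]) :
  (forall k, k \in r -> ccvg (s k) (z k)) ->
  (fun m => \sum_(k <- r) w k * sqnormc (b k - s k m)) @ \oo -->
  \sum_(k <- r) w k * sqnormc (b k - z k).
Proof.
elim: r => [|k r IH] h.
  rewrite (_ : (fun m => _) = fun=> 0); last by apply/funext => m; rewrite big_nil.
  by rewrite big_nil; exact: cvg_cst.
rewrite big_cons.
rewrite (_ : (fun m => _) = fun m => w k * sqnormc (b k - s k m) +
    \sum_(j <- r) w j * sqnormc (b j - s j m)); last first.
  by apply/funext => m; rewrite big_cons.
have [h1 h2] := h k (mem_head _ _).
apply: cvgD; last by apply: IH => j jr; apply: h; rewrite in_cons jr orbT.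
apply: cvgMr.
rewrite (_ : (fun m => _) = fun m =>
  (complex.Re (b k) - complex.Re (s k m)) * (complex.Re (b k) - complex.Re (s k m)) +
  (complex.Im (b k) - complex.Im (s k m)) * (complex.Im (b k) - complex.Im (s k m))); last first.
  by apply/funext => m; rewrite /sqnormc; reim; ring.
rewrite (_ : sqnormc _ =
  (complex.Re (b k) - complex.Re (z k)) * (complex.Re (b k) - complex.Re (z k)) +
  (complex.Im (b k) - complex.Im (z k)) * (complex.Im (b k) - complex.Im (z k))); last first.
  by rewrite /sqnormc; reim; ring.
by apply: cvgD; apply: cvgM; apply: cvgB => //; exact: cvg_cst.
Qed.

(** The conjugate symmetry is that of a real function; the Moebius modes are set
    to 0. *)
Definition real_modes a n : R[i] :=
  match n with
  | Posz k => if (2 <= k)%N then (a k)^*%C else 0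
  | Negz k => if (1 <= k)%N then a k.+1 else 0
  end.

Lemma real_modes_pos a k : real_modes a k%:Z = if (2 <= k)%N then (a k)^*%C else 0.
Proof. by []. Qed.

Lemma real_modes_neg a k : real_modes a (- k%:Z) = if (2 <= k)%N then a k else 0.
Proof. by case: k. Qed.

Lemma weight_sq k : (2 <= k)%N -> k%:R ^+ 2 <= (k ^ 3 - k)%N%:R :> R.
Proof.
move=> k2; rewrite -natrX ler_nat; rewrite leq_subRL; last first.
  by rewrite -{1}(expn1 k) leq_exp2l.
rewrite !expnS expn0 muln1; nia.
Qed.

(** Away from the Moebius modes the weights k^3 - k and k^3 are comparable. *)
Lemma weight_cube k : (2 <= k)%N -> k%:R ^+ 3 <= 2 * (k ^ 3 - k)%N%:R :> R.
Proof.
move=> k2; rewrite -natrX -natrM ler_nat.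
have : (k + (k ^ 3 - k) = k ^ 3)%N by rewrite subnKC// -{1}(expn1 k) leq_exp2l.
have : (2 * k <= k ^ 3)%N.
  rewrite (expnS k 2) mulnC leq_mul2l; apply/orP; right.
  by rewrite expnS expn1; nia.
by move: (k ^ 3)%N (k ^ 3 - k)%N => x y; lia.
Qed.

Section RealModes.
Variable a : nat -> R[i].
Hypothesis fa : (nsum 2 (fun k => (k ^ 3 - k)%N%:R * sqnormc (a k))%R < +oo)%E.

Let q k : R := (k ^ 3 - k)%N%:R * sqnormc (a k).
Let q0 k : 0 <= q k. Proof. by rewrite mulr_ge0 ?sqnormc_ge0. Qed.

Let fq : (nsum 1 q < +oo)%E.
Proof.
rewrite (nsum_split q0 (leqnSn 1)) big_nat1.
by rewrite (_ : q 1%N = 0) ?add0e//; rewrite /q mul0r.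
Qed.

Lemma real_modes_summable : modes_summable (real_modes a).
Proof.
have i0 k : 0 <= (k%:R ^+ 2)^-1 :> R by rewrite invr_ge0 sqr_ge0.
have b0 k : 0 <= 2 * (q k + (k%:R ^+ 2)^-1) by rewrite mulr_ge0 ?addr_ge0.
apply: (@le_lt_trans _ _ (nsum 1 (fun k => 2 * (q k + (k%:R ^+ 2)^-1)))).
  apply: nsum_le => k; [by rewrite addr_ge0 ?nrm1_ge0|exact: b0|move=> k1].
  rewrite real_modes_pos real_modes_neg; case: ifP => k2; last by rewrite nrm1_0 addr0.
  have k0 : 0 < k%:R ^+ 2 :> R by rewrite exprn_gt0// ltr0n.
  have h := nrm1_amgm (a k) k0.
  have h2 : k%:R ^+ 2 * sqnormc (a k) <= q k by rewrite ler_wpM2r ?sqnormc_ge0 ?weight_sq.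
  have -> : nrm1 (a k)^*%C = nrm1 (a k) by rewrite /nrm1; reim; rewrite normrN.
  by lra.
rewrite nsumZ => [|k]; last by rewrite addr_ge0.
rewrite nsumD//; apply: lte_mul_pinfty => //.
by apply: lte_add_pinfty => //; exact: nsum_invsq.
Qed.

Definition real_synth (x : R) : R := complex.Re (synth (real_modes a) x).

(** Each term pairs a mode with its complex conjugate. *)
Lemma real_synthE x : (real_synth x)%:C = synth (real_modes a) x.
Proof.
apply: cplx_eq => //; rewrite cImC /synth /csum; reim.
rewrite (_ : (fun N => _) = fun=> 0) ?lim_cst//; apply/funext => N.
apply: big1 => k _; rewrite real_modes_pos real_modes_neg emodeNJ.
by case: ifP => _; reim; ring.
Qed.

Lemma fourierR_synth n : n != 0 -> fourierR real_synth n = real_modes a n.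
Proof.
move=> n0; apply: etrans (fourier_synth real_modes_summable n0).
by apply: eq_fourier => x; exact: real_synthE.
Qed.

Lemma real_synth_H32 : H32 real_synth.
Proof.
have E : (fun x => (real_synth x)%:C) = synth (real_modes a).
  by apply/funext => x; exact: real_synthE.
split; rewrite E; first exact: L2_synth real_modes_summable.
have E3 (w : R -> R[i]) : sobolev 3 w = nsum 1 (fun k => k%:R ^+ 3 * mode_energy w k).
  exact: sobolevE.
rewrite E3; apply: (@le_lt_trans _ _ (nsum 1 (fun k => 4 * q k))); last first.
  by rewrite nsumZ//; apply: lte_mul_pinfty.
apply: nsum_le => k; [by rewrite mulr_ge0 ?mode_energy_ge0 ?exprn_ge0|exact: mulr_ge0|].
move=> k1; rewrite /mode_energy.
rewrite (fourier_synth real_modes_summable (posz_neq0 k1)).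
rewrite (fourier_synth real_modes_summable (negz_neq0 k1)).
rewrite real_modes_pos real_modes_neg; case: ifP => k2; last first.
  by rewrite sqnormc0 addr0 mulr0 mulr_ge0.
rewrite sqnormcJ /q; have := weight_cube k2; have := sqnormc_ge0 (a k).
move: (sqnormc _) (k%:R ^+ 3) ((k ^ 3 - k)%N%:R : R) => s x w s0 xw.
by have := ler_wpM2r s0 xw; lra.
Qed.

End RealModes.

(** The modes of a Cauchy sequence converge one by one; finite partial sums of
    the squared distance pass to the limit, which bounds the whole sum. *)
Lemma weil_petersson_complete : @wp_complete R.
Proof.
move=> F HF cau.
have LF m := (HF m).1.
pose s k m := fourierR (F m) (- k%:Z).
pose w k : R := (k ^ 3 - k)%N%:R.
have w0 k : 0 <= w k by exact: ler0n.
have wpE i j : wp_sum (fun x => F i x - F j x) =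
    nsum 2 (fun k => w k * sqnormc (s k i - s k j)).
  apply: eq_nsum => k _; congr (_ * sqnormc _).
  exact: fourierR_B (LF i) (LF j).
have t0 i j k : 0 <= w k * sqnormc (s k i - s k j) by rewrite mulr_ge0 ?sqnormc_ge0.
have ex k : (2 <= k)%N -> exists z, ccvg (s k) z.
  move=> k2; apply: complex_cauchy_cvg => eps eps0.
  have [N hN] := cau eps eps0; exists N => i j Ni Nj.
  have := hN i j Ni Nj; rewrite wpE => h; have := le_lt_trans (nsum_term (t0 i j) k2) h.
  rewrite lte_fin; apply: le_lt_trans; rewrite ler_peMl ?sqnormc_ge0//.
  apply: le_trans (weight_sq k2); rewrite -natrX ler1n expn_gt0.
  by rewrite (leq_trans _ k2).
pose a k : R[i] := xget 0 [set z | ccvg (s k) z].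
have ha k : (2 <= k)%N -> ccvg (s k) (a k).
  by move=> /ex[z hz]; rewrite /a; case: xgetP => [y -> //|/(_ z)].
have d0 i k : 0 <= w k * sqnormc (s k i - a k) by rewrite mulr_ge0 ?sqnormc_ge0.
have close (eps : R) : 0 < eps -> exists N, forall i, (N <= i)%N ->
    (nsum 2 (fun k => w k * sqnormc (s k i - a k))%R <= eps%:E)%E.
  move=> eps0; have [N hN] := cau eps eps0; exists N => i Ni.
  apply: nsum_bound => // M.
  have cv : (fun j => \sum_(2 <= k < M) w k * sqnormc (s k i - s k j)) @ \oo -->
      \sum_(2 <= k < M) w k * sqnormc (s k i - a k).
    by apply: weighted_cvg => k; rewrite mem_index_iota => /andP[k2 _]; exact: ha.
  apply: (@cvgr_to_le _ _ _ _ _ _ _ cv); exists N => //= j Nj.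
  rewrite -lee_fin; apply: le_trans (nsum_partial 2 M (t0 i j)) _.
  by apply: ltW; rewrite -wpE; exact: hN.
have fa : (nsum 2 (fun k => w k * sqnormc (a k))%R < +oo)%E.
  have [N hN] := close 1 ltr01.
  have e0 k : 0 <= w k * sqnormc (s k N) by rewrite mulr_ge0 ?sqnormc_ge0.
  apply: (@le_lt_trans _ _ (nsum 2 (fun k =>
    2 * (w k * sqnormc (s k N)) + 2 * (w k * sqnormc (s k N - a k)))%R)).
    apply: nsum_le => k; rewrite ?addr_ge0 ?mulr_ge0 ?sqnormc_ge0// => _.
    have := sqnormcB (s k N) (s k N - a k).
    have -> : s k N - (s k N - a k) = a k by ring.
    move=> h; have := ler_wpM2l (w0 k) h.
    by move: (sqnormc _) (sqnormc _) (sqnormc _) => *; lra.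
  rewrite nsumD => [|k|k]; [|exact: mulr_ge0..].
  rewrite !nsumZ//; apply: lte_add_pinfty; apply: lte_mul_pinfty => //.
    by apply: wp_sum_fin.
  by apply: le_lt_trans (hN N (leqnn N)) _; exact: ltry.
exists (real_synth a); split; first exact: real_synth_H32 fa.
move=> eps eps0; have [N hN] := close (eps / 2) (divr_gt0 eps0 (ltr0Sn R 1)).
exists N => i Ni; apply: (@le_lt_trans _ _ (eps / 2)%:E); last by rewrite lte_fin; lra.
apply: le_trans (hN i Ni); rewrite le_eqVlt; apply/orP; left; apply/eqP.
apply: eq_nsum => k k2; congr (_ * sqnormc _).
apply: etrans (fourierR_B _ (LF i) (real_synth_H32 fa).1) _.
congr (_ - _); apply: etrans (fourierR_synth fa _) _.
  by apply: negz_neq0; apply: leq_trans k2.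
by rewrite real_modes_neg k2.
Qed.

End Completeness.

(** * The extension is unique *)

Section ExtensionUniqueness.
Context {R : realType}.
Implicit Types (f g A : R -> R) (T U : (R -> R[i]) -> R -> R[i]) (k m : nat).
Implicit Types (E : (R -> R) -> (R -> R[i]) -> R -> R[i]).

(** The modes n > 0 of the images vanish, as the images lie in H_-. *)
Lemma op_ext_neg T U : bounded_op Hplus Hminus T -> bounded_op Hplus Hminus U ->
  (forall m k, (0 < m)%N -> (0 < k)%N ->
    fourier (T (emode m%:Z)) (- k%:Z) = fourier (U (emode m%:Z)) (- k%:Z)) ->
  eq_op_plus T U.
Proof.
move=> bT bU TU; apply: op_ext => // m [k|k] m0 n0; last exact: (TU m k.+1).
have [hT _ _] := bT; have [hU _ _] := bU.
have k0 : (0 < k)%N by case: k n0.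
have /HminusP[_ T0] := hT _ (@Hplus_emode R m m0).
have /HminusP[_ U0] := hU _ (@Hplus_emode R m m0).
by apply: etrans (T0 k k0) (esym (U0 k k0)).
Qed.

Lemma HS_coef T m k : bounded_op Hplus Hminus T -> (0 < m)%N -> (0 < k)%N ->
  ((sqnormc (fourier (T (emode m%:Z)) (- k%:Z)))%:E <= m%:R%:E * HS_norm2 T)%E.
Proof.
move=> bT m0 k0.
have F0 j : (0 <= normH2 (T (eplus j)))%E by exact: normH2_ge0.
have h1 : (normH2 (T (eplus m)) <= HS_norm2 T)%E.
  apply: le_trans (@nneseries_lim_ge _ (fun j => normH2 (T (eplus j))) xpredT 1 m.+1
    (fun _ _ _ => F0 _)).
  by rewrite big_nat_recr//= leeDr//; apply: sume_ge0 => j _; exact: F0.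
have h2 := le_trans (normH2_mode (T (eplus m)) (- k%:Z)) h1.
apply: le_trans (lee_wpmul2l _ h2); last by rewrite lee_fin.
rewrite -EFinM lee_fin (op_eplus bT m0 (negz_neq0 k0)) absz_neg.
rewrite (sqnormcM ((Num.sqrt m%:R)^-1)%:C) (@sqnormc_invsqrt R m m0).
set s := sqnormc _; have s0 : 0 <= s by exact: sqnormc_ge0.
have mn : m%:R != 0 :> R by rewrite pnatr_eq0 -lt0n.
rewrite [leRHS](_ : _ = k%:R * s); last by field.
by rewrite ler_peMl// ler1n.
Qed.

(** A bounded linear map is Lipschitz, and the Hilbert-Schmidt norm controls
    every coefficient. *)
Lemma bounded_approx E : bounded_to_HS E -> exists2 K : R, 0 <= K &
  forall f A m k, H32 f -> H32 A -> (0 < m)%N -> (0 < k)%N ->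
  ((sqnormc (fourier (E f (emode m%:Z)) (- k%:Z) - fourier (E A (emode m%:Z)) (- k%:Z)))%:E
    <= (m%:R * K)%:E * wp_sum (fun x => (f x - A x)%R))%E.
Proof.
move=> [hHS _ lin [M hM]]; exists `|M| => // f A m k Hf HA m0 k0.
pose g x := f x - A x.
have Hg : H32 g.
  have := H32_lin (-1) HA Hf; congr H32; apply/funext => x.
  by rewrite /g mulN1r addrC.
have fE : f = (fun x => 1 * g x + A x).
  by apply/funext => x; rewrite /g mul1r subrK.
have He := @Hplus_emode R m m0.
have bf := (hHS _ Hf).1; have bA := (hHS _ HA).1; have bg := (hHS _ Hg).1.
have e := lin 1 g A Hg HA _ He; rewrite -fE in e.
have Lg := op_L2 bg He; have LA := op_L2 bA He.
have h := fourier_eqH (op_L2 bf He) (L2_lin 1%:C Lg LA) e (negz_neq0 k0).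
have {}h := etrans h (fourier_lin 1%:C (- k%:Z) Lg LA).
rewrite h (_ : _ - _ = fourier (E g (emode m%:Z)) (- k%:Z)); last first.
  by rewrite mul1r addrK.
apply: le_trans (HS_coef bg m0 k0) _.
rewrite EFinM -muleA; apply: lee_wpmul2l; first by rewrite lee_fin.
apply: le_trans (hM g Hg) _; apply: lee_wpmul2r; first exact: wp_sum_ge0.
by rewrite lee_fin ler_norm.
Qed.

(** Two continuous maps that agree on the smooth fields agree everywhere, by
    density. *)
Lemma extension_unique Zdot E E' : extends_Zdot Zdot E -> extends_Zdot Zdot E' ->
  forall f, H32 f -> eq_op_plus (E' f) (E f).
Proof.
move=> [bE ZE] [bE' ZE'] f Hf.
have [K K0 hK] := bounded_approx bE; have [K' K0' hK'] := bounded_approx bE'.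
have [hE _ _ _] := bE; have [hE' _ _ _] := bE'.
apply: op_ext_neg (hE' f Hf).1 (hE f Hf).1 _ => m k m0 k0.
apply/eqP; rewrite -subr_eq0; apply/eqP/sqnormc_eq0/eqP; rewrite eq_le sqnormc_ge0 andbT.
apply/ler_addgt0Pr => e e0; rewrite add0r.
pose C := 2 * (m%:R * K') + 2 * (m%:R * K) + 1.
have C1 : 1 <= C by rewrite lerDr !addr_ge0 ?mulr_ge0.
have C0 : 0 < C by apply: lt_le_trans C1.
have [A [sA hA]] := (@smooth_fields_dense R).2 f Hf (e / C) (divr_gt0 e0 C0).
have HA := smooth_H32 sA; have He := @Hplus_emode R m m0.
have E_A : fourier (E' A (emode m%:Z)) (- k%:Z) = fourier (E A (emode m%:Z)) (- k%:Z).
  apply: fourier_eqH (op_L2 (hE' A HA).1 He) (op_L2 (hE A HA).1 He) _ (negz_neq0 k0).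
  have [c1 h1] := ZE' A sA _ He; have [c2 h2] := ZE A sA _ He.
  exists (c1 - c2); apply: aeS (aeI h1 h2) => x [-> ->].
  by ring.
have := hK' f A m k Hf HA m0 k0; have := hK f A m k Hf HA m0 k0; rewrite E_A.
set x := fourier (E f _) _; set y := fourier (E A _) _; set z := fourier (E' f _) _.
move=> h1 h2.
have W c : 0 <= c -> (c%:E * wp_sum (fun x => (f x - A x)%R) <= (c * (e / C))%:E)%E.
  by move=> c0; rewrite EFinM; apply: lee_wpmul2l (ltW hA); rewrite lee_fin.
have {h1} := le_trans h1 (W _ (mulr_ge0 (ler0n _ m) K0)).
have {h2} := le_trans h2 (W _ (mulr_ge0 (ler0n _ m) K0')).
rewrite !lee_fin => h2 h1.
have -> : z - x = (z - y) - (x - y) by ring.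
apply: le_trans (sqnormcB _ _) _.
have eC : e = C * (e / C) by rewrite mulrC divfK// gt_eqF.
have d0 : 0 < e / C by rewrite divr_gt0.
rewrite [leRHS]eC; move: h1 h2 d0; rewrite /C.
move: (sqnormc _) (sqnormc _) (e / _) => p q d; nra.
Qed.

End ExtensionUniqueness.

(** * The Weil-Petersson form of the differential *)

Section DifferentialForm.
Context {R : realType}.
Implicit Types (f g A : R -> R).

Lemma extension_bounded_to_HS : bounded_to_HS (@extension R).
Proof.
split.
- move=> f Hf; split; first exact: extension_bounded.
  rewrite extension_HS//; apply: lte_mul_pinfty => //; exact: wp_sum_fin.
- by move=> f g Hf Hg /(extension_moebius Hf Hg).
- by move=> a f g Hf Hg; exact: extension_linf.
- by exists 6^-1 => f Hf; rewrite extension_HS.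
Qed.

Lemma extension_extends Zdot : (forall A, smooth_field A -> is_Zdot A (Zdot A)) ->
  extends_Zdot Zdot (@extension R).
Proof.
move=> HZ; split; first exact: extension_bounded_to_HS.
move=> A sA; have HA := smooth_H32 sA.
apply: op_ext_neg (extension_bounded HA) (Zdot_bounded sA (HZ A sA)) _ => m k m0 k0.
exact: etrans (extension_coef HA m0 k0) (esym (Zdot_coef sA (HZ A sA) m0 k0)).
Qed.

Lemma Zdot_HS A T : smooth_field A -> is_Zdot A T ->
  HS_norm2 T = ((6^-1)%:E * wp_sum A)%E.
Proof.
move=> sA dT; exact: (@hankel_HS _ _ (fun k => fourierR A (- k%:Z)) (Zdot_bounded sA dT)
  (fun m k => @Zdot_coef _ _ _ sA m k dT)).
Qed.

End DifferentialForm.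

Theorem corollary4p7 (R : realType)
    (Zdot : (R -> R) -> (R -> R[i]) -> (R -> R[i]))
    (HZdot : forall A : R -> R, smooth_field A -> is_Zdot A (Zdot A))
    (WP : (R -> R) -> \bar R) (HWP : weil_petersson_form WP) :
  [/\ forall A : R -> R, smooth_field A ->
        HS_norm2 (Zdot A) = ((6^-1)%:E * wp_sum A)%E,
      @smooth_dense R, @wp_complete R &
      exists E : (R -> R) -> (R -> R[i]) -> (R -> R[i]),
        [/\ extends_Zdot Zdot E,
            forall E', extends_Zdot Zdot E' ->
              forall f : R -> R, H32 f -> eq_op_plus (E' f) (E f),
            forall f : R -> R, H32 f ->
              HS_norm2 (E f) = ((6^-1)%:E * wp_sum f)%E,
            exists k : R, 0 < k /\ forall f : R -> R, H32 f ->
              HS_norm2 (E f) = (k%:E * WP f)%E &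
            forall f g : R -> R, H32 f -> H32 g ->
              (eq_op_plus (E f) (E g) <-> eq_mod_mobius f g)]].
Proof.
have HE := extension_extends HZdot.
split.
- by move=> A sA; exact: Zdot_HS sA (HZdot A sA).
- exact: smooth_fields_dense.
- exact: weil_petersson_complete.
exists extension; split=> //.
- by move=> E' HE'; exact: extension_unique HE HE'.
- exact: extension_HS.
- have [c [c0 hc]] := HWP; exists (6^-1 / c); split; first by rewrite divr_gt0.
  move=> f Hf; rewrite (extension_HS Hf) (hc f Hf) muleA -EFinM.
  by rewrite divfK// gt_eqF.
- exact: extension_moebius.
Qed.
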